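(* For $d,k,n\ge 0$ there is an isomorphism of $\mathrm{GL}(V_n)$-modules $$B_{d,k}(n)\cong\bigoplus_{\pi=((a_1,d_1,k_1),\dots,(a_l,d_l,k_l))\in\Pi(d,k)}\ \left(\bigotimes_{i=1}^{l}\mathrm{Sym}^{a_i}\bigl(B^c_{d_i,k_i}(n)\bigr)\right).$$
   Context: $\mathbb K$ is a field of characteristic $0$, $V_n$ an $n$-dimensional $\mathbb K$-vector space. $B_{d,k}(n)$ is the $\mathbb K$-vector space spanned by open Jacobi diagrams (finite uni-trivalent graphs with a cyclic order on the half-edges at each trivalent vertex, each connected component having at least one univalent vertex) of degree $d$ (half the number of vertices) with exactly $k$ trivalent vertices, whose univalent vertices are colored by elements of $V_n$, modulo AS, IHX and multilinearity in the colors; $\mathrm{GL}(V_n)$ acts on the colors. $B^c_{d,k}(n)\subset B_{d,k}(n)$ is the subspace spanned by connected diagrams. A pair $(d,k)$ with $d\ge1$, $k\ge0$ is good if $d-1\le k\le 2d-2$. $\Pi(d,k)$ is the set of decompositions of $(d,k)$ into good pairs: finite sequences $((a_1,d_1,k_1),\dots,(a_l,d_l,k_l))$ of triples of integers with each $(d_i,k_i)$ good, $a_i\ge1$, $\sum_i a_id_i=d$, $\sum_i a_ik_i=k$, and $(d_1,k_1)>(d_2,k_2)>\cdots>(d_l,k_l)$ in the lexicographic order (the empty sequence being allowed when $d=k=0$, with empty tensor product $\mathbb K$). *)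

(* Defs.v *)
From HB Require Import structures.
From mathcomp Require Import all_boot all_order all_fingroup all_algebra.
From mathcomp Require Import all_classical.
From mathcomp Require Import generic_quotient ring_quotient freeg.

Set Implicit Arguments.
Unset Strict Implicit.
Unset Printing Implicit Defensive.

Import GRing.Theory.
Import ring_quotient.Quotient.

Local Open Scope ring_scope.
Local Open Scope quotient_scope.
Local Open Scope classical_set_scope.

Section Span.
Context (K : fieldType) (V : lmodType K).

Inductive lspan (A : set V) : V -> Prop :=
| lspan0 : lspan A 0
| lspan_cons a x y : A x -> lspan A y -> lspan A (a *: x + y).

(* Classical, so that arbitrary subspaces are decidable and have quotients. *)
Definition in_span (A : set V) : {pred V} := fun x => `[< lspan A x >].

Lemma lspan_mem (A : set V) x : A x -> lspan A x.
Proof.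
by move=> Ax; rewrite -[x]scale1r -[_ *: _]addr0; apply/lspan_cons/lspan0.
Qed.

Lemma lspan_lin (A : set V) a x y :
  lspan A x -> lspan A y -> lspan A (a *: x + y).
Proof.
move=> Ax Ay; elim: Ax => [|b u v Au _ IH]; first by rewrite scaler0 add0r.
by rewrite scalerDr scalerA -addrA; apply: lspan_cons.
Qed.

Lemma in_span_submod (A : set V) : submod_closed (in_span A).
Proof.
split=> [|a x y]; first exact/asboolP/lspan0.
by rewrite !unfold_in => /asboolP Ax /asboolP Ay; apply/asboolP/lspan_lin.
Qed.

HB.instance Definition _ (A : set V) :=
  GRing.isSubmodClosed.Build K V (in_span A) (in_span_submod A).

End Span.

Lemma lspan_sub (K : fieldType) (V W : lmodType K) (f : {linear V -> W})
    (A : set V) (B : set W) :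
  (forall x, A x -> lspan B (f x)) -> forall x, lspan A x -> lspan B (f x).
Proof.
move=> AB x; elim=> [|a u v Au _ IH]; first by rewrite linear0; apply: lspan0.
by rewrite linearP; apply: lspan_lin; first exact: AB.
Qed.

Section LinearQuotient.
Context (K : fieldType) (V : lmodType K) (A : set V).

Definition lquot := {quot (in_span A)}.
HB.instance Definition _ := Choice.on lquot.
HB.instance Definition _ := GRing.Zmodule.on lquot.

Definition lproj (x : V) : lquot := \pi_{quot (in_span A)} x.

Lemma lprojP x y : reflect (lspan A (x - y)) (lproj x == lproj y).
Proof. by rewrite /lproj -idealrBE; apply: asboolP. Qed.

Lemma lprojK : cancel (repr : lquot -> V) lproj.
Proof. exact: reprK. Qed.

Lemma lprojB : zmod_morphism lproj.
Proof. by move=> x y; rewrite /lproj !piE. Qed.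

Definition lquot_scale (a : K) (x : lquot) : lquot := lproj (a *: repr x).

Lemma lproj_scale a x : lproj (a *: x) = lquot_scale a (lproj x).
Proof.
apply/eqP/lprojP; rewrite -scalerBr -[_ *: _]addr0.
by apply: lspan_lin (lspan0 _); apply/lprojP; rewrite lprojK.
Qed.

HB.instance Definition _ := GRing.isZmodMorphism.Build V lquot lproj lprojB.

Lemma lprojD x y : lproj (x + y) = lproj x + lproj y.
Proof. exact: raddfD. Qed.

Lemma lquot_scaleA a b x : lquot_scale a (lquot_scale b x) = lquot_scale (a * b) x.
Proof. by rewrite -[x]lprojK -!lproj_scale scalerA. Qed.
Lemma lquot_scale1 x : lquot_scale 1 x = x.
Proof. by rewrite -[x]lprojK -!lproj_scale scale1r. Qed.
Lemma lquot_scaleDr a : {morph lquot_scale a : x y / x + y}.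
Proof.
move=> x y; rewrite -[x]lprojK -[y]lprojK -lprojD -!lproj_scale scalerDr.
exact: lprojD.
Qed.
Lemma lquot_scaleDl x : {morph lquot_scale^~ x : a b / a + b}.
Proof. by move=> a b; rewrite -[x]lprojK -!lproj_scale scalerDl lprojD. Qed.

HB.instance Definition _ := GRing.Zmodule_isLmodule.Build K lquot
  lquot_scaleA lquot_scale1 lquot_scaleDr lquot_scaleDl.
HB.instance Definition _ := GRing.isScalable.Build K V lquot *:%R lproj lproj_scale.

Lemma lproj_eq0 x : lspan A x -> lproj x = 0.
Proof. by move=> Ax; rewrite -(linear0 lproj); apply/eqP/lprojP; rewrite subr0. Qed.

End LinearQuotient.

Section LinearSub.
Context (K : fieldType) (V : lmodType K) (A : set V).

Definition lsub := {x : V | in_span A x}.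
HB.instance Definition _ := Choice.on lsub.
HB.instance Definition _ := SubChoice.on lsub.
HB.instance Definition _ := [SubChoice_isSubLmodule of lsub by <:].

End LinearSub.

Record rep (K : fieldType) (G : groupType) := Rep {
  rep_mod :> lmodType K;
  rep_act : G -> {linear rep_mod -> rep_mod};
  rep_act1 : forall x, rep_act 1%g x = x;
  rep_actM : forall g h x, rep_act (g * h)%g x = rep_act g (rep_act h x)
}.

Definition rep_isomorphic (K : fieldType) (G : groupType) (M N : rep K G) :=
  exists f : {linear M -> N},
    bijective f /\ forall (g : G) (x : M), f (rep_act M g x) = rep_act N g (f x).

Section FreeRep.
Context (K : fieldType) (G : groupType) (X : choiceType).

Lemma fglift_linear (M : lmodType K) (f : X -> M) :
  linear (fglift f : {freeg X / K} -> M).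
Proof.
pose F : {additive {freeg X / K} -> M} :=
  HB.pack (fglift f) (GRing.isZmodMorphism.Build _ _ (fglift f) (lift_is_additive f)).
move=> a u v; rewrite -[fglift f]/(F : _ -> _) raddfD; congr (_ + _).
rewrite -[X in F (a *: X)]freeg_sumE -[X in _ = a *: F X]freeg_sumE.
rewrite scaler_sumr !(raddf_sum F) scaler_sumr.
apply: eq_bigr => x _; have -> : a *: << coeff x u *g x >> =
    << a * coeff x u *g x >> :> {freeg X / K}.
  by apply/eqP/freeg_eqP => y; rewrite coeffZ !coeffU mulrA.
by rewrite /= !liftU scalerA.
Qed.

Definition free_lift (M : lmodType K) (f : X -> M) : {linear {freeg X / K} -> M} :=
  HB.pack (fglift f : {freeg X / K} -> M)
    (GRing.isLinear.Build K {freeg X / K} M *:%R (fglift f) (fglift_linear f)).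

Lemma free_liftU (M : lmodType K) (f : X -> M) x : free_lift f << x >> = f x.
Proof. by rewrite /= liftU scale1r. Qed.

Lemma free_ext (M : lmodType K) (f h : {linear {freeg X / K} -> M}) :
  (forall x, f << x >> = h << x >>) -> f =1 h.
Proof.
move=> fh u; rewrite -(freeg_sumE u) !linear_sum; apply: eq_bigr => x _ /=.
have -> : << coeff x u *g x >> = coeff x u *: << x >> :> {freeg X / K}.
  by apply/eqP/freeg_eqP => y; rewrite coeffZ !coeffU mul1r.
by rewrite !linearZ /= fh.
Qed.

Context (act : G -> X -> X).
Hypothesis act1 : forall x, act 1%g x = x.
Hypothesis actM : forall g h x, act (g * h)%g x = act g (act h x).

Definition free_act (g : G) : {linear {freeg X / K} -> {freeg X / K}} :=
  free_lift (fun x => << act g x >> : {freeg X / K}).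

Lemma free_actU g x : free_act g << x >> = << act g x >>.
Proof. exact: free_liftU. Qed.

Lemma free_act1 x : free_act 1%g x = x.
Proof. by apply: (free_ext (h := idfun)) => y; rewrite free_actU act1. Qed.

Lemma free_actM g h x : free_act (g * h)%g x = free_act g (free_act h x).
Proof.
apply: (free_ext (h := free_act g \o free_act h)) => y.
by rewrite -[RHS]/(free_act g (free_act h << y >>)) !free_actU actM.
Qed.

Definition free_rep : rep K G := Rep free_act1 free_actM.

Lemma free_repU g x : rep_act free_rep g << x >> = << act g x >>.
Proof. exact: free_actU. Qed.

End FreeRep.

Definition rep_stable (K : fieldType) (G : groupType) (M : rep K G) (A : set M) :=
  forall (g : G) x, A x -> lspan A (rep_act M g x).

Section QuotSubRep.
Context (K : fieldType) (G : groupType) (M : rep K G) (A : set M).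
Hypothesis stableA : rep_stable A.

Definition quot_act_fun (g : G) (x : lquot A) : lquot A :=
  lproj A (rep_act M g (repr x)).

Lemma quot_act_proj g x : quot_act_fun g (lproj A x) = lproj A (rep_act M g x).
Proof.
apply/eqP/lprojP; rewrite -linearB; apply: (lspan_sub (@stableA g)).
by apply/lprojP; rewrite lprojK.
Qed.

Lemma quot_act_linear g : linear (quot_act_fun g).
Proof.
move=> a x y; rewrite -[x]lprojK -[y]lprojK -linearP !quot_act_proj.
by rewrite !linearP.
Qed.

Definition quot_act (g : G) : {linear lquot A -> lquot A} :=
  HB.pack (quot_act_fun g)
    (GRing.isLinear.Build K (lquot A) (lquot A) *:%R _ (quot_act_linear g)).

Lemma quot_act1 x : quot_act 1%g x = x.
Proof. by rewrite -[x]lprojK [LHS]quot_act_proj rep_act1. Qed.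

Lemma quot_actM g h x : quot_act (g * h)%g x = quot_act g (quot_act h x).
Proof. by rewrite -[x]lprojK /= !quot_act_proj rep_actM. Qed.

Definition quot_rep : rep K G := Rep quot_act1 quot_actM.

Lemma quot_rep_proj g x : rep_act quot_rep g (lproj A x) = lproj A (rep_act M g x).
Proof. exact: quot_act_proj. Qed.

Lemma sub_act_subproof g (x : lsub A) : in_span A (rep_act M g (val x)).
Proof. by apply/asboolP/(lspan_sub (@stableA g))/asboolP/(valP x). Qed.

Definition sub_act_fun (g : G) (x : lsub A) : lsub A := Sub _ (sub_act_subproof g x).

Lemma sub_act_linear g : linear (sub_act_fun g).
Proof. by move=> a x y; apply: val_inj; rewrite /= !linearP. Qed.

Definition sub_act (g : G) : {linear lsub A -> lsub A} :=
  HB.pack (sub_act_fun g)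
    (GRing.isLinear.Build K (lsub A) (lsub A) *:%R _ (sub_act_linear g)).

Lemma sub_act1 x : sub_act 1%g x = x.
Proof. by apply: val_inj; rewrite /= rep_act1. Qed.

Lemma sub_actM g h x : sub_act (g * h)%g x = sub_act g (sub_act h x).
Proof. by apply: val_inj; rewrite /= rep_actM. Qed.

Definition sub_rep : rep K G := Rep sub_act1 sub_actM.

End QuotSubRep.

Section Tensor.
Context (K : fieldType) (G : groupType) (l : nat) (M : 'I_l -> rep K G).

Definition family := {dffun forall i : 'I_l, M i}.

Definition family_upd (x : family) (i : 'I_l) (y : M i) : family :=
  finfun (dfwith x i y).

Definition family_act (g : G) (x : family) : family :=
  [ffun i => rep_act (M i) g (x i)].

Lemma family_act1 x : family_act 1%g x = x.
Proof. by apply/ffunP => i; rewrite ffunE rep_act1. Qed.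
Lemma family_actM g h x : family_act (g * h)%g x = family_act g (family_act h x).
Proof. by apply/ffunP => i; rewrite !ffunE rep_actM. Qed.

Definition family_rep : rep K G := free_rep K family_act1 family_actM.

Inductive multilinearity : set family_rep :=
| Multilinear (x : family) (i : 'I_l) (a : K) (y z : M i) :
    multilinearity (<< family_upd x (a *: y + z) >>
                    - (a *: << family_upd x y >> + << family_upd x z >>)).

Lemma family_act_upd g x i (y : M i) :
  family_act g (family_upd x y) = family_upd (family_act g x) (rep_act (M i) g y).
Proof.
apply/ffunP => j; rewrite !ffunE; have [-> | ij] := eqVneq j i.
  by rewrite !dfwithin.
by rewrite !dfwithout 1?eq_sym // ffunE.
Qed.

Lemma multilinearity_stable : rep_stable multilinearity.
Proof.
move=> g _ [x i a y z]; apply: lspan_mem.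
rewrite linearB linearP !free_repU !family_act_upd linearP.
exact: Multilinear.
Qed.

Definition tensor : rep K G := quot_rep multilinearity_stable.

Definition ptensor (x : family) : tensor :=
  lproj multilinearity (<< x >> : {freeg family / K}).

Lemma ptensor_act g x : rep_act tensor g (ptensor x) = ptensor (family_act g x).
Proof. by rewrite [LHS]quot_rep_proj free_repU. Qed.

End Tensor.

Section SymmetricPower.
Context (K : fieldType) (G : groupType) (a : nat) (M : rep K G).

Definition tensor_power : rep K G := tensor (fun _ : 'I_a => M).

Definition family_perm (s : 'S_a) (x : family (fun _ : 'I_a => M)) :
  family (fun _ : 'I_a => M) := [ffun i => x (s i)].

Inductive symmetry : set tensor_power :=
| Symmetry (x : family (fun _ : 'I_a => M)) (s : 'S_a) :
    symmetry (ptensor (family_perm s x) - ptensor x).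

Lemma symmetry_stable : rep_stable symmetry.
Proof.
move=> g _ [x s]; apply: lspan_mem; rewrite linearB !ptensor_act.
have -> : family_act g (family_perm s x) = family_perm s (family_act g x).
  by apply/ffunP => i; rewrite !ffunE.
exact: Symmetry.
Qed.

Definition Sym : rep K G := quot_rep symmetry_stable.

End SymmetricPower.

Section DirectSum.
Context (K : fieldType) (G : groupType) (I : choiceType) (M : I -> rep K G).

Definition finsupp_family (f : forall i, M i) : bool :=
  `[< finite_set [set i | f i <> 0] >].

Definition dsum_mod := {f : forall i, M i | finsupp_family f}.
HB.instance Definition _ := Choice.on dsum_mod.

Definition dsum_coord (f : dsum_mod) : forall i, M i := val f.

Lemma dsum_ext (f g : dsum_mod) : (forall i, dsum_coord f i = dsum_coord g i) -> f = g.
Proof. by move=> fg; apply/val_inj/functional_extensionality_dep. Qed.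

Lemma finsupp_map (f : dsum_mod) (h : forall i, M i -> M i) :
  (forall i, h i 0 = 0) -> finsupp_family (fun i => h i (dsum_coord f i)).
Proof.
move=> h0; apply/asboolP; have /asboolP := valP f; apply: sub_finite_set => i /=.
by move=> hi fi; apply: hi; rewrite [dsum_coord f i]fi h0.
Qed.

Lemma finsupp_add (f g : dsum_mod) :
  finsupp_family (fun i => dsum_coord f i + dsum_coord g i).
Proof.
apply/asboolP; have /asboolP ff := valP f; have /asboolP fg := valP g.
have : finite_set ([set i | val f i <> 0] `|` [set i | val g i <> 0]).
  by rewrite finite_setU.
apply: sub_finite_set => i /= fgi.
have [fi0|] := pselect (val f i = 0); last by left.
by right=> gi0; apply: fgi; rewrite [dsum_coord f i]fi0 [dsum_coord g i]gi0 addr0.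
Qed.

Lemma finsupp0 : finsupp_family (fun i => 0 : M i).
Proof.
apply/asboolP; rewrite (_ : [set _ | _] = set0); first exact: finite_set0.
by apply/seteqP; split=> i.
Qed.

Definition dsum_zero : dsum_mod := Sub _ finsupp0.
Definition dsum_add (f g : dsum_mod) : dsum_mod := Sub _ (finsupp_add f g).
Definition dsum_opp (f : dsum_mod) : dsum_mod :=
  Sub _ (finsupp_map (h := fun i => -%R) f (fun i => oppr0 _)).
Definition dsum_scale (a : K) (f : dsum_mod) : dsum_mod :=
  Sub _ (finsupp_map (h := fun i => *:%R a) f (fun i => scaler0 _ a)).

Lemma dsum_addA : associative dsum_add.
Proof. by move=> f g h; apply: dsum_ext => i; apply: addrA. Qed.
Lemma dsum_addC : commutative dsum_add.
Proof. by move=> f g; apply: dsum_ext => i; apply: addrC. Qed.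
Lemma dsum_add0 : left_id dsum_zero dsum_add.
Proof. by move=> f; apply: dsum_ext => i; apply: add0r. Qed.
Lemma dsum_addN : left_inverse dsum_zero dsum_opp dsum_add.
Proof. by move=> f; apply: dsum_ext => i; apply: addNr. Qed.
HB.instance Definition _ := GRing.isZmodule.Build dsum_mod
  dsum_addA dsum_addC dsum_add0 dsum_addN.

Lemma dsum_scaleA a b f : dsum_scale a (dsum_scale b f) = dsum_scale (a * b) f.
Proof. by apply: dsum_ext => i; apply: scalerA. Qed.
Lemma dsum_scale1 f : dsum_scale 1 f = f.
Proof. by apply: dsum_ext => i; apply: scale1r. Qed.
Lemma dsum_scaleDr a : {morph dsum_scale a : f g / f + g}.
Proof. by move=> f g; apply: dsum_ext => i; apply: scalerDr. Qed.
Lemma dsum_scaleDl f : {morph dsum_scale^~ f : a b / a + b}.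
Proof. by move=> a b; apply: dsum_ext => i; apply: scalerDl. Qed.
HB.instance Definition _ := GRing.Zmodule_isLmodule.Build K dsum_mod
  dsum_scaleA dsum_scale1 dsum_scaleDr dsum_scaleDl.

Definition dsum_act_fun (g : G) (f : dsum_mod) : dsum_mod :=
  Sub _ (finsupp_map (h := fun i => rep_act (M i) g) f (fun i => linear0 _)).

Lemma dsum_act_linear g : linear (dsum_act_fun g).
Proof. by move=> a f h; apply: dsum_ext => i; apply: linearP. Qed.

Definition dsum_act (g : G) : {linear dsum_mod -> dsum_mod} :=
  HB.pack (dsum_act_fun g)
    (GRing.isLinear.Build K dsum_mod dsum_mod *:%R _ (dsum_act_linear g)).

Lemma dsum_act1 x : dsum_act 1%g x = x.
Proof. by apply: dsum_ext => i; apply: rep_act1. Qed.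
Lemma dsum_actM g h x : dsum_act (g * h)%g x = dsum_act g (dsum_act h x).
Proof. by apply: dsum_ext => i; apply: rep_actM. Qed.

Definition dsum : rep K G := Rep dsum_act1 dsum_actM.

End DirectSum.

Section GeneralLinear.
Context (K : fieldType) (V : vectType K).

Definition GL := {f : 'End(V) | lker f == 0%VS}.
HB.instance Definition _ := SubChoice.on GL.

Lemma GL_one_subproof : lker (\1%VF : 'End(V)) == 0%VS.
Proof. by apply/lker0P => x y; rewrite !id_lfunE. Qed.
Lemma GL_mul_subproof (f g : GL) : lker (val f \o val g)%VF == 0%VS.
Proof.
have [/lker0P injf /lker0P injg] := (valP f, valP g).
by apply/lker0P => x y; rewrite !comp_lfunE => /injf/injg.
Qed.
Lemma GL_inv_subproof (f : GL) : lker (val f)^-1%VF == 0%VS.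
Proof. by apply/lker0P; apply: can_inj (lker0_lfunVK (valP f)). Qed.

Definition GL_one : GL := Sub (\1%VF : 'End(V)) GL_one_subproof.
Definition GL_mul (f g : GL) : GL := Sub (val f \o val g)%VF (GL_mul_subproof f g).
Definition GL_inv (f : GL) : GL := Sub (val f)^-1%VF (GL_inv_subproof f).

Lemma GL_mulA : associative GL_mul.
Proof. by move=> f g h; apply: val_inj; apply: comp_lfunA. Qed.
Lemma GL_mul1g : left_id GL_one GL_mul.
Proof. by move=> f; apply: val_inj; apply: comp_lfun1l. Qed.
Lemma GL_mulg1 : right_id GL_one GL_mul.
Proof. by move=> f; apply: val_inj; apply: comp_lfun1r. Qed.
Lemma GL_mulVg : left_inverse GL_one GL_inv GL_mul.
Proof. by move=> f; apply: val_inj; apply: lker0_compVf (valP f). Qed.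
Lemma GL_mulgV : right_inverse GL_one GL_inv GL_mul.
Proof. by move=> f; apply: val_inj; apply: lker0_compfV (valP f). Qed.

HB.instance Definition _ := isGroup.Build GL
  GL_mulA GL_mul1g GL_mulg1 GL_mulVg GL_mulgV.

End GeneralLinear.

(* A uni-trivalent graph with k trivalent and u univalent vertices is encoded by
   its set of half-edges: (i, 0), (i, 1), (i, 2), in this cyclic order, at the
   i-th trivalent vertex and a single one at each univalent vertex.  The edges
   are the orbits of a fixed-point-free involution.  Every diagram is isomorphic
   to one of this form, and the choices made (numbering of the vertices, first
   half-edge at each trivalent vertex) are undone by [Rel_iso] below. *)
Section Graph.
Context (k u : nat).

Definition halfedge : finType := ('I_k * 'I_3 + 'I_u)%type.
Definition vertex : finType := ('I_k + 'I_u)%type.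

Definition tri (i : 'I_k) (a : 'I_3) : halfedge := inl (i, a).
Definition uni (j : 'I_u) : halfedge := inr j.

Definition vertex_of (h : halfedge) : vertex :=
  match h with inl (i, _) => inl i | inr j => inr j end.

Definition next (h : halfedge) : halfedge :=
  match h with inl (i, a) => tri i (ordS a) | inr j => uni j end.

Definition is_pairing (p : {perm halfedge}) : bool :=
  [forall h, (p (p h) == h) && (p h != h)].

Definition adjacent (p : {perm halfedge}) : rel vertex :=
  fun v w => [exists h, (vertex_of h == v) && (vertex_of (p h) == w)].

Definition every_component_has_leg (p : {perm halfedge}) : bool :=
  [forall v, exists j : 'I_u, connect (adjacent p) v (inr j)].

Definition connected_graph (p : {perm halfedge}) : bool :=
  (0 < #|vertex|)%N && [forall v, forall w, connect (adjacent p) v w].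

(* The orientation at the i-th vertex reversed: the edge ends at positions
   1 and 2 of the vertex are exchanged. *)
Definition flip (i : 'I_k) : {perm halfedge} :=
  tperm (tri i (inord 1)) (tri i (inord 2)).

(* The three diagrams of IHX, with four strands 1, 2, 3, 4 leaving the disc,
   and planar (counterclockwise) orientation:

      1   2                              1     2
       \ /                1     2         \   /
        i                 |     |          \ /
        |        -        i --- j    +     / \      =  0
        j                 |     |         i --- j
       / \                3     4         |     |
      3   4                               3     4

   The edge (i, 0) -- (j, 0) is kept, and the strands occupy the positions

               (i, 1)  (i, 2)  (j, 1)  (j, 2)
        I :      2       1       3       4
        H :      1       3       4       2
        X :      2       3       4       1

   so that I_to_H is the cycle (i,1) -> (j,2) -> (j,1) -> (i,2) -> (i,1), and
   H_to_X exchanges the strands 1 and 2.  (For permutations, s * t applies s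
   first.) *)
Definition I_to_H (i j : 'I_k) : {perm halfedge} :=
  (tperm (tri i (inord 1)) (tri j (inord 2))
   * tperm (tri i (inord 1)) (tri j (inord 1))
   * tperm (tri i (inord 1)) (tri i (inord 2)))%g.

Definition H_to_X (i j : 'I_k) : {perm halfedge} :=
  tperm (tri i (inord 1)) (tri j (inord 2)).

End Graph.

(* The guard k <= 2 * d is needed because of truncated subtraction. *)
Definition jacobi_graph (d k : nat) : finType :=
  {p : {perm halfedge k (2 * d - k)} |
     [&& (k <= 2 * d)%N, is_pairing p & every_component_has_leg p]}.

Section Jacobi.
Context (K : fieldType) (V : vectType K) (d k : nat).

Definition diagram : choiceType :=
  (jacobi_graph d k * {ffun 'I_(2 * d - k) -> V})%type.

Definition edges (D : diagram) : {perm halfedge k (2 * d - k)} := val D.1.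
Definition color (D : diagram) : {ffun 'I_(2 * d - k) -> V} := D.2.

Definition diagram_iso (D D' : diagram) : Prop :=
  exists phi : {perm halfedge k (2 * d - k)},
    [/\ forall h, phi (next h) = next (phi h),
        forall h, phi (edges D h) = edges D' (phi h)
      & forall j j', phi (uni k j) = uni k j' -> color D' j' = color D j].

Definition diagram_act (g : GL V) (D : diagram) : diagram :=
  (D.1, [ffun j => val g (color D j)]).

Lemma diagram_act1 D : diagram_act 1%g D = D.
Proof.
by case: D => p c; congr (_, _); apply/ffunP => j; rewrite ffunE; apply: id_lfunE.
Qed.
Lemma diagram_actM g h D :
  diagram_act (g * h)%g D = diagram_act g (diagram_act h D).
Proof. by congr (_, _); apply/ffunP => j; rewrite !ffunE; apply: comp_lfunE. Qed.

Definition diagram_rep : rep K (GL V) := free_rep K diagram_act1 diagram_actM.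

(* (p ^ s)%g maps s h to s (p h): the edge end at position h moves to position
   s h. *)
Inductive jacobi_relation : set diagram_rep :=
| Rel_iso D D' : diagram_iso D D' -> jacobi_relation (<< D >> - << D' >>)
| Rel_AS D D' (i : 'I_k) :
    color D' = color D -> edges D' = (edges D ^ flip _ i)%g ->
    jacobi_relation (<< D >> + << D' >>)
| Rel_IHX D_I D_H D_X (i j : 'I_k) :
    i != j -> edges D_I (tri _ i ord0) = tri _ j ord0 ->
    color D_H = color D_I -> edges D_H = (edges D_I ^ I_to_H _ i j)%g ->
    color D_X = color D_H -> edges D_X = (edges D_H ^ H_to_X _ i j)%g ->
    jacobi_relation (<< D_I >> - << D_H >> + << D_X >>)
| Rel_linear D D1 D2 (j : 'I_(2 * d - k)) (a : K) :
    edges D1 = edges D -> edges D2 = edges D ->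
    (forall j', j' != j -> color D1 j' = color D j' /\ color D2 j' = color D j') ->
    color D j = a *: color D1 j + color D2 j ->
    jacobi_relation (<< D >> - (a *: << D1 >> + << D2 >>)).

Lemma jacobi_relation_stable : rep_stable jacobi_relation.
Proof.
have colorE g D j : color (diagram_act g D) j = val g (color D j) by rewrite ffunE.
have eq_color g D D' : color D' = color D ->
    color (diagram_act g D') = color (diagram_act g D).
  by move=> eqD; apply/ffunP => j; rewrite !colorE eqD.
move=> g _ [D D' [phi [phi_next phi_edges phi_color]]
  |D D' i cD eD|D_I D_H D_X i j ij eij cH eH cX eX|D D1 D2 j a e1 e2 c12 cj];
  apply: lspan_mem.
- rewrite linearB !free_repU; apply: Rel_iso; exists phi; split=> // l l' /phi_color eqc.
  by rewrite !colorE eqc.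
- by rewrite linearD !free_repU; apply: (Rel_AS (i := i)) => //; apply: eq_color.
- rewrite linearD linearB !free_repU.
  by apply: (Rel_IHX (i := i) (j := j)) => //; apply: eq_color.
rewrite linearB linearP !free_repU.
apply: (Rel_linear (j := j)) => // [j' /c12[c1 c2]|].
  by rewrite !colorE c1 c2.
by rewrite !colorE cj linearP.
Qed.

Definition B : rep K (GL V) := quot_rep jacobi_relation_stable.

Definition diagram_class (D : diagram) : B :=
  lproj jacobi_relation (<< D >> : {freeg diagram / K}).

Lemma diagram_class_act g D :
  rep_act B g (diagram_class D) = diagram_class (diagram_act g D).
Proof. by rewrite [LHS]quot_rep_proj free_repU. Qed.

Definition connected_classes : set B :=
  [set x | exists2 D, connected_graph (edges D) & x = diagram_class D].

Lemma connected_classes_stable : rep_stable connected_classes.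
Proof.
move=> g _ [D cD ->]; apply: lspan_mem; rewrite diagram_class_act.
by exists (diagram_act g D).
Qed.

Definition Bc : rep K (GL V) := sub_rep connected_classes_stable.

End Jacobi.

Definition good (d k : nat) : bool :=
  (0 < d)%N && (d - 1 <= k <= 2 * d - 2)%N.

(* All entries of a decomposition are nonnegative integers (a >= 1, d >= 1,
   k >= 0), so that nat can replace the integers. *)
Definition lex_gt (t t' : nat * nat * nat) : bool :=
  let: (_, d, k) := t in let: (_, d', k') := t' in
  ((d' < d) || ((d' == d) && (k' < k)))%N.

Definition is_decomposition (d k : nat) (s : seq (nat * nat * nat)) : bool :=
  [&& all (fun t : nat * nat * nat => let: (a, d', k') := t in (0 < a)%N && good d' k') s,
      \sum_(t <- s) t.1.1 * t.1.2 == d,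
      \sum_(t <- s) t.1.1 * t.2 == k
    & sorted lex_gt s]%N.

Definition decomposition (d k : nat) : choiceType :=
  {s : seq (nat * nat * nat) | is_decomposition d k s}.

Definition decomposition_term (K : fieldType) (V : vectType K)
    (s : seq (nat * nat * nat)) : rep K (GL V) :=
  tensor (fun i : 'I_(size s) =>
    let: (a, d, k) := tnth (in_tuple s) i in Sym a (Bc V d k)).

(* Main.v *)
(* Choose bases of the spaces B^c_(d,k) made of classes of connected diagrams, and let R be
   the polynomial ring with one variable per basis diagram.  Every relation of B_(d,k)
   happens inside one connected component, so sending a diagram to the product of its
   components, each expanded in the chosen bases, is a linear map B_(d,k) -> R.  Multiplying
   the tensor factors gives a linear map from the right-hand side to R.  Disjoint unions of
   basis diagrams span B_(d,k), tensors of basis diagrams span the right-hand side, and in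
   both cases two generators with the same monomial are equal.  Distinct monomials being
   independent, both maps are injective with the same image, which defines the isomorphism.
   It is equivariant because a tensor of arbitrary connected classes corresponds to their
   disjoint union.

   Only good pairs occur: a connected graph has at least (number of vertices) - 1 edges,
   and a diagram with a single leg vanishes.  For the latter, let v be the trivalent vertex
   next to the leg and e another edge at v; slide the end v of e over all the other
   vertices.  By IHX and AS everything cancels but the original diagram, where v sits on
   the leg, and the diagram where v sits on e itself, a tadpole, which vanishes by AS. *)
From HB Require Import structures.
From mathcomp Require Import all_boot all_fingroup all_algebra.
From mathcomp Require Import all_classical.
From mathcomp Require Import finmap zify.
From mathcomp Require Import -(notations) monalg.
From mathcomp Require Import generic_quotient freeg.
Require Import Defs.

Set Implicit Arguments.
Unset Strict Implicit.
Unset Printing Implicit Defensive.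

Import GRing.Theory.
Local Open Scope ring_scope.

(** * Linear algebra *)

(** In the presentation of [B] the vertices are numbered and the type depends on [d] and [k], so
    cutting out a component or forming a disjoint union would mean renumbering inside dependent
    types. Diagrams are therefore handled as [raw] graphs on arbitrary finite sets of half-edges. An
    [invariant] function of raw graphs is one that respects the relations wherever they are applied;
    it induces a linear map on every [B V d k], and the class [cls] is itself invariant. Disjoint
    union with a fixed graph and the product over components preserve invariance, which is all that
    the two sides of the isomorphism require.

    The bases consist of diagrams rather than vectors because a monomial has to be realized both as
    a disjoint union and as a tensor. Mapping both sides into a commutative algebra avoids choosing
    an order of the components.

    In the vanishing of one-leg diagrams, 2 is inverted because a tadpole equals its own negative
    and because every edge is seen from both ends; 3 is inverted because a relation attached to a
    vertex is summed over the three half-edges there. *)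

Section Spans.
Local Open Scope classical_set_scope.
Context (K : fieldType).

Lemma lspan_trans (M : lmodType K) (A B : set M) :
  (forall x, A x -> lspan B x) -> forall x, lspan A x -> lspan B x.
Proof.
move=> AB x; elim=> [|a u v Au _ IH]; first exact: lspan0.
by apply: lspan_lin => //; apply: AB.
Qed.

Lemma lspanZ (M : lmodType K) (A : set M) a x : lspan A x -> lspan A (a *: x).
Proof. by move=> Ax; rewrite -[_ *: _]addr0; apply: lspan_lin (lspan0 _). Qed.

Lemma lspan_sum (M : lmodType K) (A : set M) (J : Type) (r : seq J) (f : J -> M) :
  (forall j, lspan A (f j)) -> lspan A (\sum_(j <- r) f j).
Proof.
move=> Af; elim: r => [|j r IH]; first by rewrite big_nil; apply: lspan0.
by rewrite big_cons -[f j]scale1r; apply: lspan_lin.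
Qed.

Lemma lspan_eq_lin (M N : lmodType K) (f g : {linear M -> N}) (A : set M) :
  (forall x, A x -> f x = g x) -> forall x, lspan A x -> f x = g x.
Proof.
move=> fg x; elim=> [|a u v Au _ IH]; first by rewrite !linear0.
by rewrite !linearP IH fg.
Qed.

Lemma exists_linear (M N : lmodType K) (f : M -> N) :
  linear f -> exists g : {linear M -> N}, g =1 f.
Proof.
move=> lf; pose g : {linear M -> N} := HB.pack f (GRing.isLinear.Build K M N *:%R f lf).
by exists g.
Qed.

Lemma linear_iso_of_inj (M N R : lmodType K)
    (F : {linear M -> R}) (G : {linear N -> R}) :
  injective F -> injective G ->
  (forall x, exists y, G y = F x) -> (forall y, exists x, F x = G y) ->
  exists h : {linear M -> N}, bijective h /\ forall x, G (h x) = F x.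
Proof.
move=> Finj Ginj FG GF; pose h x := projT1 (cid (FG x)).
have hE x : G (h x) = F x by rewrite /h; case: cid.
have hl : linear h by move=> a x y; apply: Ginj; rewrite hE !linearP !hE.
have [h' hh'] := exists_linear hl; exists h'; split=> [|x]; last by rewrite hh'.
exists (fun y => projT1 (cid (GF y))) => [x|y].
  by case: cid => /= z; rewrite hh' hE => /Finj.
by case: cid => /= z Fz; rewrite hh'; apply: Ginj; rewrite hE.
Qed.

Lemma scale_freegU (X : choiceType) (a b : K) (x : X) :
  a *: (<< b *g x >> : {freeg X / K}) = << a * b *g x >>.
Proof. by apply/eqP/freeg_eqP => y; rewrite coeffZ !coeffU mulrA. Qed.

Lemma freeg_lspan (X : choiceType) (u : {freeg X / K}) :
  lspan [set << x >> | x in [set: X]] u.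
Proof.
rewrite -(freeg_sumE u); apply: lspan_sum => x.
have -> : << coeff x u *g x >> = coeff x u *: << x >> :> {freeg X / K}.
  by rewrite scale_freegU mulr1.
by apply/lspanZ/lspan_mem; exists x.
Qed.

Lemma lquot_lspan (M : lmodType K) (A B : set M) :
  (forall x, lspan B x) -> forall y : lquot A, lspan [set lproj A x | x in B] y.
Proof.
move=> Bx y; rewrite -[y]lprojK; apply: (lspan_sub (f := lproj A)) (Bx _).
by move=> x Bx'; apply: lspan_mem; exists x.
Qed.

Lemma lquot_lift (M N : lmodType K) (A : set M) (f : {linear M -> N}) :
  (forall x, A x -> f x = 0) ->
  exists g : {linear lquot A -> N}, forall x, g (lproj A x) = f x.
Proof.
move=> fA; pose g (y : lquot A) := f (repr y).
have gE x : g (lproj A x) = f x.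
  apply/eqP; rewrite -subr_eq0 -linearB; apply/eqP.
  have: lspan A (repr (lproj A x) - x) by apply/lprojP; rewrite lprojK.
  by elim=> [|a u v Au _ IH]; [rewrite linear0 | rewrite linearP IH fA // scaler0 addr0].
have gl : linear g.
  by move=> a x y; rewrite -[x]lprojK -[y]lprojK -linearP !gE linearP.
by have [g' g'E] := exists_linear gl; exists g' => x; rewrite g'E.
Qed.

End Spans.

(** * Bases chosen inside a spanning family *)

Section Hamel.
Local Open Scope classical_set_scope.
Context (K : fieldType) (M : lmodType K) (X : choiceType) (e : X -> M).

Definition supported (A : set X) (u : {freeg X / K}) := forall x, x \in dom u -> A x.

(** Combinations are formal sums of indices, so independence also forces [e] to be injective on [A]:
    distinct diagrams in a basis have distinct classes. *)
Definition independent (A : set X) :=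
  forall u, supported A u -> free_lift e u = 0 -> u = 0.

Lemma supported_lin (A : set X) a u v :
  supported A u -> supported A v -> supported A (a *: u + v).
Proof.
move=> Au Av x; rewrite mem_dom coeffD coeffZ.
have [ux|] := boolP (x \in dom u); first by move=> _; apply: Au.
rewrite mem_dom negbK => /eqP ->; rewrite mulr0 add0r -mem_dom; exact: Av.
Qed.

Lemma lift_supported_lspan (A : set X) u :
  supported A u -> lspan (e @` A) (free_lift e u).
Proof.
move=> Au; have -> : free_lift e u = \sum_(x <- dom u) coeff x u *: e x.
  rewrite -{1}(freeg_sumE u) linear_sum; apply: eq_bigr => x _.
  by rewrite /= liftU.
rewrite big_seq; elim/big_ind: _ => [|x y Ax Ay|x /Au Ax]; first exact: lspan0.
  by rewrite -[x]scale1r; apply: lspan_lin.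
by apply/lspanZ/lspan_mem; exists x.
Qed.

Lemma maximal_independent (A0 Y : set X) : A0 `<=` Y -> independent A0 ->
  exists A, [/\ A0 `<=` A, A `<=` Y, independent A
    & forall y, Y y -> lspan (e @` A) (e y)].
Proof.
move=> A0Y iA0.
(* [A0] is adjoined instead of being required inside [A], because [Zorn_bigcup] also asks for the
   empty chain, whose union is empty. *)
pose P (A : set X) := A `<=` Y /\ independent (A0 `|` A).
have [F FP Ftot|A [[AY iA] Amax]] := Zorn_bigcup (P := P).
  split=> [x [B /FP[BY _] /BY]//|u su u0].
  (* The support of [u] is finite and [F] is a chain, so outside [A0] a single member of [F]
     suffices, or none at all. *)
  have : supported A0 u \/ exists2 B, F B & supported (A0 `|` B) u.
    move: su; rewrite /supported; elim: (dom u) => [|x s IH] su; first by left.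
    have /IH Hs : forall z, z \in s -> (A0 `|` \bigcup_(Z in F) Z) z.
      by move=> z zs; apply: su; rewrite inE zs orbT.
    have [A0x|[B FB Bx]] := su x (mem_head _ _).
      case: Hs => [Hs|[C FC Hs]]; [left|right; exists C => //].
        by move=> z; rewrite inE => /orP[/eqP->//|/Hs].
      by move=> z; rewrite inE => /orP[/eqP->|/Hs //]; left.
    right; case: Hs => [Hs|[C FC Hs]].
      exists B => // z; rewrite inE => /orP[/eqP->|/Hs]; by [right|left].
    have [BC|CB] := Ftot _ _ FB FC.
      exists C => // z; rewrite inE => /orP[/eqP->|/Hs //]; right; exact: BC.
    exists B => // z; rewrite inE => /orP[/eqP->|/Hs[]]; [by right|by left|].
    by move=> /CB; right.
  case=> [su0|[B FB sB]]; first exact: iA0.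
  by have [_ iB] := FP _ FB; apply: iB.
exists (A0 `|` A); split=> [||//|y Yy]; first exact: subsetUl.
  by rewrite subUset.
have [|Ay] := pselect ((A0 `|` A) y).
  by move=> Ay; apply: lspan_mem; exists y.
have : ~ P (A `|` [set y]).
  apply: Amax; split=> [x Ax|eqA]; first by left.
  by apply: Ay; right; apply: eqA; right.
move=> nP; have [u [su u0 un0]] : exists u,
    [/\ supported (A0 `|` (A `|` [set y])) u, free_lift e u = 0 & u <> 0].
  apply: contrapT => nu; apply: nP; split=> [x [/AY//|->//]|u su u0].
  by apply: contrapT => un0; apply: nu; exists u.
(* By maximality [y] satisfies a relation [u] over [A0] and [A]. Its coefficient there is nonzero,
   since otherwise [u] would be a relation without [y]; hence [e y] can be solved for. *)
pose c := coeff y u.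
pose u' := u - << c *g y >>.
have cu' x : coeff x u' = if x == y then 0 else coeff x u.
  rewrite coeffB coeffU eq_sym; case: eqP => [->|_]; first by rewrite mulr1 subrr.
  by rewrite mulr0 subr0.
have su' : supported (A0 `|` A) u'.
  move=> x; rewrite mem_dom cu'; case: (x =P y) => [_|nxy]; first by rewrite eqxx.
  by rewrite -mem_dom => /su[A0x|[Ax|/nxy]]; [left|right|].
have c0 : c != 0.
  apply/eqP => c0; apply: un0; apply: iA => //.
  by have -> : u = u' by rewrite /u' c0 freegU0 subr0.
have ey : e y = - c^-1 *: free_lift e u' + 0.
  rewrite /u' linearB u0 sub0r addr0.
  have -> : free_lift e (<< c *g y >> : {freeg X / K}) = c *: e y by rewrite /= liftU.
  by rewrite scalerN scaleNr opprK scalerA mulVf // scale1r.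
rewrite ey; apply: lspan_lin (lspan0 _); exact: lift_supported_lspan.
Qed.

Lemma independent0 : independent set0.
Proof.
move=> u su _; apply/eqP; rewrite -dom_eq0.
by rewrite /supported in su; case: (dom u) su => // x s /(_ x (mem_head _ _)).
Qed.

Lemma lspan_supported (A : set X) m : lspan (e @` A) m ->
  exists2 u, supported A u & free_lift e u = m.
Proof.
elim=> [|a x y [z Az <-] _ [u su <-]].
  by exists 0; [move=> x; rewrite dom0 | rewrite linear0].
exists (a *: << z >> + u); last by rewrite linearP free_liftU.
apply: supported_lin => // w; rewrite domU1 inE => /eqP ->; exact: Az.
Qed.

(** Two maximal choices: [A] inside [P] is a basis of the span of [P], and its extension [A'] is a
    basis of [M]. The extension makes it possible to define [L] on all of [M], as a formal lift of
    [c] composed with the coordinates [k] in [A']. *)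
Lemma partial_hamel_basis (P : set X) : (forall m, lspan (range e) m) ->
  exists A, [/\ A `<=` P, forall p, P p -> lspan (e @` A) (e p)
   & forall (N : lmodType K) (c : X -> N),
       exists L : {linear M -> N}, forall a, A a -> L (e a) = c a].
Proof.
move=> eM; have [A [_ AP iA spA]] := maximal_independent (@sub0set _ P) independent0.
have [A' [AA' _ iA' spA']] := maximal_independent (@subsetT _ A) iA.
exists A; split=> // N c.
have kP m : exists2 u, supported A' u & free_lift e u = m.
  apply: lspan_supported; apply: lspan_trans (eM m) => _ [x _ <-]; exact: spA'.
pose k m := s2val (cid2 (kP m)).
have sk m : supported A' (k m) by rewrite /k; case: cid2.
have kE m : free_lift e (k m) = m by rewrite /k; case: cid2.
have kU u : supported A' u -> k (free_lift e u) = u.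
  move=> su; apply/eqP; rewrite -subr_eq0; apply/eqP; apply: iA'.
    rewrite addrC -scaleN1r; apply: supported_lin => //; exact: sk.
  by rewrite linearB kE subrr.
have kl : linear (free_lift c \o k).
  move=> a x y; rewrite -[LHS]/(free_lift c _) -[RHS]/(a *: free_lift c _ + free_lift c _).
  rewrite -linearP -[in LHS](kE x) -[in LHS](kE y) -linearP kU //.
  by apply: supported_lin; apply: sk.
have [L LE] := exists_linear kl.
exists L => a Aa; rewrite LE -[LHS]/(free_lift c _) -[e a]free_liftU kU ?free_liftU //.
by move=> x; rewrite domU1 inE => /eqP ->; apply: AA'.
Qed.

End Hamel.

(** * Monomials in a polynomial ring and injectivity of maps into it *)

Section Monomials.
Local Open Scope classical_set_scope.
Context (K : fieldType) (I : choiceType).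

Local Notation R := (malg (cmonom I) K).

Definition var (x : I) : R := mkmalgU (ucm x) 1.
Definition mon (s : seq I) : R := \prod_(x <- s) var x.
Definition mset (s : seq I) : cmonom I := \big[@mulcm I/onecm I]_(x <- s) ucm x.

Lemma msetE s x : mset s x = count_mem x s.
Proof.
rewrite /mset; elim: s => [|y s IH]; first by rewrite big_nil onecmE.
by rewrite big_cons mulcmE IH ucmE.
Qed.

Lemma perm_mset s t : (mset s == mset t) = perm_eq s t.
Proof.
apply/eqP/idP => [st|/seq.permP st]; last by apply/eqP/cmP => x; rewrite !msetE st.
by apply/allP => x _ /=; rewrite -!msetE st.
Qed.

Lemma monE s : mon s = mkmalgU (mset s) 1.
Proof.
rewrite /mon /mset; elim: s => [|x s IH]; first by rewrite !big_nil.
rewrite !big_cons IH malgM_def fgmulUU mulr1; congr mkmalgU.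
Qed.

Lemma var_neq0 x : var x <> 0.
Proof. by move/eqP; rewrite monalgU_eq0 oner_eq0. Qed.

Lemma mon_section (M : lmodType K) (f : cmonom I -> M) :
  exists g : {linear R -> M}, forall m, g (mkmalgU m 1) = f m.
Proof.
pose g (r : R) := \sum_(k <- msupp r) mcoeff k r *: f k.
have gE (r : R) (d : {fset cmonom I}) : (msupp r `<=` d)%fset ->
    g r = \sum_(k <- d) mcoeff k r *: f k.
  move=> rd; rewrite /g [RHS](bigID (fun k => k \in msupp r)) /= [X in _ = _ + X]big1.
    rewrite addr0 (big_fset_incl _ rd).
      by rewrite [RHS]big_mkcond /=; apply: eq_bigr => k _;
        case: ifPn => // /mcoeff_outdom->; rewrite scale0r.
    by move=> k _ /mcoeff_outdom ->; rewrite scale0r.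
  by move=> k /mcoeff_outdom ->; rewrite scale0r.
have gl : linear g.
  move=> a r s; pose d := (msupp (a *: r + s) `|` (msupp r `|` msupp s))%fset.
  rewrite !(gE _ d) ?fsubsetUl //; last 2 first.
  - by rewrite /d fsetUA fsubsetUr.
  - by rewrite /d fsetUCA fsubsetUl.
  rewrite scaler_sumr -big_split; apply: eq_bigr => k _ /=.
  by rewrite mcoeffD mcoeffZ scalerDl scalerA.
have [g' g'E] := exists_linear gl; exists g' => m.
rewrite g'E (gE _ [fset m]%fset) ?msuppU_le // big_seq_fset1 mcoeffUU.
by rewrite scale1r.
Qed.

(** [gen s x] says that [x] is a generator with monomial [s]. Monomials form a basis of [R], so
    there is a linear map that sends a monomial back to a generator having it, and 0 where there is
    none. The last hypothesis makes that generator unique, so this map is a left inverse of [F]. *)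
Lemma mon_spanned_inj (M : lmodType K) (F : {linear M -> R})
    (gen : seq I -> M -> Prop) :
  (forall x, lspan [set y | exists s, gen s y] x) ->
  (forall s x, gen s x -> F x = mon s) ->
  (forall s t x y, perm_eq s t -> gen s x -> gen t y -> x = y) ->
  injective F.
Proof.
move=> sp Fgen geninj.
pose f (m : cmonom I) : M :=
  if pselect (exists x, exists2 s, mset s = m & gen s x) is left H
  then projT1 (cid H) else 0.
have [g gE] := mon_section f.
have gF x : g (F x) = x.
  apply: (lspan_eq_lin (f := g \o F) (g := idfun)) (sp x) => {}x [s sx] /=.
  rewrite (Fgen _ _ sx) monE gE /f; case: pselect => [H|[]]; last by exists x, s.
  case: cid => /= y [t /eqP]; rewrite perm_mset => ts ty; exact: (geninj _ _ _ _ ts).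
exact: can_inj gF.
Qed.

End Monomials.

(** * Tensor products, symmetric powers and direct sums *)

Section TensorTheory.
Local Open Scope classical_set_scope.
Context (K : fieldType) (G : groupType) (l : nat) (M : 'I_l -> rep K G).

Lemma tensor_lift (N : lmodType K) (f : family M -> N) :
  (forall (x : family M) i a (y z : M i), f (family_upd x (a *: y + z)) =
     a *: f (family_upd x y) + f (family_upd x z)) ->
  exists L : {linear tensor M -> N}, forall x, L (ptensor x) = f x.
Proof.
move=> fl; have [|L LE] := @lquot_lift K _ N (@multilinearity K G l M) (free_lift f).
  move=> _ [x i a y z]; rewrite linearB linearP !free_liftU fl.
  by rewrite subrr.
by exists L => x; rewrite LE free_liftU.
Qed.

Lemma family_updE (x : family M) i (y : M i) : family_upd x y i = y.
Proof. by rewrite ffunE dfwithin. Qed.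

Lemma family_upd_ne (x : family M) i j (y : M i) : j != i -> family_upd x y j = x j.
Proof. by move=> ji; rewrite ffunE dfwithout // eq_sym. Qed.

Lemma family_upd_id (x : family M) i : family_upd x (x i) = x.
Proof.
apply/ffunP => j; have [->|ji] := eqVneq j i; first exact: family_updE.
exact: family_upd_ne.
Qed.

Lemma ptensor_linear (x : family M) i a (y z : M i) :
  ptensor (family_upd x (a *: y + z)) =
  a *: ptensor (family_upd x y) + ptensor (family_upd x z).
Proof.
pose p := lproj (multilinearity (M := M)).
rewrite -[RHS](linearP p a << family_upd x y >> << family_upd x z >>).
apply/eqP; rewrite -subr_eq0 -(linearB p); apply/eqP.
by apply: lproj_eq0; apply: lspan_mem; apply: Multilinear.
Qed.

Lemma ptensor_upd_lspan (A : set (tensor M)) (x : family M) i (B : set (M i)) :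
  (forall y, B y -> lspan A (ptensor (family_upd x y))) ->
  forall y, lspan B y -> lspan A (ptensor (family_upd x y)).
Proof.
move=> AB y; elim=> [|a u v Bu _ IH].
  (* Multilinearity at [1 *: 0 + 0] reads [t = t + t], so a pure tensor with a zero entry
     vanishes. *)
  have := ptensor_linear x 1 (0 : M i) 0; rewrite scaler0 addr0 scale1r.
  by move/eqP; rewrite -subr_eq0 opprD addNKr oppr_eq0 => /eqP ->; apply: lspan0.
by rewrite ptensor_linear; apply: lspan_lin => //; apply: AB.
Qed.

Lemma tensor_lspan (B : forall i, set (M i)) :
  (forall i x, lspan (B i) x) ->
  forall x, lspan [set ptensor y | y in [set y : family M | forall i, B i (y i)]] x.
Proof.
move=> Bsp x; set A := [set _ | _ in _].
apply: (lspan_trans (A := [set ptensor y | y in [set: family M]])); last first.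
  apply: (lspan_trans _ (@lquot_lspan _ _ _ _ (@freeg_lspan _ _) x)).
  by move=> _ [_ [y _ <-] <-]; apply: lspan_mem; exists y.
move=> _ [{}x _ <-].
(* Entries below [n] are arbitrary and the others lie in [B]; the induction expands one more entry
   at a time, and [n = l] leaves no condition. *)
have: forall n, (n <= l)%N ->
    forall x : family M, (forall i : 'I_l, (n <= i)%N -> B i (x i)) -> lspan A (ptensor x).
  elim=> [_ {}x Bx|n IH nl {}x Bx].
    by apply: lspan_mem; exists x => // i; apply: Bx.
  rewrite -(family_upd_id x (Ordinal nl)).
  apply: ptensor_upd_lspan (Bsp _ _) => y By; apply: IH => [|i ni]; first exact: ltnW.
  have [->|ineq] := eqVneq i (Ordinal nl); first by rewrite family_updE.
  rewrite family_upd_ne //; apply: Bx; rewrite ltn_neqAle ni andbT.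
  by move: ineq; rewrite -val_eqE eq_sym.
by move=> /(_ l (leqnn l)); apply=> i; rewrite leqNgt ltn_ord.
Qed.

Lemma tensor_prod (R : comAlgType K) (f : forall i, {linear M i -> R}) :
  exists L : {linear tensor M -> R}, forall x, L (ptensor x) = \prod_i f i (x i).
Proof.
apply: tensor_lift => x i a y z.
rewrite !(bigD1 (P := xpredT) i) //= !family_updE linearP mulrDl scalerAl.
by congr (_ * _ + _ * _); apply: eq_bigr => j ji; rewrite !family_upd_ne.
Qed.

End TensorTheory.

Section SymTheory.
Local Open Scope classical_set_scope.
Context (K : fieldType) (G : groupType) (a : nat) (M : rep K G).

Definition psym (x : family (fun _ : 'I_a => M)) : Sym a M :=
  lproj (@symmetry K G a M) (ptensor x).

Lemma psym_act g x : rep_act (Sym a M) g (psym x) = psym (family_act g x).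
Proof. by rewrite [LHS]quot_rep_proj ptensor_act. Qed.

Lemma psym_perm s x : psym (family_perm s x) = psym x.
Proof.
apply/eqP; rewrite -subr_eq0 -(linearB (lproj (@symmetry K G a M))); apply/eqP.
by apply: lproj_eq0; apply: lspan_mem; constructor.
Qed.

Lemma sym_lspan (B : set M) : (forall x, lspan B x) -> forall x,
  lspan [set psym y | y in [set y : family (fun _ : 'I_a => M) | forall i, B (y i)]] x.
Proof.
move=> Bsp x.
apply: (lspan_trans _ (@lquot_lspan _ _ _ _ (@tensor_lspan _ _ _ _ (fun=> B) (fun=> Bsp)) x)).
by move=> _ [_ [y By <-] <-]; apply: lspan_mem; exists y.
Qed.

Lemma sym_prod (R : comAlgType K) (f : {linear M -> R}) :
  exists L : {linear Sym a M -> R}, forall x, L (psym x) = \prod_i f (x i).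
Proof.
have [T TE] := @tensor_prod K G a (fun=> M) R (fun=> f).
have [|L LE] := @lquot_lift K _ R (@symmetry K G a M) T.
  move=> _ [x s]; rewrite linearB !TE; apply/eqP; rewrite subr_eq0; apply/eqP.
  by rewrite [RHS](reindex_inj (@perm_inj _ s)); apply: eq_bigr => i _; rewrite ffunE.
by exists L => x; rewrite /psym LE TE.
Qed.

End SymTheory.

Section DsumTheory.
Local Open Scope classical_set_scope.
Context (K : fieldType) (G : groupType) (I : choiceType) (M : I -> rep K G).

Lemma dsum_inj_subproof i (x : M i) :
  finsupp_family (dfwith (fun j => 0 : M j) i x).
Proof.
apply/asboolP; apply: (sub_finite_set (B := [set i])) => //.
move=> j /=; apply: contra_notP => /eqP ji; by rewrite dfwithout // eq_sym.
Qed.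

Definition dsum_inj i (x : M i) : dsum M := Sub _ (dsum_inj_subproof x).

Lemma dsum_injE i (x : M i) : dsum_coord (dsum_inj x) i = x.
Proof. by rewrite /dsum_coord /= dfwithin. Qed.

Lemma dsum_inj_ne i j (x : M i) : j != i -> dsum_coord (dsum_inj x) j = 0.
Proof. by move=> ji; rewrite /dsum_coord /= dfwithout // eq_sym. Qed.

Lemma dsum_coordP j a (x y : dsum M) :
  dsum_coord (a *: x + y) j = a *: dsum_coord x j + dsum_coord y j.
Proof. by []. Qed.

Lemma dsum_inj_linear i : linear (@dsum_inj i).
Proof.
move=> a x y; apply: dsum_ext => j; rewrite dsum_coordP.
have [->|ji] := eqVneq j i; first by rewrite !dsum_injE.
by rewrite !dsum_inj_ne // scaler0 addr0.
Qed.

Lemma dsum_inj_act i g (x : M i) :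
  rep_act (dsum M) g (dsum_inj x) = dsum_inj (rep_act (M i) g x).
Proof.
apply: dsum_ext => j; rewrite -[LHS]/(rep_act (M j) g (dsum_coord (dsum_inj x) j)).
have [->|ji] := eqVneq j i; first by rewrite !dsum_injE.
by rewrite !dsum_inj_ne // linear0.
Qed.

Definition dsum_supp (x : dsum M) : {fset I} := fset_set [set i | dsum_coord x i <> 0].

Lemma dsum_suppP (x : dsum M) i : i \notin dsum_supp x -> dsum_coord x i = 0.
Proof.
rewrite in_fset_set; last by have /asboolP := valP x.
by rewrite notin_setE /= => /contrapT.
Qed.

Lemma dsum_lspan (B : forall i, set (M i)) : (forall i x, lspan (B i) x) ->
  forall x, lspan [set y | exists i, exists2 z, B i z & y = dsum_inj z] x.
Proof.
move=> Bsp x; have -> : x = \sum_(i <- dsum_supp x) dsum_inj (dsum_coord x i).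
  apply: dsum_ext => j.
  have -> : dsum_coord (\sum_(i <- dsum_supp x) dsum_inj (dsum_coord x i)) j =
     \sum_(i <- dsum_supp x) dsum_coord (dsum_inj (dsum_coord x i)) j.
    elim: (enum_fset _) => [|i r IH]; first by rewrite !big_nil.
    by rewrite !big_cons -IH.
  have [jx|jx] := boolP (j \in dsum_supp x).
    rewrite (big_fsetD1 j) //= dsum_injE big_seq big1 ?addr0 // => i.
    by rewrite !inE => /andP[ij _]; rewrite dsum_inj_ne // eq_sym.
  rewrite dsum_suppP // big_seq big1 // => i ix; rewrite dsum_inj_ne //.
  by apply: contraNneq jx => ->.
apply: lspan_sum => i; have [h hE] := exists_linear (@dsum_inj_linear i).
rewrite -hE; apply: (lspan_sub (f := h)) (Bsp i _) => z Bz.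
by apply: lspan_mem; exists i, z.
Qed.

Lemma dsum_lift (N : lmodType K) (f : forall i, {linear M i -> N}) :
  exists L : {linear dsum M -> N}, forall i (x : M i), L (dsum_inj x) = f i x.
Proof.
pose L (x : dsum M) := \sum_(i <- dsum_supp x) f i (dsum_coord x i).
have LE (x : dsum M) (d : {fset I}) : (dsum_supp x `<=` d)%fset ->
    L x = \sum_(i <- d) f i (dsum_coord x i).
  move=> xd; rewrite /L (big_fset_incl _ xd) // => i _ /dsum_suppP ->.
  by rewrite linear0.
have Ll : linear L.
  move=> a x y; pose d := (dsum_supp (a *: x + y) `|` (dsum_supp x `|` dsum_supp y))%fset.
  rewrite !(LE _ d) ?fsubsetUl //; last 2 first.
  - by rewrite /d fsetUA fsubsetUr.
  - by rewrite /d fsetUCA fsubsetUl.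
  rewrite scaler_sumr -big_split; apply: eq_bigr => i _ /=.
  by rewrite dsum_coordP linearP.
have [L' L'E] := exists_linear Ll; exists L' => i x.
rewrite L'E (LE _ [fset i]%fset) ?big_seq_fset1 ?dsum_injE //.
apply/fsubsetP => j; apply: contraLR; rewrite inE => ji.
rewrite in_fset_set; last by have /asboolP := valP (dsum_inj x).
by rewrite notin_setE /=; apply; rewrite dsum_inj_ne.
Qed.

End DsumTheory.

From mathcomp Require Import finset.

(** * Diagrams on arbitrary sets of half-edges *)

Section Raw.
Context (V : Type).

(* A uni-trivalent graph as a set of half-edges: [nx] turns around the vertices, so that
   legs are its fixed points and trivalent vertices its 3-cycles, and [pr] exchanges the
   two ends of an edge.  [col] is only meaningful on legs. *)
Record raw := Raw {
  half :> finType;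
  nx : half -> half;
  pr : half -> half;
  col : half -> V
}.

Definition cubic (X : raw) := forall h : X, nx (nx (nx h)) = h.
Definition paired (X : raw) := involutive (@pr X) /\ forall h : X, pr h != h.
Definition link (X : raw) : rel X := fun h h' => (h' == nx h) || (h' == pr h).
Definition leggy (X : raw) :=
  forall h : X, exists l, connect (@link X) h l /\ nx l = l.
Definition valid (X : raw) := [/\ cubic X, paired X & leggy X].
Definition conn (X : raw) := (0 < #|X|)%N /\ forall h h' : X, connect (@link X) h h'.

Definition ntri (X : raw) := #|[pred h : X | nx h != h]|.
Definition nleg (X : raw) := #|[pred h : X | nx h == h]|.

(** The image is closed under [nx] and [pr], so paths starting in it never leave it: embeddings
    preserve and reflect connectivity, and validity pulls back along them. *)
Definition embedding (X Y : raw) (f : X -> Y) :=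
  [/\ injective f, forall h, f (nx h) = nx (f h), forall h, f (pr h) = pr (f h)
    & forall h, nx h = h -> col (f h) = col h].

Definition riso (X Y : raw) := exists2 f : X -> Y, embedding f & bijective f.

Lemma link_nx (X : raw) (h : X) : connect (@link X) h (nx h).
Proof. by apply: connect1; rewrite /link eqxx. Qed.

Lemma link_pr (X : raw) (h : X) : connect (@link X) h (pr h).
Proof. by apply: connect1; rewrite /link eqxx orbT. Qed.

Lemma link_sym (X : raw) : cubic X -> paired X -> connect_sym (@link X).
Proof.
move=> cX [pX _]; have H (h h' : X) : connect (@link X) h h' -> connect (@link X) h' h.
  case/connectP=> p; elim: p h => [|x p IH] h /=; first by move=> _ ->.
  case/andP=> hx px lx; apply: (connect_trans (IH _ px lx)).
  case/orP: hx => /eqP ->; last by rewrite -{2}[h]pX link_pr.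
  by rewrite -{2}[h]cX; apply: (connect_trans (link_nx _)); apply: link_nx.
by move=> h h'; apply/idP/idP; apply: H.
Qed.

Lemma embedding_comp (X Y Z : raw) (f : X -> Y) (g : Y -> Z) :
  embedding f -> embedding g -> embedding (g \o f).
Proof.
move=> [f1 f2 f3 f4] [g1 g2 g3 g4]; split=> [|h|h|h hh] /=.
- exact: inj_comp.
- by rewrite f2 g2.
- by rewrite f3 g3.
- by rewrite g4 ?f4 // -f2 hh.
Qed.

Lemma embedding_inv (X Y : raw) (f : X -> Y) (g : Y -> X) :
  embedding f -> cancel g f -> embedding g.
Proof.
move=> [f1 f2 f3 f4] gf; split=> [|h|h|h hh].
- exact: can_inj gf.
- by apply: f1; rewrite f2 !gf.
- by apply: f1; rewrite f3 !gf.
- by rewrite -[in RHS](gf h) f4 //; apply: f1; rewrite f2 gf.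
Qed.

Lemma riso_refl X : riso X X.
Proof. by exists id; [split | exists id]. Qed.

Lemma riso_trans X Y Z : riso X Y -> riso Y Z -> riso X Z.
Proof.
move=> [f ef bf] [g eg bg]; exists (g \o f); first exact: embedding_comp.
exact: bij_comp.
Qed.

Lemma riso_sym X Y : riso X Y -> riso Y X.
Proof.
move=> [f ef [g fg gf]]; exists g; first exact: embedding_inv ef gf.
by exists f.
Qed.

Lemma riso_id (A : finType) (n p n' p' : A -> A) (c c' : A -> V) :
  n =1 n' -> p =1 p' -> (forall h, n h = h -> c h = c' h) ->
  riso (Raw n p c) (Raw n' p' c').
Proof.
move=> nn pp cc; exists (id : Raw n p c -> Raw n' p' c'); last by exists id.
by split=> // h /= nh; rewrite cc.
Qed.

Lemma connect_embedding (X Y : raw) (f : X -> Y) x y : embedding f ->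
  connect (@link Y) (f x) y <-> exists2 z, y = f z & connect (@link X) x z.
Proof.
move=> [f1 f2 f3 _]; split.
  case/connectP=> p; elim: p x => [|w p IH] x /=; first by move=> _ ->; exists x.
  case/andP=> xw pw lw.
  case/orP: xw => /eqP ew; move: pw lw; rewrite ew -?f2 -?f3 => pw lw.
    by have [z -> cz] := IH _ pw lw; exists z => //; apply: connect_trans cz; apply: link_nx.
  by have [z -> cz] := IH _ pw lw; exists z => //; apply: connect_trans cz; apply: link_pr.
case=> z -> /connectP[p]; elim: p x => [|w p IH] x /=; first by move=> _ ->.
case/andP=> xw pw lw; apply: (connect_trans _ (IH _ pw lw)).
by case/orP: xw => /eqP ->; rewrite ?f2 ?f3 ?link_nx ?link_pr.
Qed.

Lemma embedding_connect (X Y : raw) (f : X -> Y) x y : embedding f ->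
  connect (@link Y) (f x) (f y) = connect (@link X) x y.
Proof.
move=> ef; have [f1 _ _ _] := ef; apply/idP/idP.
  by move=> /(connect_embedding _ _ ef)[z /f1 ->].
by move=> xy; apply/(connect_embedding _ _ ef); exists y.
Qed.

Lemma embedding_valid (X Y : raw) (f : X -> Y) : embedding f -> valid Y -> valid X.
Proof.
move=> ef [cY [pY nY] lY]; have [f1 f2 f3 _] := ef; split.
- by move=> h; apply: f1; rewrite !f2 cY.
- split=> [h|h]; first by apply: f1; rewrite !f3 pY.
  by rewrite -(inj_eq f1) f3 nY.
move=> h; have [l [/(connect_embedding _ _ ef)[z -> hz] nl]] := lY (f h).
by exists z; split=> //; apply: f1; rewrite f2.
Qed.

Lemma riso_valid X Y : riso X Y -> valid X -> valid Y.
Proof. by case/riso_sym=> f ef _; apply: embedding_valid ef. Qed.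

Lemma riso_conn X Y : riso X Y -> conn X -> conn Y.
Proof.
move=> /riso_sym[f ef bf] [X0 cX]; split=> [|h h'].
  by rewrite (bij_eq_card bf).
by rewrite -(embedding_connect _ _ ef).
Qed.

Lemma riso_ntri X Y : riso X Y -> ntri X = ntri Y.
Proof.
move=> [f [f1 f2 _ _] bf]; rewrite /ntri -(fintype.card_image f1).
have [g fg gf] := bf; apply: eq_card => y; rewrite -[y]gf fintype.mem_image // !inE.
by rewrite -f2 (inj_eq f1).
Qed.

Lemma riso_nleg X Y : riso X Y -> nleg X = nleg Y.
Proof.
move=> [f [f1 f2 _ _] bf]; rewrite /nleg -(fintype.card_image f1).
have [g fg gf] := bf; apply: eq_card => y; rewrite -[y]gf fintype.mem_image // !inE.
by rewrite -f2 (inj_eq f1).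
Qed.

Definition rsum (X Y : raw) : raw := Raw
  (fun h : (half X + half Y)%type =>
     match h with inl x => inl (nx x) | inr y => inr (nx y) end)
  (fun h => match h with inl x => inl (pr x) | inr y => inr (pr y) end)
  (fun h => match h with inl x => col x | inr y => col y end).

Definition rzero : raw := Raw (fun h : void => h) id (fun h => match h with end).

(** The default value [h] of [insubd] is never taken when [S] is [stable], in particular when it is
    a component. *)
Definition restr (X : raw) (S : {set X}) : raw := @Raw {h : X | h \in S}
  (fun h => insubd h (nx (val h))) (fun h => insubd h (pr (val h)))
  (fun h => col (val h)).

(** The counterpart of [(p ^ s)%g] in the relations: vertices and colors stay in place, and the edge
    end at [h] moves to [s h]. *)
Definition rconj (X : raw) (s : {perm X}) : raw :=
  Raw (@nx X) (fun h => s (pr ((s^-1)%g h))) (@col X).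

Definition recol (X : raw) (c : X -> V) : raw := Raw (@nx X) (@pr X) c.

Definition cc (X : raw) (h : X) : {set X} := [set h' | connect (@link X) h h'].

Definition stable (X : raw) (S : {set X}) :=
  forall h, h \in S -> (nx h \in S) /\ (pr h \in S).

Lemma restr_embedding (X : raw) (S : {set X}) : stable S ->
  embedding (val : restr S -> X).
Proof.
move=> sS; split=> [x y /val_inj //|h|h|//].
- by rewrite /= val_insubd (sS _ (valP h)).1.
- by rewrite /= val_insubd (sS _ (valP h)).2.
Qed.

Lemma inl_embedding (X Y : raw) : embedding (inl : X -> rsum X Y).
Proof. by split=> // x y [->]. Qed.

Lemma inr_embedding (X Y : raw) : embedding (inr : Y -> rsum X Y).
Proof. by split=> // x y [->]. Qed.

Lemma cc_stable (X : raw) (h : X) : stable (cc h).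
Proof.
move=> x; rewrite !inE => hx.
by split; apply: (connect_trans hx); rewrite ?link_nx ?link_pr.
Qed.

Lemma stableC (X : raw) (S : {set X}) : cubic X -> paired X -> stable S -> stable (~: S).
Proof.
move=> cX [pX _] sS h; rewrite !inE => hS; split; apply: contra hS => hS.
  by rewrite -[h]cX; apply: (sS _ _).1; apply: (sS _ _).1.
by rewrite -[h]pX; apply: (sS _ _).2.
Qed.

Lemma restr_split (X : raw) (S : {set X}) : cubic X -> paired X -> stable S ->
  riso (rsum (restr S) (restr (~: S))) X.
Proof.
move=> cX pX sS; have [i1 i2 i3 i4] := restr_embedding sS.
have [j1 j2 j3 j4] := restr_embedding (stableC cX pX sS).
pose f (h : rsum (restr S) (restr (~: S))) : X :=
  match h with inl x => val x | inr y => val y end.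
have finj : injective f.
  move=> [x|x] [y|y] /=; rewrite /f; first by move/val_inj->.
  + have xS : sval x \in S := valP x; have : sval y \in ~: S := valP y.
    by move=> + xy; rewrite -xy inE xS.
  + have xS : sval y \in S := valP y; have : sval x \in ~: S := valP x.
    by move=> + xy; rewrite xy inE xS.
  + by move/val_inj->.
exists f; last first.
  apply: inj_card_bij finj _; rewrite card_sum !card_sig -(cardsC S).
  by rewrite leq_add // cardE.
by split=> [//|[x|x]|[x|x]|[x|x] []];
  [exact: i2 | exact: j2 | exact: i3 | exact: j3 | move/i4 | move/j4].
Qed.

Lemma rsum_riso X X' Y Y' : riso X X' -> riso Y Y' -> riso (rsum X Y) (rsum X' Y').
Proof.
move=> [f [f1 f2 f3 f4] [f' ff ff']] [g [g1 g2 g3 g4] [g' gg gg']].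
exists (fun h : rsum X Y => match h with inl x => inl (f x) | inr y => inr (g y) end
   : rsum X' Y').
  split.
  - by move=> [x|x] [y|y] //= [] => [/f1|/g1] ->.
  - by case=> x /=; rewrite ?f2 ?g2.
  - by case=> x /=; rewrite ?f3 ?g3.
  - by case=> x [] => [/f4|/g4].
exists (fun h : rsum X' Y' => match h with inl x => inl (f' x) | inr y => inr (g' y) end).
  by case=> x; rewrite ?ff ?gg.
by case=> x; rewrite ?ff' ?gg'.
Qed.

Lemma rsumC X Y : riso (rsum X Y) (rsum Y X).
Proof.
exists (fun h : rsum X Y => match h with inl x => inr x | inr y => inl y end : rsum Y X).
  by split=> [[x|x] [y|y] //= [->]|[]|[]|[]].
by exists (fun h => match h with inl x => inr x | inr y => inl y end); case.
Qed.

Lemma rsumA X Y Z : riso (rsum X (rsum Y Z)) (rsum (rsum X Y) Z).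
Proof.
exists (fun h : rsum X (rsum Y Z) => match h with
   | inl x => inl (inl x) | inr (inl y) => inl (inr y) | inr (inr z) => inr z end
   : rsum (rsum X Y) Z).
  by split=> [[x|[x|x]] [y|[y|y]] //= [->]|[x|[x|x]]|[x|[x|x]]|[x|[x|x]] //= []].
exists (fun h => match h with
   | inl (inl x) => inl x | inl (inr y) => inr (inl y) | inr z => inr (inr z) end).
  by case=> // [[]].
by case=> // [[]].
Qed.

Lemma rsum0 X : riso (rsum rzero X) X.
Proof.
exists (fun h : rsum rzero X => match h with inl x => match x with end | inr y => y end).
  by split=> [[[]|x] [[]|y] //= ->|[[]|]|[[]|]|[[]|] //= x []].
by exists inr => // [[[]|]].
Qed.

Lemma rsum_valid X Y : valid X -> valid Y -> valid (rsum X Y).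
Proof.
move=> [cX [pX nX] lX] [cY [pY nY] lY]; split.
- by case=> x /=; rewrite ?cX ?cY.
- split; first by case=> x /=; rewrite ?pX ?pY.
  by case=> x /=; apply/eqP => [[/eqP]]; rewrite ?(negPf (nX x)) ?(negPf (nY x)).
case=> x.
  have [l [xl nl]] := lX x; exists (inl l); split; last by rewrite /= nl.
  by rewrite (embedding_connect _ _ (@inl_embedding X Y)).
have [l [xl nl]] := lY x; exists (inr l); split; last by rewrite /= nl.
by rewrite (embedding_connect _ _ (@inr_embedding X Y)).
Qed.

Lemma rzero_valid : valid rzero.
Proof. by split; [case | split; case | case]. Qed.

Lemma ntri_rsum X Y : ntri (rsum X Y) = (ntri X + ntri Y)%N.
Proof.
rewrite /ntri -!sum1_card big_sumType /=.
by congr addn; apply: eq_bigl => x; rewrite !inE.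
Qed.

Lemma nleg_rsum X Y : nleg (rsum X Y) = (nleg X + nleg Y)%N.
Proof.
rewrite /nleg -!sum1_card big_sumType /=.
by congr addn; apply: eq_bigl => x; rewrite !inE.
Qed.

(** By the two hypotheses on [s], [s x] is connected to [x] in both graphs. An edge from [x] to
    [pr x] of one graph corresponds to the edge from [s x] to [s (pr x)] of the other, so either
    graph can simulate the paths of the other. *)
Lemma rconj_connect (X : raw) (s : {perm X}) (h0 : X) : cubic X -> paired X ->
  (forall h, s h != h -> connect (@link X) h0 h) ->
  (forall h, s h != h -> connect (@link (rconj s)) h0 h) ->
  connect (@link (rconj s)) =2 connect (@link X).
Proof.
move=> cX pX sX sY.
have cY : cubic (rconj s) by [].
have pY : paired (rconj s).
  split=> [h|h] /=; first by rewrite permK pX.1 permKV.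
  by rewrite -{2}[h](permKV s) (inj_eq perm_inj) pX.2.
have symX := link_sym cX pX; have symY := link_sym cY pY.
have fromX x : connect (@link X) (s x) x.
  have [->//|sx] := eqVneq (s x) x.
  by apply: (@connect_trans _ _ h0); [rewrite symX|]; apply: sX => //; rewrite (inj_eq perm_inj).
have fromY x : connect (@link (rconj s)) (s x) x.
  have [->|sx] := eqVneq (s x) x; first exact: connect0.
  apply: (@connect_trans _ _ h0); [rewrite symY|]; apply: sY => //.
  by rewrite (inj_eq perm_inj).
move=> x y; apply/idP/idP => /connectP[p]; elim: p x => [|w p IH] x /=.
- by move=> _ ->; apply: connect0.
- case/andP=> xw pw lw; apply: (connect_trans _ (IH _ pw lw)).
  case/orP: xw => /eqP ->; first exact: link_nx.
  rewrite /=; apply: (connect_trans _ (_ : connect _ (pr ((s^-1)%g x)) _)); last first.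
    by rewrite symX fromX.
  apply: (connect_trans _ (link_pr _)).
  by rewrite -{1}[x](permKV s) fromX.
- by move=> _ ->; apply: connect0.
case/andP=> xw pw lw; apply: (connect_trans _ (IH _ pw lw)).
case/orP: xw => /eqP ->; first exact: (@link_nx (rconj s)).
apply: (connect_trans _ (fromY _)).
have -> : s (@pr X x) = @pr (rconj s) (s x) by rewrite /= permK.
by apply: (connect_trans _ (@link_pr (rconj s) (s x))); rewrite symY fromY.
Qed.

Lemma rconj_leggy (X : raw) (s : {perm X}) :
  connect (@link (rconj s)) =2 connect (@link X) -> leggy (rconj s) <-> leggy X.
Proof.
move=> E; split=> lX h; have [l [hl nl]] := lX h; exists l; split=> //.
  by rewrite -E.
by rewrite E.
Qed.

Lemma rconj_paired (X : raw) (s : {perm X}) : paired X -> paired (rconj s).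
Proof.
move=> pX; split=> [h|h] /=; first by rewrite permK pX.1 permKV.
by rewrite -{2}[h](permKV s) (inj_eq perm_inj) pX.2.
Qed.

End Raw.

Arguments rzero {V}.

(** * Standard forms of raw diagrams, and their classes *)

Section Standard.
Context (K : fieldType) (V : vectType K).

Definition wired k u (p : {perm halfedge k u}) (c : 'I_u -> V) : raw V := Raw
  (@next k u) p (fun h => if h is inr j then c j else 0).

Definition std d k (D : diagram V d k) : raw V := wired (edges D) (color D).

Lemma ordS3 (a : 'I_3) : ordS (ordS (ordS a)) = a.
Proof. by apply: val_inj; case: a => [[|[|[|]]]]. Qed.

Lemma ordS3_neq (a : 'I_3) : (ordS a == a) = false.
Proof. by case: a => [[|[|[|]]]]. Qed.

Lemma wired_cubic k u p c : cubic (@wired k u p c).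
Proof. by case=> [[i a]|j] //=; rewrite ordS3. Qed.

Lemma next_eq k u (h : halfedge k u) : (next h == h) = if h is inr _ then true else false.
Proof.
case: h => [[i a]|j] /=; last exact: eqxx.
by apply/eqP => [[]] /eqP; rewrite ordS3_neq.
Qed.

Lemma wired_ntri k u p c : ntri (@wired k u p c) = (3 * k)%N.
Proof.
rewrite /ntri -sum1_card big_sumType /= [X in (_ + X)%N]big1 ?addn0.
  transitivity (\sum_(x : 'I_k * 'I_3) 1)%N.
    by apply: eq_bigl => x; rewrite !inE next_eq.
  by rewrite sum1_card card_prod !card_ord mulnC.
by move=> j; rewrite !inE next_eq.
Qed.

Lemma wired_nleg k u p c : nleg (@wired k u p c) = u.
Proof.
rewrite /nleg -sum1_card big_sumType /= big1 ?add0n.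
  transitivity (\sum_(x : 'I_u) 1)%N; last by rewrite sum1_card card_ord.
  by apply: eq_bigl => x; rewrite !inE next_eq.
by move=> x; rewrite !inE next_eq.
Qed.

Lemma wired_paired k u (p : {perm halfedge k u}) c :
  is_pairing p <-> paired (wired p c).
Proof.
split=> [/forallP H|[H1 H2]].
  by split=> h; have /andP[/eqP ? ?] := H h.
by apply/forallP => h; rewrite -[p (p h)]/(@pr _ (wired p c) (@pr _ (wired p c) h)) H1 H2 eqxx.
Qed.

Lemma vertex_connect k u p c (h h' : wired p c) : vertex_of h = vertex_of h' ->
  connect (@link V (@wired k u p c)) h h'.
Proof.
case: h h' => [[i a]|j] [[i' a']|j'] //= [->]; last exact: connect0.
set W := wired p c.
have n1 (x : W) : connect (@link _ W) x (next x) := link_nx x.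
have n2 (x : W) : connect (@link _ W) x (next (next x)) := connect_trans (n1 _) (n1 _).
have [->|[->|->]] : a' = a \/ a' = ordS a \/ a' = ordS (ordS a).
  by case: a a' => [[|[|[|a]]] Ha] [[|[|[|a']]] Ha'] //;
   do ?[by left; apply: val_inj | by right; left; apply: val_inj
       | by right; right; apply: val_inj].
- exact: connect0.
- exact: (n1 (inl (i', a))).
- exact: (n2 (inl (i', a))).
Qed.

Lemma adjacent_connect k u p c (h h' : @wired k u p c) :
  connect (adjacent p) (vertex_of h) (vertex_of h') = connect (@link V (wired p c)) h h'.
Proof.
apply/idP/idP => /connectP[s].
  elim: s h => [|w s IH] h /=; first by move=> _ /esym; apply: vertex_connect.
  case/andP=> /existsP[h0 /andP[/eqP h0h /eqP ph0]] ws lw.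
  apply: (@connect_trans _ _ h0); first exact: vertex_connect.
  apply: (@connect_trans _ _ (p h0)); first exact: (@link_pr V (wired p c) h0).
  by apply: IH; rewrite ph0.
elim: s h => [|w s IH] h /=; first by move=> _ ->; apply: connect0.
case/andP=> hw ws lw; apply: (connect_trans _ (IH _ ws lw)).
case/orP: hw => /eqP ->; last first.
  by apply: connect1; apply/existsP; exists h; rewrite !eqxx.
by case: h => [[i a]|j] /=; apply: connect0.
Qed.

Lemma vertex_of_surj k u (v : vertex k u) : exists h, vertex_of h = v.
Proof. by case: v => [i|j]; [exists (tri u i ord0)|exists (uni k j)]. Qed.

Lemma wired_leggy k u (p : {perm halfedge k u}) c :
  every_component_has_leg p <-> leggy (wired p c).
Proof.
split=> [/forallP H h|H].
  have /existsP[j hj] := H (vertex_of h).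
  by exists (uni k j); split=> //; rewrite -(@adjacent_connect _ _ p c).
apply/forallP => v; have [h <-] := vertex_of_surj v.
have [l [hl /eqP]] := H h; rewrite next_eq; case: l hl => // j hj _.
by apply/existsP; exists j; rewrite -[inr j]/(vertex_of (inr j)) (@adjacent_connect _ _ p c).
Qed.

Lemma wired_conn k u (p : {perm halfedge k u}) c :
  connected_graph p <-> conn (wired p c).
Proof.
split=> [/andP[/card_gt0P[v _] /forallP H]|[/card_gt0P[h _] H]].
  split=> [|h h'].
    by have [h _] := vertex_of_surj v; apply/card_gt0P; exists h.
  by have /forallP/(_ (vertex_of h')) := H (vertex_of h); rewrite (@adjacent_connect _ _ p c).
apply/andP; split; first by apply/card_gt0P; exists (vertex_of h).
apply/forallP => v; apply/forallP => w.
have [x <-] := vertex_of_surj v; have [y <-] := vertex_of_surj w.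
by rewrite (@adjacent_connect _ _ p c).
Qed.

Lemma std_valid d k (D : diagram V d k) : valid (std D).
Proof.
have /and3P[kd pD lD] := valP D.1; split; first exact: wired_cubic.
  by apply/wired_paired.
by apply/wired_leggy.
Qed.

Lemma std_le d k (D : diagram V d k) : (k <= 2 * d)%N.
Proof. by have /and3P[] := valP D.1. Qed.

Lemma wired_std d k (p : {perm halfedge k (2 * d - k)}) (c : {ffun 'I_(2 * d - k) -> V}) :
  (k <= 2 * d)%N -> valid (wired p c) ->
  exists2 D : diagram V d k, edges D = p & color D = c.
Proof.
move=> kd [_ /wired_paired pp /wired_leggy pl].
have H : [&& (k <= 2 * d)%N, is_pairing p & every_component_has_leg p] by rewrite kd pp.
by exists (Sub p H, c).
Qed.

(** [froot] selects a first half-edge in each 3-cycle of [nx]; every half-edge at a trivalent vertex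
    is then a selected one turned by a unique element of ['I_3]. *)
Lemma iter_nx_inj (X : raw V) : cubic X -> forall h h' : X, nx h != h ->
  forall a a' : 'I_3, iter a (@nx _ X) h = iter a' (@nx _ X) h' ->
  froot (@nx _ X) h = h -> froot (@nx _ X) h' = h' -> h = h' /\ a = a'.
Proof.
move=> cX h h' nh a a' E rh rh'.
have nxinj : injective (@nx _ X) by move=> x y xy; rewrite -[x]cX xy cX.
have cs := fconnect_sym nxinj.
have hh' : h = h'.
  rewrite -rh -rh'; apply/eqP; rewrite root_connect //.
  apply: (connect_trans (fconnect_iter _ a h)); rewrite E cs; exact: fconnect_iter.
split=> //; move: E; rewrite -hh' {h' rh' hh'}.
have n1 : nx h <> h by apply/eqP.
have n2 : nx (nx h) <> h by move=> e; apply: n1; rewrite -[RHS]cX e.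
have n12 : nx (nx h) <> nx h by move/nxinj.
by case: a a' => [[|[|[|a]]] Ha] [[|[|[|a']]] Ha'] //= E;
  first [exact: val_inj | exfalso; congruence].
Qed.

(** The trivalent vertices are numbered by the roots [T] of their [nx]-cycles and the legs by the
    fixed points [F]. Since [N] is in bijection with [T] times ['I_3], there are [k] roots; the
    pairing is then carried over along the resulting bijection [f]. *)
Lemma std_form (X : raw V) d k : valid X -> ntri X = (3 * k)%N ->
  (nleg X + k = 2 * d)%N -> exists D : diagram V d k, riso (std D) X.
Proof.
move=> vX tX lX; have [cX [pX nX] _] := vX.
have nxinj : injective (@nx _ X) by move=> x y xy; rewrite -[x]cX xy cX.
have cs := fconnect_sym nxinj.
pose N := [set h : X | nx h != h].
pose F := [set h : X | nx h == h].
pose T := [set h : X | (froot (@nx _ X) h == h) && (h \in N)].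
have cF : #|F| = (2 * d - k)%N by rewrite cardsE -[LHS]/(nleg X); lia.
have cN : #|N| = (3 * k)%N by rewrite cardsE.
pose g (x : X * 'I_3) : X := iter x.2 (@nx _ X) x.1.
have nxN h a : iter a (@nx _ X) h \in N = (h \in N).
  by elim: a => //= a <-; rewrite !inE (inj_eq nxinj).
have cT : #|T| = k.
  suff E : (#|T| * #|'I_3|)%N = #|N| by move: E; rewrite cN card_ord; lia.
  rewrite -cardsT -cardsX.
  rewrite -(card_in_imset (f := g)); last first.
    move=> [h a] [h' a']; rewrite !inE /= !andbT => /andP[/eqP rh nh] /andP[/eqP rh' _] E.
    by have [-> ->] := @iter_nx_inj X cX h h' nh a a' E rh rh'.
  apply: eq_card => h; apply/imsetP/idP => [[[h' a]]|hN].
    by rewrite finset.in_setX => /andP[/= + _] ->; rewrite inE /g nxN => /andP[].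
  have := connect_root (frel (@nx _ X)) h; rewrite cs => /iter_findex E.
  set a := findex _ _ _ in E; have aE : iter (a %% 3) (@nx _ X) (froot (@nx _ X) h) = h.
    rewrite -[RHS]E [in RHS](divn_eq a 3) addnC iterD; congr iter.
    elim: (a %/ 3)%N => [//|q IH].
    by rewrite mulSn addnC iterD -[iter 3 _ _]/(nx (nx (nx _))) cX.
  exists (froot (@nx _ X) h, inord (a %% 3)); last first.
    by rewrite /g /= inordK ?ltn_mod.
  rewrite finset.in_setX finset.in_setT andbT /= [_ \in T]inE root_root // eqxx /=.
  by rewrite -(nxN _ (a %% 3)%N) aE.
pose f (h : halfedge k (2 * d - k)) : X := match h with
  | inl (i, a) => iter a (@nx _ X) (enum_val (cast_ord (esym cT) i))
  | inr j => enum_val (cast_ord (esym cF) j) end.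
have fT (i : 'I_k) : enum_val (cast_ord (esym cT) i) \in T by apply: enum_valP.
have fF j : enum_val (cast_ord (esym cF) j) \in F by apply: enum_valP.
have finj : injective f.
  move=> [[i a]|j] [[i' a']|j'] /= E.
  - have := fT i; have := fT i'; rewrite !inE => /andP[/eqP r1 n1] /andP[/eqP r2 n2].
    by have [/enum_val_inj/cast_ord_inj -> ->] := iter_nx_inj cX n2 E r2 r1.
  - have := fF j'; rewrite -E inE; have := nxN (enum_val (cast_ord (esym cT) i)) a.
    by rewrite !inE => + /eqP nf; rewrite nf eqxx; have := fT i; rewrite !inE => /andP[_ ->].
  - have := fF j; rewrite E inE; have := nxN (enum_val (cast_ord (esym cT) i')) a'.
    by rewrite !inE => + /eqP nf; rewrite nf eqxx; have := fT i'; rewrite !inE => /andP[_ ->].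
  - by move/enum_val_inj/cast_ord_inj: E => ->.
have fbij : bijective f.
  apply: inj_card_bij finj _; rewrite card_sum card_prod !card_ord.
  have := cardsC F; rewrite cF (_ : ~: F = N); first by rewrite cN; lia.
  by apply/setP => h; rewrite !inE.
have fnx h : f (next h) = nx (f h).
  case: h => [[i a]|j] /=; last by have := fF j; rewrite inE => /eqP.
  by case: a => [[|[|[|a]]] Ha] //=; rewrite cX.
have [f' ff' f'f] := fbij.
have pinj : injective (f' \o @pr _ X \o f).
  by apply: inj_comp (finj); apply: inj_comp (can_inj pX); apply: can_inj f'f.
pose c := [ffun j => col (f (uni k j))].
have emb : embedding (f : wired (perm pinj) c -> X).
  split=> // [h|h] /=; first by rewrite permE /= f'f.
  by move/eqP; rewrite next_eq; case: h => // j _; rewrite ffunE.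
have [||D De Dc] := @wired_std d k (perm pinj) c; first by lia.
  exact: embedding_valid emb vX.
by exists D; rewrite /std De Dc; exists f.
Qed.

Lemma std_ntri d k (D : diagram V d k) X : riso (std D) X -> ntri X = (3 * k)%N.
Proof. by move/riso_ntri <-; rewrite wired_ntri. Qed.

Lemma std_nleg d k (D : diagram V d k) X : riso (std D) X -> (nleg X + k = 2 * d)%N.
Proof. by move/riso_nleg <-; rewrite wired_nleg subnK ?std_le. Qed.

Lemma std_iso d k (D D' : diagram V d k) : riso (std D) (std D') -> diagram_iso D D'.
Proof.
move=> [f [f1 f2 f3 f4] _]; exists (perm f1); split=> [h|h|j j'].
- by rewrite !permE f2.
- by rewrite !permE f3.
rewrite permE => fj; have := f4 (uni k j) erefl.
by rewrite [f _]fj.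
Qed.

Lemma iso_std d k (D D' : diagram V d k) : diagram_iso D D' -> riso (std D) (std D').
Proof.
move=> [f [f1 f2 f3]]; exists (f : std D -> std D'); last first.
  by exists (f^-1)%g; [exact: permK | exact: permKV].
split=> // [|h]; first exact: perm_inj.
move/eqP; rewrite next_eq; case: h => // j _.
have : next (f (uni k j)) == f (uni k j) by rewrite -f1.
rewrite next_eq; case E : (f (uni k j)) => [|j'] // _.
exact: f3.
Qed.

(* Zero when [X] has no standard form of degree [d] with [k] trivalent vertices. *)
Definition cls d k (X : raw V) : B V d k :=
  if pselect (exists D : diagram V d k, riso (std D) X) is left H
  then diagram_class (projT1 (cid H)) else 0.

Lemma iso_class d k (D D' : diagram V d k) : riso (std D) (std D') ->
  diagram_class D = diagram_class D'.
Proof.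
move=> /std_iso DD'; apply/eqP; rewrite -subr_eq0.
rewrite -(linearB (lproj (@jacobi_relation K V d k))); apply/eqP.
by apply: lproj_eq0; apply: lspan_mem; constructor.
Qed.

Lemma cls_std d k (D : diagram V d k) X : riso (std D) X -> cls d k X = diagram_class D.
Proof.
move=> DX; rewrite /cls; case: pselect => [H|[]]; last by exists D.
case: cid => D' D'X /=; apply: iso_class; exact: riso_trans D'X (riso_sym DX).
Qed.

Lemma cls_iso d k (X Y : raw V) : riso X Y -> cls d k X = cls d k Y.
Proof.
move=> XY; rewrite {2}/cls; case: pselect => [H|nH].
  by case: cid => D DY /=; apply: cls_std; apply: riso_trans DY (riso_sym XY).
rewrite /cls; case: pselect => // -[D DX]; case: nH; exists D.
exact: riso_trans DX XY.
Qed.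

(* The permutations [flip], [I_to_H] and [H_to_X] based at arbitrary half-edges. *)
Definition flipr (X : raw V) (h : X) : {perm X} := tperm (nx h) (nx (nx h)).
Definition ihr (X : raw V) (h h' : X) : {perm X} :=
  (tperm (nx h) (nx (nx h')) * tperm (nx h) (nx h') * tperm (nx h) (nx (nx h)))%g.
Definition hxr (X : raw V) (h h' : X) : {perm X} := tperm (nx h) (nx (nx h')).

Definition separate (X : raw V) (h h' : X) :=
  [&& nx h != h, nx h' != h' & h' \notin [:: h; nx h; nx (nx h)]].

(* These are the functions of diagrams that induce linear maps on every [B V d k]. *)
Record invariant (N : lmodType K) (F : raw V -> N) : Prop := Invariant {
  inv_iso : forall X Y, valid X -> riso X Y -> F X = F Y;
  inv_AS : forall (X : raw V) (h : X), valid X -> nx h != h -> F X + F (rconj (flipr h)) = 0;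
  inv_IHX : forall (X : raw V) (h h' : X), valid X -> separate h h' -> pr h = h' ->
    F X - F (rconj (ihr h h')) + F (rconj (ihr h h' * hxr h h')%g) = 0;
  inv_lin : forall (X : raw V) (c1 c2 : X -> V) (l : X) a, valid X -> nx l = l ->
    (forall h, nx h = h -> h != l -> c1 h = col h /\ c2 h = col h) ->
    col l = a *: c1 l + c2 l -> F X = a *: F (recol c1) + F (recol c2)
}.

End Standard.

(** * Invariant functions as linear maps on [B], and invariance of the class itself *)

Section Universal.
Context (K : fieldType) (V : vectType K).

Lemma next_tri0 k u (i : 'I_k) : next (tri u i ord0) = tri u i (inord 1).
Proof. by congr (inl (_, _)); apply: val_inj; rewrite /= inordK. Qed.

Lemma next_tri1 k u (i : 'I_k) : next (next (tri u i ord0)) = tri u i (inord 2).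
Proof. by congr (inl (_, _)); apply: val_inj; rewrite /= inordK. Qed.

Lemma flipr_std d k (D : diagram V d k) i : flipr (tri _ i ord0 : std D) = flip _ i.
Proof. by rewrite /flipr /flip -next_tri1 -next_tri0. Qed.

Lemma ihr_std d k (D : diagram V d k) i j :
  ihr (tri _ i ord0 : std D) (tri _ j ord0 : std D) = I_to_H _ i j.
Proof. by rewrite /ihr /I_to_H -!next_tri1 -!next_tri0. Qed.

Lemma hxr_std d k (D : diagram V d k) i j :
  hxr (tri _ i ord0 : std D) (tri _ j ord0 : std D) = H_to_X _ i j.
Proof. by rewrite /hxr /H_to_X -!next_tri1 -!next_tri0. Qed.

Lemma separate_std d k (D : diagram V d k) i j :
  separate (tri _ i ord0 : std D) (tri _ j ord0 : std D) = (i != j).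
Proof.
rewrite /separate -![nx _ != _]/(~~ (next _ == _)) !next_eq /= !inE.
have [->|ij] := eqVneq i j; first by rewrite eqxx.
have ne a : ((inl (j, ord0) : halfedge k (2 * d - k)) == inl (i, a)) = false.
  by apply/eqP => [[/eqP]]; rewrite eq_sym (negPf ij).
by rewrite !ne.
Qed.

Lemma std_conj d k (D D' : diagram V d k) (s : {perm halfedge k (2 * d - k)}) :
  edges D' = (edges D ^ s)%g -> color D' = color D ->
  riso (std D') (rconj (s : {perm std D})).
Proof.
move=> eD cD; apply: riso_id => // [h|h _]; last by rewrite cD.
by rewrite /= eD !permM.
Qed.

Lemma invariant_lift (N : lmodType K) (F : raw V -> N) d k : invariant F ->
  exists L : {linear B V d k -> N}, forall D, L (diagram_class D) = F (std D).
Proof.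
move=> [Fiso FAS FIHX Flin].
have [|L LE] := @lquot_lift K _ N (@jacobi_relation K V d k)
    (free_lift (fun D => F (std D))); last first.
  by exists L => D; rewrite LE free_liftU.
have Fconj (D D' : diagram V d k) (s : {perm halfedge k (2 * d - k)}) :
    edges D' = (edges D ^ s)%g -> color D' = color D ->
    F (std D') = F (rconj (s : {perm std D})).
  by move=> eD cD; apply: Fiso (std_valid _) _; apply: std_conj.
move=> _ [D D' DD'|D D' i cD eD|D_I D_H D_X i j ij eij cH eH cX eX|D D1 D2 j a e1 e2 c12 cj].
- rewrite linearB !free_liftU (Fiso _ _ _ (iso_std DD')) ?subrr //.
  exact: std_valid.
- rewrite linearD !free_liftU (Fconj D D' (flip _ i)) // -flipr_std.
  by apply: FAS (std_valid _) _; rewrite [nx _ == _]next_eq.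
- rewrite linearD linearB !free_liftU (Fconj D_I D_H (I_to_H _ i j)) //.
  have eXI : edges D_X = (edges D_I ^ (I_to_H _ i j * H_to_X _ i j))%g.
    by rewrite conjgM -eH.
  rewrite (Fconj D_I D_X _ eXI) ?cX //.
  rewrite -(ihr_std D_I) -(hxr_std D_I).
  by apply: FIHX (std_valid _) _ _ => //; rewrite separate_std.
rewrite linearB linearP !free_liftU; apply/eqP; rewrite subr_eq0; apply/eqP.
have Frec (D' : diagram V d k) : edges D' = edges D ->
    F (std D') = F (recol (@col _ (std D') : std D -> V)).
  by move=> eD; apply: Fiso (std_valid _) _; apply: riso_id => // h; rewrite /= eD.
rewrite (Frec D1) // (Frec D2) //.
apply: (Flin (std D) (@col _ (std D1) : std D -> V) (@col _ (std D2) : std D -> V)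
  (uni _ j : std D) a) => //; first exact: std_valid.
move=> h /eqP; rewrite [_ == _]next_eq; case: h => // j' _.
by rewrite -[_ == _]/(j' == j) => /c12[/= -> ->].
Qed.

Lemma flipr_fix (X : raw V) (h x : X) : flipr h x != x ->
  connect (@link _ X) h x.
Proof.
rewrite /flipr; case: tpermP => [-> _|-> _|]; last by rewrite eqxx.
  exact: link_nx.
exact: connect_trans (link_nx _) (link_nx _).
Qed.

Lemma flipr_connect (X : raw V) (h : X) : cubic X -> paired X ->
  connect (@link _ (rconj (flipr h))) =2 connect (@link _ X).
Proof.
move=> cX pX; apply: (rconj_connect (h0 := h)) => // x; first exact: flipr_fix.
exact: (@flipr_fix (rconj (flipr h))).
Qed.

Definition site (X : raw V) (h h' : X) :=
  [:: nx h; nx (nx h); nx h'; nx (nx h')].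

(** Both permutations of IHX, [ihr] and [ihr * hxr], are of this kind, so connectivity and validity
    of the H and X diagrams are proved once. *)
Definition sited (X : raw V) (s : {perm X}) h h' :=
  forall x, x \notin site h h' -> s x = x.

Lemma ihr_sited (X : raw V) (h h' : X) : sited (ihr h h') h h'.
Proof.
move=> x; rewrite !inE !negb_or => /and4P[x1 x2 x3 x4].
by rewrite /ihr !permM !tpermD // eq_sym.
Qed.

Lemma ihxr_sited (X : raw V) (h h' : X) : sited (ihr h h' * hxr h h')%g h h'.
Proof.
move=> x xs; rewrite permM ihr_sited //; move: xs.
by rewrite !inE !negb_or => /and4P[x1 x2 x3 x4]; rewrite tpermD // eq_sym.
Qed.

Lemma separate_site (X : raw V) (h h' : X) : cubic X -> separate h h' ->
  h \notin site h h' /\ h' \notin site h h'.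
Proof.
move=> cX /and3P[nh nh']; rewrite !inE !negb_or => /and3P[h0 h1 h2].
have nxinj : injective (@nx _ X) by move=> x y xy; rewrite -[x]cX xy cX.
split; apply/and4P; split=> //.
- by rewrite eq_sym.
- by apply: contra nh => /eqP {1}->; rewrite cX.
- by apply: contra h2 => /eqP ->; rewrite cX.
- by apply: contra h1 => /eqP ->; rewrite cX.
- by rewrite eq_sym.
- by apply: contra nh' => /eqP {1}->; rewrite cX.
Qed.

(** The ends [h] and [h'] are fixed by [s], so the inner edge of the IHX relation survives and still
    joins the two vertices where edge ends have moved. *)
Lemma sited_connect_conj (X : raw V) (s : {perm X}) (h h' : X) : cubic X ->
  separate h h' -> pr h = h' -> sited s h h' ->
  forall x, s x != x -> connect (@link _ (rconj s)) h x.
Proof.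
move=> cX sep hh' ss x sx.
have [hs hs'] := separate_site cX sep.
have fixh : s h = h by apply: ss.
have fixh' : s h' = h' by apply: ss.
have prh : @pr _ (rconj s) h = h' by rewrite /= -{1}fixh permK hh' fixh'.
have hh'c : connect (@link _ (rconj s)) h h' by rewrite -prh link_pr.
have n1 y : connect (@link _ (rconj s)) y (@nx _ X y) := @link_nx _ (rconj s) y.
have : x \in site h h' by apply: contraR sx => /ss ->.
rewrite !inE => /or4P[] /eqP ->; first exact: n1.
- exact: connect_trans (n1 _) (n1 _).
- exact: connect_trans hh'c (n1 _).
- exact: connect_trans hh'c (connect_trans (n1 _) (n1 _)).
Qed.

Lemma sited_fix (X : raw V) (s : {perm X}) (h h' : X) : pr h = h' -> sited s h h' ->
  forall x, s x != x -> connect (@link _ X) h x.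
Proof.
move=> hh' ss x sx.
have n1 (y : X) : connect (@link _ X) y (nx y) := link_nx y.
have hh'c : connect (@link _ X) h h' by rewrite -hh' link_pr.
have : x \in site h h' by apply: contraR sx => /ss ->.
rewrite !inE => /or4P[] /eqP ->; first exact: n1.
- exact: connect_trans (n1 _) (n1 _).
- exact: connect_trans hh'c (n1 _).
- exact: connect_trans hh'c (connect_trans (n1 _) (n1 _)).
Qed.

Lemma sited_connect (X : raw V) (s : {perm X}) (h h' : X) : cubic X -> paired X ->
  separate h h' -> pr h = h' -> sited s h h' ->
  connect (@link _ (rconj s)) =2 connect (@link _ X).
Proof.
move=> cX pX sep hh' ss; apply: (rconj_connect (h0 := h)) => //.
  exact: sited_fix ss.
exact: sited_connect_conj ss.
Qed.

Lemma valid_flipr (X : raw V) (h : X) : valid X -> valid (rconj (flipr h)).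
Proof.
move=> [cX pX lX]; split=> //; first exact: rconj_paired.
by apply/rconj_leggy => //; apply: flipr_connect.
Qed.

Lemma valid_sited (X : raw V) (s : {perm X}) (h h' : X) : valid X ->
  separate h h' -> pr h = h' -> sited s h h' -> valid (rconj s).
Proof.
move=> [cX pX lX] sep hh' ss; split=> //; first exact: rconj_paired.
by apply/rconj_leggy => //; apply: sited_connect ss.
Qed.

(** A change of the first half-edge at each vertex. The defining relations of [B] are based at the
    half-edges [(i, 0)]; turning the numbering brings any given half-edge to that position. *)
Definition rot k u (r : 'I_k -> 'I_3) (h : halfedge k u) : halfedge k u :=
  match h with inl (i, a) => tri u i (a + r i) | inr j => uni k j end.

Lemma rot_bij k u (r : 'I_k -> 'I_3) : bijective (@rot k u r).
Proof.
by exists (rot (fun i => - r i)); case=> [[i a]|j] //=; rewrite /tri ?addrK ?subrK.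
Qed.

Lemma rot_next k u (r : 'I_k -> 'I_3) (h : halfedge k u) : rot r (next h) = next (rot r h).
Proof.
case: h => [[i a]|j] //=; congr (inl (_, _)).
by apply: val_inj; case: a (r i) => [[|[|[|a]]] Ha] [[|[|[|b]]] Hb].
Qed.

Lemma std_rot d k (D : diagram V d k) (r : 'I_k -> 'I_3) (X : raw V) (f : std D -> X) :
  valid X -> embedding f -> bijective f ->
  exists D' : diagram V d k, embedding (f \o rot r : std D' -> X).
Proof.
move=> vX ef bf; have [g fg gf] := bf; have [q rq qr] := @rot_bij k (2 * d - k) r.
have [f1 f2 f3 f4] := ef.
have pinj : injective (q \o edges D \o rot r).
  by apply: inj_comp (can_inj rq); apply: inj_comp (can_inj qr) _; apply: perm_inj.
have emb : embedding (f \o rot r : wired (perm pinj) (color D) -> X).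
  split=> [|h|h|h].
  - exact: inj_comp f1 (can_inj rq).
  - by rewrite /= rot_next -f2.
  - by rewrite /= permE /= qr -f3.
  - by move/eqP; rewrite [_ == _]next_eq; case: h => // j _; rewrite /= f4.
have [D' eD cD] := wired_std (std_le D) (embedding_valid emb vX).
by exists D'; rewrite /std eD cD.
Qed.

Lemma conj_transport d k (D : diagram V d k) (X : raw V) (f : std D -> X)
    (s : {perm halfedge k (2 * d - k)}) (t : {perm X}) :
  embedding f -> bijective f -> (forall x, f (s x) = t (f x)) -> valid (rconj t) ->
  exists D' : diagram V d k,
    [/\ edges D' = (edges D ^ s)%g, color D' = color D & riso (std D') (rconj t)].
Proof.
move=> [f1 f2 f3 f4] bf fs vt.
have emb : embedding (f : wired (edges D ^ s)%g (color D) -> rconj t).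
  split=> // h; rewrite /= !permM fs f3; congr (t (pr _)).
  by apply: (@perm_inj _ t); rewrite -fs !permKV.
have [D' eD cD] := wired_std (std_le D) (embedding_valid emb vt).
by exists D'; split=> //; rewrite /std eD cD; exists f.
Qed.

(** All diagrams in one relation have as many half-edges of each kind as [X]. Hence either [X] has a
    standard form, or every term of the relation is 0 by the default value of [cls]. *)
Lemma cls_case (X : raw V) d k : valid X ->
  (exists D : diagram V d k, riso (std D) X) \/
  (forall Y : raw V, ntri Y = ntri X -> nleg Y = nleg X -> cls d k Y = 0).
Proof.
move=> vX; have [DX|nD] := pselect (exists D : diagram V d k, riso (std D) X).
  by left.
right=> Y tY lY; rewrite /cls; case: pselect => // -[D DY]; case: nD.
apply: std_form => //; first by rewrite -tY (std_ntri DY).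
by rewrite -lY (std_nleg DY).
Qed.

Lemma cls_relation d k (x : diagram_rep V d k) :
  jacobi_relation x -> lproj (@jacobi_relation K V d k) x = 0.
Proof. by move=> Jx; apply: lproj_eq0; apply: lspan_mem. Qed.

Lemma tri_surj d k (D : diagram V d k) (x : std D) : nx x != x ->
  exists i a, x = tri _ i a.
Proof. by rewrite [_ == _]next_eq; case: x => [[i a] _|//]; exists i, a. Qed.

Lemma class_flip d k (D D' : diagram V d k) i :
  edges D' = (edges D ^ flip _ i)%g -> color D' = color D ->
  diagram_class D + diagram_class D' = 0.
Proof.
move=> eD cD; rewrite -(linearD (lproj (@jacobi_relation K V d k))).
by apply: cls_relation; apply: Rel_AS cD eD.
Qed.

Lemma cls_invariant d k : invariant (@cls K V d k).
Proof.
split=> [X Y _|X h vX nh|X h h' vX sep hh'|X c1 c2 l a vX nl c12 cl].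
- exact: cls_iso.
- have [[D0 [f0 ef0 bf0]]|C] := cls_case d k vX; last by rewrite !C // addr0.
  have [g0 fg0 gf0] := bf0.
  have [|i [a E]] := @tri_surj d k D0 (g0 h).
    by case: ef0 => f1 f2 _ _; rewrite -(inj_eq f1) f2 gf0.
  have [D ef] := std_rot (fun=> a) vX ef0 bf0.
  have bf : bijective (f0 \o rot (fun=> a)) := bij_comp bf0 (rot_bij _ _).
  have fh : (f0 \o rot (fun=> a)) (tri _ i ord0 : std D) = h.
    by rewrite /= add0r -E gf0.
  move: (f0 \o _) ef bf fh => f ef bf fh; have [f1 f2 f3 f4] := ef.
  have [|D' [eD cD D'X]] :=
    @conj_transport d k D X f (flip _ i) (flipr h) ef bf _ (valid_flipr h vX).
    by move=> x; rewrite -(flipr_std D) /flipr (inj_tperm _ _ _ f1) !f2 fh.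
  rewrite (cls_std D'X) (@cls_std _ _ _ _ D); last by exists f.
  exact: class_flip eD cD.
- have [[D0 [f0 ef0 bf0]]|C] := cls_case d k vX; last by rewrite !C // subr0 addr0.
  have [g0 fg0 gf0] := bf0.
  have /and3P[nh nh' hh0] := sep.
  have [|i [a E]] := @tri_surj d k D0 (g0 h).
    by case: ef0 => f1 f2 _ _; rewrite -(inj_eq f1) f2 gf0.
  have [|j [b E']] := @tri_surj d k D0 (g0 h').
    by case: ef0 => f1 f2 _ _; rewrite -(inj_eq f1) f2 gf0.
  have ij : i != j.
    apply: contraNneq hh0 => ij; have [f1 f2 _ _] := ef0.
    rewrite !inE -[h']gf0 E' -[h]gf0 E -!f2 !(inj_eq f1) ij.
    by case: a b {E E'} => [[|[|[|a]]] Ha] [[|[|[|b]]] Hb] //=;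
      rewrite -![inl _ == _]/((j == j) && _) eqxx.
  (* One rotation must bring both [h] and [h'] to position 0, which is possible because they lie at
     different vertices. *)
  pose r (x : 'I_k) := if x == i then a else b.
  have [D ef] := std_rot r vX ef0 bf0.
  have bf : bijective (f0 \o rot r) := bij_comp bf0 (rot_bij _ _).
  have fh : (f0 \o rot r) (tri _ i ord0 : std D) = h.
    by rewrite /= add0r /r eqxx -E gf0.
  have fh' : (f0 \o rot r) (tri _ j ord0 : std D) = h'.
    by rewrite /= add0r /r eq_sym (negPf ij) -E' gf0.
  move: (f0 \o _) ef bf fh fh' => f ef bf fh fh'; have [f1 f2 f3 f4] := ef.
  have ft x y z : f (tperm x y z) = tperm (f x) (f y) (f z) by apply: inj_tperm.
  have fih x : f (I_to_H _ i j x) = ihr h h' (f x).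
    by rewrite -(ihr_std D) /ihr !permM !ft !f2 fh fh'.
  have fhx x : f (H_to_X _ i j x) = hxr h h' (f x).
    by rewrite -(hxr_std D) /hxr !ft !f2 fh fh'.
  have [|D_H [eH cH HX]] := @conj_transport d k D X f (I_to_H _ i j) (ihr h h') ef bf fih.
    by apply: valid_sited sep hh' _ => //; apply: ihr_sited.
  have [||D_X [eX cX XX]] := @conj_transport d k D X f (I_to_H _ i j * H_to_X _ i j)
      (ihr h h' * hxr h h') ef bf.
    by move=> x; rewrite permM fhx fih [RHS]permM.
  - by apply: valid_sited sep hh' _ => //; apply: ihxr_sited.
  rewrite (cls_std HX) (cls_std XX) (@cls_std _ _ _ _ D); last by exists f.
  pose p := lproj (@jacobi_relation K V d k).
  rewrite -[LHS]/(p _ - p _ + p _) -linearB -linearD; apply: cls_relation.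
  apply: (Rel_IHX (i := i) (j := j)) => //.
  + by apply: f1; rewrite fh' -hh' -fh -f3.
  + by rewrite cX cH.
  + by rewrite eX eH conjgM.
have [[D [f ef bf]]|C] := cls_case d k vX; last by rewrite !C // scaler0 addr0.
have [f1 f2 f3 f4] := ef; have [g fg gf] := bf.
have vr (c : X -> V) : valid (recol c) by case: vX.
have H (c : X -> V) : exists D' : diagram V d k, [/\ edges D' = edges D,
    forall j, color D' j = c (f (uni _ j)) & riso (std D') (recol c)].
  pose cj := [ffun j => c (f (uni k j))].
  have emb : embedding (f : wired (edges D) cj -> recol c).
    split=> // h /eqP; rewrite [_ == _]next_eq; case: h => // j _.
    by rewrite /= ffunE.
  have [D' eD cD] := wired_std (std_le D) (embedding_valid emb (vr c)).
  exists D'; split=> // [j|]; first by rewrite cD ffunE.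
  by rewrite /std eD cD; exists f.
have [D1 [e1 k1 R1]] := H c1; have [D2 [e2 k2 R2]] := H c2.
rewrite (cls_std R1) (cls_std R2) (@cls_std _ _ _ _ D); last by exists f.
pose p := lproj (@jacobi_relation K V d k).
apply/eqP; rewrite -subr_eq0 -[X in X == _]/(p _ - (a *: p _ + p _)) -linearP -linearB.
apply/eqP; apply: cls_relation.
have : next (g l) == g l.
  by apply/eqP; apply: f1; rewrite [f (next _)]f2 gf.
rewrite next_eq; case E : (g l) => [|j] // _.
have fj : f (uni k j) = l by rewrite /uni -E gf.
have fcol j' : col (f (uni k j')) = color D j' by rewrite f4.
apply: (Rel_linear (j := j)) => // [j' jj'|].
  rewrite k1 k2 -!fcol; apply: c12; first by rewrite -f2.
  by rewrite -fj (inj_eq f1); apply: contra jj' => /eqP[->].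
by rewrite k1 k2 -fcol fj cl.
Qed.

End Universal.

(** * Diagrams with a single leg *)

Section Vanishing.
Context (K : fieldType) (V : vectType K) (d k : nat).

Lemma cls_invalid (X : raw V) : ~ valid X -> cls d k X = 0.
Proof.
move=> nX; rewrite /cls; case: pselect => // -[D DX]; case: nX.
exact: riso_valid DX (std_valid D).
Qed.

Local Notation cls := (@cls K V d k).

(** Cutting and splicing edges may create components without legs. Flipping neither creates nor
    removes such a component, so when one is present both classes are 0 and AS still holds. The same
    reasoning gives [cls_ihx]. *)
Lemma cls_flip (X : raw V) (h : X) : cubic X -> paired X -> nx h != h ->
  cls X + cls (rconj (flipr h)) = 0.
Proof.
move=> cX pX nh; have [lX|nX] := pselect (leggy X).
  by apply: (inv_AS (cls_invariant V d k)) nh; split.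
rewrite !cls_invalid ?addr0 // => -[_ _ l]; apply: nX => //.
exact: (rconj_leggy (@flipr_connect _ _ X h cX pX)).1 l.
Qed.

Lemma cls_ihx (X : raw V) (h h' : X) : cubic X -> paired X -> separate h h' ->
  pr h = h' ->
  cls X - cls (rconj (ihr h h')) + cls (rconj (ihr h h' * hxr h h')%g) = 0.
Proof.
move=> cX pX sep hh'; have [lX|nX] := pselect (leggy X).
  by apply: (inv_IHX (cls_invariant V d k)) sep hh'; split.
have z s : sited s h h' -> cls (rconj s) = 0.
  move=> ss; apply: cls_invalid => -[_ _ l]; apply: nX.
  exact: (rconj_leggy (sited_connect cX pX sep hh' ss)).1 l.
rewrite (z _ (@ihr_sited _ _ X h h')) (z _ (@ihxr_sited _ _ X h h')) subr0 addr0.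
by apply: cls_invalid => -[].
Qed.

(** A symmetry [c] of the pairing is absorbed by the conjugation, and a symmetry [r] of the vertices
    fixing the legs is a relabelling. Isomorphisms between modifications of one graph thus become
    identities of permutations. *)
Lemma rconj_riso (X : raw V) (A B c r : {perm X}) :
  (forall h, r (nx h) = nx (r h)) -> (forall h, nx h = h -> r h = h) ->
  (forall h, c (pr h) = pr (c h)) -> (A * r = c * B)%g ->
  riso (rconj A) (rconj B).
Proof.
move=> rn rfix cp E; exists (r : rconj A -> rconj B); last first.
  by exists (r^-1)%g; [exact: permK | exact: permKV].
have E' x : r (A x) = B (c x) by rewrite -!permM E.
split=> // [|h|h /rfix /= -> //]; first exact: perm_inj.
rewrite /= E' cp; congr (B (pr _)); apply: (@perm_inj _ B).
by rewrite -E' !permKV.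
Qed.

Lemma rconj_rconj (X : raw V) (s t : {perm X}) :
  riso (rconj (t : {perm rconj s})) (rconj (s * t)%g).
Proof. by apply: riso_id => // h; rewrite /= permM invMg permM. Qed.

Lemma rconjK (X : raw V) (s : {perm X}) : (s * s = 1)%g ->
  riso (rconj (s : {perm rconj s})) X.
Proof.
move=> ss; apply: riso_trans (rconj_rconj s s) _; rewrite ss.
by case: X s ss => A n p c s ss; apply: riso_id => // h; rewrite /= invg1 !perm1.
Qed.

Lemma tperm_pr (X : raw V) (x : X) : paired X ->
  forall h, tperm x (pr x) (pr h) = pr (tperm x (pr x) h).
Proof.
move=> [pX _] h; have pinj : injective (@pr _ X) := can_inj pX.
by rewrite (inj_tperm _ _ _ pinj) pX tpermC.
Qed.

(* [side] proves that two of the points are distinct. *)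
Local Ltac eval_tperm side := rewrite ?permM; repeat
  match goal with |- context [fun_of_perm (tperm ?a ?b) ?c] =>
    is_var c;
    first [constr_eq a c; rewrite (tpermL a b) | constr_eq b c; rewrite (tpermR a b)
         | rewrite (@tpermD _ a b c); [| by side | by side]]
  end.

(** The two identities [A * r = c * B] that [rconj_riso] requires for the H and X terms of the IHX
    relation at the vertices (v0, v1, v2) and (w0, w1, w2). *)
Lemma six_points (T : finType) (v0 v1 v2 w0 w1 w2 : T)
    (ih := (tperm v2 w2 * tperm v2 w1 * tperm v2 v0)%g) :
  uniq [:: v0; v1; v2; w0; w1; w2] ->
  (tperm w0 v2 * ih * (tperm w0 w1 * tperm w0 w2) = tperm w1 v2 * tperm v2 v0)%g /\
  (tperm w0 v2 * (ih * tperm v2 w2) *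
    (tperm v1 w2 * tperm v1 v0 * tperm v1 w1 * tperm v1 v2 * tperm v1 w0)
    = tperm v1 v2 * tperm w2 v2)%g.
Proof.
rewrite /= !inE !negb_or.
case/and5P=> /and5P[a1 a2 a3 a4 a5] /and4P[a6 a7 a8 a9] /and3P[b1 b2 b3] /andP[b4 b5] /andP[b6 _].
have sp x : x \in [:: v0; v1; v2; w0; w1; w2] \/
   [/\ x != v0, x != v1 & x != v2] /\ [/\ x != w0, x != w1 & x != w2].
  have [xs|xs] := boolP (x \in [:: v0; v1; v2; w0; w1; w2]); [by left | right].
  by move: xs; rewrite !inE !negb_or => /and5P[x0 x1 x2 x3 /andP[x4 x5]].
split; apply/permP => x; rewrite /ih;
  (have [|[[x0 x1 x2] [x3 x4 x5]]] := sp x;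
    last by eval_tperm ltac:(first [assumption | rewrite eq_sym; assumption])).
all: rewrite !inE; case/or4P=> [/eqP->|/eqP->|/eqP->|/or3P[/eqP->|/eqP->|/eqP->]].
all: by eval_tperm ltac:(first [assumption | rewrite eq_sym; assumption]).
Qed.

Local Ltac side_neq := first [assumption | rewrite eq_sym; assumption].

(* In [X] the half-edges v1 and v2 form an edge; [Y h] is [X] with the edge at [h] cut and
   the vertex (v0, v1, v2) spliced in, [h] being joined to v1. *)
Lemma splice_kirchhoff (X : raw V) (v0 v1 v2 w : X)
    (Y := fun h : X => rconj (tperm h v2)) : cubic X -> paired X ->
  nx v0 = v1 -> nx v1 = v2 -> pr v1 = v2 ->
  uniq [:: v0; v1; v2; w; nx w; nx (nx w)] ->
  cls (Y w) + cls (Y (nx w)) + cls (Y (nx (nx w))) = 0.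
Proof.
move=> cX pX v01 v12 pv uv.
have v20 : nx v2 = v0 by rewrite -v12 -v01 cX.
have [id1 id2] := six_points uv.
set w1 := nx w in uv id1 id2 *; set w2 := nx w1 in uv id1 id2 *.
have w20 : nx w2 = w by rewrite /w2 /w1 cX.
move: (uv); rewrite /= !inE !negb_or.
case/and5P=> /and5P[a1 a2 a3 a4 a5] /and4P[a6 a7 a8 a9] /and3P[b1 b2 b3] /andP[b4 b5] /andP[b6 _].
have cY h : cubic (Y h) by [].
have pY h : paired (Y h) := rconj_paired (tperm h v2) pX.
have prv : @pr _ (Y w) v1 = w.
  by rewrite /= tpermV; eval_tperm side_neq; rewrite pv tpermR.
have sep : separate (v1 : Y w) (w : Y w).
  rewrite /separate /= v12 v20 !inE !negb_or.
  by apply/and3P; split; [| |apply/and3P; split]; side_neq.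
(* IHX along the edge of [Y w] from [v1] to [w]: the H term will be the negative of [Y (nx w)], by
   one flip, and the X term will be [Y (nx (nx w))]. *)
have := cls_ihx (cY w) (pY w) sep prv.
have ihE : ihr (v1 : Y w) (w : Y w) = (tperm v2 w2 * tperm v2 w1 * tperm v2 v0)%g.
  by rewrite /ihr /= v12 v20.
have hxE : hxr (v1 : Y w) (w : Y w) = tperm v2 w2 by rewrite /hxr /= v12.
rewrite ihE hxE.
have -> : cls (rconj ((tperm v2 w2 * tperm v2 w1 * tperm v2 v0)%g : {perm Y w})) =
   - cls (Y w1).
  have nv1 : @nx _ (Y w1) v1 != v1 by rewrite /= v12; side_neq.
  have /eqP := cls_flip (cY w1) (pY w1) nv1.
  rewrite addrC addr_eq0 => /eqP <-; apply: cls_iso.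
  apply: riso_trans (rconj_rconj _ _) _.
  apply: riso_trans (riso_sym (rconj_rconj _ _)).
  have -> : flipr (v1 : Y w1) = tperm v2 v0 by rewrite /flipr /= v12 v20.
  (* The relabelling turns the second vertex: [w] to [w1] to [w2] to [w]. *)
  apply: (@rconj_riso _ _ _ 1%g (tperm w w1 * tperm w w2)%g); first last.
  - by rewrite mul1g.
  - by move=> h; rewrite !perm1.
  - move=> h nh; have [hw hw1 hw2] : [/\ w != h, w1 != h & w2 != h].
      split; apply: contraTneq isT => e; move: nh; rewrite -e.
      + by move/eqP; rewrite -/w1 eq_sym (negPf b4).
      + by move/eqP; rewrite -/w2 eq_sym (negPf b6).
      + by move/eqP; rewrite w20 (negPf b5).
    by eval_tperm side_neq.
  move=> h; have [hw|hw] := eqVneq h w.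
    by rewrite hw -/w1; eval_tperm side_neq; rewrite -/w2.
  have [hw1|hw1] := eqVneq h w1.
    by rewrite hw1 -/w2; eval_tperm side_neq; rewrite w20.
  have [hw2|hw2] := eqVneq h w2.
    by rewrite hw2 w20; eval_tperm side_neq.
  have nxinj : injective (@nx _ X) := can_inj (g := fun x => nx (nx x)) cX.
  have nw : nx h != w by rewrite -w20 (inj_eq nxinj).
  have nw1 : nx h != w1 by rewrite (inj_eq nxinj).
  have nw2 : nx h != w2 by rewrite (inj_eq nxinj).
  have -> : (tperm w w1 * tperm w w2)%g h = h by eval_tperm side_neq.
  by set g := nx h in nw nw1 nw2 *; eval_tperm side_neq.
rewrite opprK -addrA => <-; rewrite -!addrA; congr (_ + (_ + _)).
apply: cls_iso; apply: riso_sym.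
apply: riso_trans (rconj_rconj _ _) _.
(* The relabelling exchanges the two vertices by the 6-cycle [v1], [w2], [v0], [w1], [v2], [w]; the
   transposition of [v1] and [v2] preserves the pairing because these two form an edge of [X]. *)
apply: (@rconj_riso _ _ _ (tperm v1 v2)
  (tperm v1 w2 * tperm v1 v0 * tperm v1 w1 * tperm v1 v2 * tperm v1 w)%g); first last.
- by [].
- by move=> h; rewrite -pv tperm_pr.
- move=> h nh.
  have [[? ? ?] [? ? ?]] : [/\ v0 != h, v1 != h & v2 != h] /\ [/\ w != h, w1 != h & w2 != h].
    split; split; apply: contraTneq isT => e; move: nh; rewrite -e => /eqP.
    + by rewrite v01 eq_sym (negPf a1).
    + by rewrite v12 eq_sym (negPf a6).
    + by rewrite v20 (negPf a2).
    + by rewrite -/w1 eq_sym (negPf b4).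
    + by rewrite -/w2 eq_sym (negPf b6).
    + by rewrite w20 (negPf b5).
  by eval_tperm side_neq.
move=> h; have [hw|hw] := eqVneq h w.
  by rewrite hw -/w1; eval_tperm side_neq.
have [hw1|hw1] := eqVneq h w1.
  by rewrite hw1 -/w2; eval_tperm side_neq.
have [hw2|hw2] := eqVneq h w2.
  by rewrite hw2 w20; eval_tperm side_neq.
have [h0|h0] := eqVneq h v0.
  by rewrite h0 v01; eval_tperm side_neq.
have [h1|h1] := eqVneq h v1.
  by rewrite h1 v12; eval_tperm side_neq.
have [h2|h2] := eqVneq h v2.
  by rewrite h2 v20; eval_tperm side_neq.
have nxinj : injective (@nx _ X) := can_inj (g := fun x => nx (nx x)) cX.
have nw : nx h != w by rewrite -w20 (inj_eq nxinj).
have nw1 : nx h != w1 by rewrite (inj_eq nxinj).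
have nw2 : nx h != w2 by rewrite (inj_eq nxinj).
have nv0 : nx h != v0 by rewrite -v20 (inj_eq nxinj).
have nv1 : nx h != v1 by rewrite -v01 (inj_eq nxinj).
have nv2 : nx h != v2 by rewrite -v12 (inj_eq nxinj).
set r := (_ * _)%g; have -> : r h = h by rewrite /r; eval_tperm side_neq.
by rewrite /r; set g := nx h in nw nw1 nw2 nv0 nv1 nv2 *; eval_tperm side_neq.
Qed.

Hypothesis char2 : (2%:R : K) != 0.
Hypothesis char3 : (3%:R : K) != 0.

Lemma double_eq0 (M : lmodType K) (x : M) : x + x = 0 -> x = 0.
Proof.
move=> xx; have : 2%:R *: x = 0 by rewrite scaler_nat mulr2n.
by move/eqP; rewrite scaler_eq0 (negPf char2) => /eqP.
Qed.

(** Flipping at [h] exchanges the two ends of the loop, which gives back the same graph; so AS says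
    that the class is its own negative. *)
Lemma tadpole_eq0 (X : raw V) (h : X) : cubic X -> paired X -> nx h != h ->
  pr (nx h) = nx (nx h) -> cls X = 0.
Proof.
move=> cX pX nh ph; apply: double_eq0.
rewrite -[RHS](cls_flip cX pX nh); congr (_ + _); apply: cls_iso.
have -> : flipr h = tperm (nx h) (pr (nx h)) by rewrite /flipr ph.
case: X h cX pX nh ph => A n p c h cX pX nh ph; apply: riso_id => // x.
by rewrite /= tpermV [RHS](@tperm_pr (Raw n p c) (n h) pX) /= tpermK.
Qed.

(** Splicing at [h] or at [pr h] inserts the vertex into the same edge with its two ends [v1] and
    [v2] exchanged, which is a flip. *)
Lemma splice_flip (X : raw V) (v0 v1 v2 h : X)
    (Y := fun h : X => rconj (tperm h v2)) : cubic X -> paired X ->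
  nx v0 = v1 -> nx v1 = v2 -> nx v0 != v0 -> pr v1 = v2 -> h != v1 -> h != v2 ->
  cls (Y h) + cls (Y (pr h)) = 0.
Proof.
move=> cX pX v01 v12 nv0 pv h1 h2.
have [p2 pn] := pX; have pinj : injective (@pr _ X) := can_inj p2.
have pv' : pr v2 = v1 by rewrite -pv p2.
set h' := pr h; have h'1 : h' != v1 by rewrite -pv' (inj_eq pinj).
have h'2 : h' != v2 by rewrite -pv (inj_eq pinj).
have hh' : h' != h := pn h.
have v12' : v1 != v2 by rewrite -pv eq_sym pn.
have cY g : cubic (Y g) by [].
have pY g : paired (Y g) := rconj_paired (tperm g v2) pX.
have <- := cls_flip (cY h) (pY h) (nv0 : @nx _ (Y h) v0 != v0).
congr (_ + _); apply: cls_iso; apply: riso_sym.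
apply: riso_trans (rconj_rconj _ _) _.
have -> : flipr (v0 : Y h) = tperm v1 v2 by rewrite /flipr /= v01 v12.
(* With no relabelling, [c] must be the quotient of the two conjugations. It is the 4-cycle [h],
   [v1], [h'], [v2], which interchanges the edges [h h'] and [v1 v2] and so preserves the
   pairing. *)
apply: (@rconj_riso _ _ _ (tperm h v2 * tperm v1 v2 * tperm h' v2)%g 1%g).
- by move=> x; rewrite !perm1.
- by move=> x _; rewrite perm1.
- move=> x; have p' : pr h' = h by rewrite /h' p2.
  have [->|xh] := eqVneq x h; first by rewrite -/h'; eval_tperm side_neq; rewrite pv.
  have [->|xh'] := eqVneq x h'; first by rewrite p'; eval_tperm side_neq; rewrite pv'.
  have [->|x1] := eqVneq x v1; first by rewrite pv; eval_tperm side_neq; rewrite p'.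
  have [->|x2] := eqVneq x v2; first by rewrite pv'; eval_tperm side_neq.
  have q1 : pr x != h by rewrite -p' (inj_eq pinj).
  have q2 : pr x != h' by rewrite (inj_eq pinj).
  have q3 : pr x != v1 by rewrite -pv' (inj_eq pinj).
  have q4 : pr x != v2 by rewrite -pv (inj_eq pinj).
  set s := (_ * _)%g; have -> : s x = x by rewrite /s; eval_tperm side_neq.
  by rewrite /s; set g := pr x in q1 q2 q3 q4 *; eval_tperm side_neq.
by rewrite mulg1 -[RHS]mulgA tperm2 mulg1.
Qed.

(* [X0] removes from the edge at [b] the vertex (v0, v1, v2) next to the leg [t]; splicing it
   back gives [X], and splicing it into its own edge at [a = pr v0] gives a tadpole. *)
Lemma one_leg_eq0 (X : raw V) : valid X -> nleg X = 1%N -> cls X = 0.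
Proof.
move=> [cX pX _] l1; have [p2 pn] := pX.
have pinj : injective (@pr _ X) := can_inj p2.
have nxinj : injective (@nx _ X) := can_inj (g := fun x => nx (nx x)) cX.
have [t nt uniqt] : exists2 t : X, nx t = t & forall x, nx x = x -> x = t.
  have /cards1P[t tE] : #|[set h : X | nx h == h]| == 1%N by rewrite cardsE -l1.
  exists t => [|x nxx].
    by apply/eqP; have := finset.set11 t; rewrite -tE inE.
  by apply/finset.set1P; rewrite -tE inE nxx.
have tricyc (x : X) : x != t -> [/\ nx x != x, nx (nx x) != x & nx (nx x) != nx x].
  move=> xt; have nx1 : nx x != x by apply: contra xt => /eqP/uniqt->.
  split=> //; last by rewrite (inj_eq nxinj).
  by rewrite -{2}[x]cX !(inj_eq nxinj) eq_sym.
pose v2 := pr t; pose v0 := nx v2; pose v1 := nx v0.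
have pv2 : pr v2 = t by rewrite /v2 p2.
have v2t : v2 != t := pn t.
have [n1 n2 n3] := tricyc _ v2t; rewrite -/v0 -/v1 in n1 n2 n3.
have v12 : nx v1 = v2 by rewrite /v1 /v0 cX.
have v0t : v0 != t by rewrite -nt (inj_eq nxinj).
have v1t : v1 != t by rewrite -nt (inj_eq nxinj).
pose b := pr v1.
(* If the two remaining half-edges at the vertex form an edge, the diagram is already a tadpole. *)
have [bv0|bv0] := eqVneq b v0.
  by apply: (@tadpole_eq0 X v2) => //; rewrite -/v0 -/v1 -bv0 /b p2.
have bv1 : b != v1 := pn v1.
have bv2 : b != v2 by rewrite -[v2]p2 (inj_eq pinj) pv2.
have bt : b != t by rewrite -[t]p2 (inj_eq pinj) -/v2.
pose a := pr v0.
have ab : a != b by rewrite (inj_eq pinj) eq_sym.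
have av0 : a != v0 := pn v0.
have av2 : a != v2 by rewrite -[v2]p2 (inj_eq pinj) pv2.
have av1 : a != v1 by rewrite -[v1]p2 (inj_eq pinj) -/b eq_sym.
have at' : a != t by rewrite -[t]p2 (inj_eq pinj) -/v2.
pose X0 : raw V := rconj (tperm b v2).
have cX0 : cubic X0 by [].
have pX0 : paired X0 := rconj_paired (tperm b v2) pX.
have q1 : @pr _ X0 v1 = v2.
  by rewrite /= tpermV; eval_tperm side_neq; rewrite -/b tpermL.
have q0 : @pr _ X0 v0 = a.
  by rewrite /= tpermV; eval_tperm side_neq; rewrite -/a; eval_tperm side_neq.
have qt : @pr _ X0 t = b.
  by rewrite /= tpermV; eval_tperm side_neq; rewrite -/v2 tpermR.
pose Y (h : X0) : raw V := rconj (tperm h v2).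
pose P : X0 -> X0 := @pr _ X0.
have PP : involutive P := pX0.1.
have Pinj : injective P := can_inj PP.
(* The half-edges at the other trivalent vertices; extending [f] by 0 to the leg and to the spliced
   vertex lets the sums run over all half-edges. *)
pose N := [pred h : X0 | [&& h != t, h != v0, h != v1 & h != v2]].
pose f (h : X0) := if h \in N then cls (Y h) else 0.
have nxN h : (nx h \in N) = (h \in N).
  rewrite !inE -{1}nt -{1}v12 (_ : v0 = @nx _ X0 v2) // (_ : v1 = @nx _ X0 v0) //.
  rewrite !(inj_eq nxinj).
  by case: (h == t); case: (h == v0); case: (h == v1); case: (h == v2).
(* [splice_kirchhoff] makes the sum over each vertex vanish. Summed over all half-edges, every
   vertex is counted three times, hence the division by 3. *)
have sum0 : \sum_h f h = 0.
  have fcyc h : f h + f (nx h) + f (nx (nx h)) = 0.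
    rewrite /f !nxN; case: ifP => [hN|_]; last by rewrite !addr0.
    move: (hN); rewrite inE => /and4P[ht h0 h1 h2].
    move: (hN); rewrite -nxN inE => /and4P[k0 k1 k2 k3].
    move: (hN); rewrite -nxN -nxN inE => /and4P[l0 l2 l3 l4].
    have [m1 m2 m3] := tricyc _ ht.
    apply: (@splice_kirchhoff X0 v0 v1 v2 h) => //.
    rewrite /= !inE !negb_or /=.
    by repeat (apply/andP; split); first [by [] | side_neq].
  have r1 : \sum_h f (nx h) = \sum_h f h by rewrite [RHS](reindex_inj nxinj).
  have r2 : \sum_h f (nx (nx h)) = \sum_h f h.
    by rewrite [RHS](reindex_inj (inj_comp nxinj nxinj)).
  have : \sum_h (f h + f (nx h) + f (nx (nx h))) = 0 by rewrite big1.
  rewrite !big_split /= r1 r2 => S3; have : 3%:R *: \sum_h f h = 0.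
    by rewrite scaler_nat mulrSr mulr2n.
  by move/eqP; rewrite scaler_eq0 (negPf char3) => /eqP.
have fa : f a = 0.
  rewrite /f; case: ifP => // _.
  have PX : @pr _ (Y a) v0 = v2.
    rewrite -[LHS]/(tperm a v2 (@pr _ X0 ((tperm a v2)^-1%g v0))) tpermV.
    by eval_tperm side_neq; rewrite q0 tpermL.
  apply: (@tadpole_eq0 (Y a) v1) => //.
  - exact: rconj_paired.
  - by rewrite /= v12; side_neq.
  have pv2' : @pr _ (Y a) v2 = v0.
    by rewrite -[in LHS]PX (@rconj_paired _ X0 (tperm a v2) pX0).1.
  by rewrite -[LHS]/(@pr _ (Y a) (nx v1)) -[RHS]/(nx (nx v1)) v12.
have fb : f b = cls X.
  rewrite /f inE bt bv0 bv1 bv2 /=; apply: cls_iso.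
  apply: rconjK; exact: tperm2.
(* The same sum regrouped along edges. An edge with both ends in [N] cancels by [splice_flip], and
   the edges meeting the spliced vertex contribute only the tadpole [f a] or zeros. There remains
   the edge joining the leg [t] to [b]. *)
pose g h := f h + f (P h).
have gsum : \sum_h g h = 0.
  have r : \sum_h f (P h) = \sum_h f h by rewrite [RHS](reindex_inj Pinj).
  by rewrite big_split /= r sum0 addr0.
have g0 h : h != b -> h != t -> g h = 0.
  move=> hb ht; rewrite /g.
  have [->|ha] := eqVneq h a; first by rewrite fa -q0 PP /f !inE eqxx andbF addr0.
  have [->|h0] := eqVneq h v0; first by rewrite /P q0 fa /f !inE eqxx andbF addr0.
  have [->|h1] := eqVneq h v1; first by rewrite /P q1 /f !inE !eqxx !andbF addr0.
  have [->|h2] := eqVneq h v2.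
    by rewrite -q1 PP /f !inE q1 !eqxx !andbF addr0.
  have hN : h \in N by rewrite inE ht h0 h1 h2.
  have PhN : P h \in N.
    have ne x y : P x = y -> h != x -> P h != y by move=> <-; rewrite (inj_eq Pinj).
    rewrite inE; apply/and4P; split.
    - by apply: (ne b) => //; rewrite -[b]qt PP.
    - by apply: (ne a) => //; rewrite -[a]q0 PP.
    - by apply: (ne v2) => //; rewrite -[v2 in LHS]q1 PP.
    - exact: (ne v1).
  by rewrite /f hN PhN; apply: (@splice_flip X0 v0 v1 v2 h).
(* The surviving edge is seen from both ends, so the conclusion is that twice the class of [X]
   vanishes. *)
have : g b + g t = 0.
  rewrite -[RHS]gsum [RHS](bigD1 b) //= [X in _ = _ + X](bigD1 t) /=; last by side_neq.
  by rewrite big1 ?addr0 // => h /andP[]; apply: g0.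
have Pt : P t = b := qt; have Pb : P b = t by rewrite -Pt PP.
have ft : f t = 0 by rewrite /f !inE eqxx.
by rewrite /g Pb Pt ft addr0 add0r fb => /double_eq0.
Qed.

End Vanishing.

(** * Connected components *)

Lemma big_disjointU (R : Type) (idx : R) (op : Monoid.com_law idx) (I : finType)
    (A B : {set I}) (F : I -> R) : [disjoint A & B] ->
  \big[op/idx]_(i in A :|: B) F i =
    op (\big[op/idx]_(i in A) F i) (\big[op/idx]_(i in B) F i).
Proof. by move=> AB; rewrite -bigU //; apply: eq_bigl => i; rewrite in_setU. Qed.

Section Components.
Context (K : fieldType) (V : vectType K).

Lemma cubic_nx_inj (X : raw V) : cubic X -> injective (@nx _ X).
Proof. by move=> cX x y xy; rewrite -[x]cX xy cX. Qed.

(** With [u] legs and [k] trivalent vertices, the bound of edges by vertices minus one reads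
    [u + k - 1 <= (u + 3k) / 2], that is [u <= k + 2]; [ntri] counts half-edges and equals [3k],
    which explains the factors 3 and 6. *)
Lemma euler_bound (X : raw V) : cubic X -> paired X -> conn X ->
  (3 * nleg X <= ntri X + 6)%N.
Proof.
move=> cX [p2 pn] [/card_gt0P[h0 _] cnX]; have nxinj := cubic_nx_inj cX.
(* Each vertex gets total weight 3, whether a leg or trivalent, so the weight of a union of vertices
   is three times their number. *)
pose w (h : X) := if nx h == h then 3 else 1%N.
pose inner (A : {set X}) := [set h in A | pr h \in A].
pose orb (h : X) : {set X} := [set h; nx h; nx (nx h)].
have orbw h : (\sum_(x in orb h) w x = 3)%N.
  have wn x : w (nx x) = w x by rewrite /w (inj_eq nxinj).
  have [e|e] := eqVneq (nx h) h.
    have -> : orb h = [set h] by rewrite /orb !e !setUid.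
    by rewrite big_set1 /w e eqxx.
  have e2 : nx (nx h) != h by rewrite -{2}[h]cX !(inj_eq nxinj) eq_sym.
  rewrite /orb setUC big_setU1 /=; last first.
    by rewrite !inE negb_or e2 (inj_eq nxinj).
  rewrite big_setU1 ?big_set1 /=; last by rewrite inE eq_sym.
  by rewrite !wn /w (negPf e).
have orbn h x : x \in orb h -> nx x \in orb h.
  by rewrite !inE => /orP[/orP[]|] /eqP->; rewrite ?cX !eqxx ?orbT.
(* [A] is a union of vertices with at most one more vertex than inner edges, multiplied by 6. A
   single vertex qualifies, and a largest such set is shown to be everything. *)
pose good (A : {set X}) := [&& A != set0, [forall x in A, nx x \in A]
  & 2 * \sum_(x in A) w x <= 3 * #|inner A| + 6]%N.
have g0 : good (orb h0).
  apply/and3P; split; first by apply/set0Pn; exists h0; rewrite !inE eqxx.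
    by apply/forall_inP => x; apply: orbn.
  by rewrite orbw leq_addl.
pose A := [arg max_(A > orb h0 | good A) #|A|].
have [gA mA] : good A /\ forall B, good B -> (#|B| <= #|A|)%N.
  by rewrite /A; case: arg_maxnP.
have /and3P[/set0Pn[a aA] /forall_inP nA bA] := gA.
have AT : A = setT.
  apply/setP => x; rewrite in_setT.
  (* By connectivity some edge leaves [A]; adding the vertex at its far end adds one vertex and at
     least one inner edge, against maximality. *)
  apply: contraT => xA; have : exists2 y, y \in A & pr y \notin A.
    have [//|nex] := pselect (exists2 y, y \in A & pr y \notin A).
    have stA y : y \in A -> pr y \in A.
      by move=> yA; apply: contraT => pyA; case: nex; exists y.
    have /connectP[p] := cnX a x; elim: p a aA => [|b p IH] c cA /=.
      by move=> _ xc; rewrite xc cA in xA.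
    case/andP=> cb pb lb; apply: (IH b) => //.
    by case/orP: cb => /eqP ->; [apply: nA | apply: stA].
  case=> y yA pyA; pose O := orb (pr y).
  have dO : [disjoint A & O].
    rewrite disjoint_sym; apply/pred0P => z /=; apply/negP => /andP[zO zA].
    case/negP: pyA; move: zO; rewrite !inE => /orP[/orP[]|] /eqP e.
    - by rewrite -e.
    - by rewrite -[pr y]cX -e; apply: (nA _ (nA _ zA)).
    - by rewrite -[pr y]cX -e; apply: nA.
  have pyO : pr y \in O by rewrite !inE eqxx.
  have gAO : good (A :|: O).
    apply/and3P; split; first by apply/set0Pn; exists y; rewrite inE yA.
      apply/forall_inP => z; rewrite in_setU [nx z \in _]in_setU => /orP[zA|zO].
        by rewrite nA.
      by rewrite (orbn (pr y)) ?orbT.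
    have -> : (\sum_(x in A :|: O) w x = \sum_(x in A) w x + 3)%N.
      by rewrite -(orbw (pr y)) big_disjointU.
    rewrite mulnDr.
    have : (#|inner A| + #|[set y; pr y]| <= #|inner (A :|: O)|)%N.
      have <- : #|inner A :|: [set y; pr y]| = (#|inner A| + #|[set y; pr y]|)%N.
        rewrite cardsU; have -> : inner A :&: [set y; pr y] = set0.
          apply/setP => z; rewrite !inE; apply/negP => /andP[/andP[zA pzA]].
          by case/orP=> /eqP e; rewrite e in zA pzA;
             [rewrite pzA in pyA | rewrite zA in pyA].
        by rewrite cards0 subn0.
      apply/subset_leq_card/fintype.subsetP => z; rewrite in_setU.
      case/orP; first by rewrite !inE => /andP[-> ->].
      have pyU : pr y \in A :|: O by rewrite in_setU pyO orbT.
      have yU : y \in A :|: O by rewrite in_setU yA.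
      by rewrite in_set2 => /orP[] /eqP ->; rewrite inE ?p2 yU pyU.
    by rewrite cards2 eq_sym pn; lia.
  have := mA _ gAO; rewrite leqNgt => /negP[]; apply: proper_card.
  apply/properP; split; first exact: subsetUl.
  by exists (pr y) => //; rewrite in_setU pyO orbT.
move: bA; rewrite AT.
have -> : (\sum_(x in [set: X]) w x = 3 * nleg X + ntri X)%N.
  rewrite (bigID (fun x => nx x == x)) /= /nleg /ntri -!sum1_card big_distrr /=.
  congr (_ + _)%N; apply: eq_big => x; rewrite ?inE //= /w.
    by move=> ->.
  by move/negPf->.
have -> : inner [set: X] = setT by apply/setP => x; rewrite !inE.
rewrite cardsT -[#|X|](cardC [pred h | nx h == h]).
have -> : #|[predC [pred h : X | nx h == h]]| = ntri X by apply: eq_card => x; rewrite !inE.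
rewrite -/(nleg X); lia.
Qed.

Lemma type_exists (X : raw V) : cubic X -> paired X ->
  exists d k, ntri X = (3 * k)%N /\ (nleg X + k = 2 * d)%N.
Proof.
move=> cX [p2 pn]; have nxinj := cubic_nx_inj cX.
have E3 : (fcard (@nx _ X) [pred h | nx h != h] * 3 = ntri X)%N.
  apply: fcard_order_set => //.
    apply/fintype.subsetP => h; rewrite !inE => nh; apply/eqP.
    apply: (@order_cycle _ _ [:: h; nx h; nx (nx h)]); last exact: mem_head.
      by rewrite /= !eqxx cX eqxx.
    have n2 : nx (nx h) != h by rewrite -{2}[h]cX !(inj_eq nxinj) eq_sym.
    rewrite /= !inE negb_or (eq_sym h) nh (eq_sym h) n2 eq_sym (inj_eq nxinj).
    by rewrite nh.
  by move=> x y /eqP <-; rewrite !inE (inj_eq nxinj).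
have E2 : (fcard (@pr _ X) predT * 2 = #|X|)%N.
  apply: fcard_order_set => //; first exact: can_inj p2.
  apply/fintype.subsetP => h _; rewrite inE; apply/eqP.
  apply: (@order_cycle _ _ [:: h; pr h]); last exact: mem_head.
    by rewrite /= !eqxx p2 eqxx.
  by rewrite /= inE eq_sym pn.
have C : #|X| = (nleg X + ntri X)%N.
  rewrite -[LHS](cardC [pred h : X | nx h == h]) /nleg /ntri.
  by congr (_ + _)%N; apply: eq_card => x; rewrite !inE.
move: E3 E2; set k := fcard _ _; set m := fcard _ _ => E3 E2.
(* [m] counts edges, so [nleg + 3k = 2m], and the degree is [m - k]. *)
by exists (m - k)%N, k; lia.
Qed.

Definition comps (X : raw V) : {set {set X}} := [set cc h | h : X].

Lemma comps_stable (X : raw V) (S : {set X}) : S \in comps X -> stable S.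
Proof. by case/imsetP => h _ ->; apply: cc_stable. Qed.

Lemma embedding_cc (X Y : raw V) (f : X -> Y) h : embedding f ->
  cc (f h) = f @: cc h.
Proof.
move=> ef; apply/setP => y; rewrite inE; apply/idP/imsetP.
  by move/(connect_embedding _ _ ef) => [z -> hz]; exists z; rewrite ?inE.
case=> z; rewrite inE => hz ->; by rewrite (embedding_connect _ _ ef).
Qed.

Lemma restr_imset (X Y : raw V) (f : X -> Y) (S : {set X}) : embedding f -> stable S ->
  riso (restr S) (restr (f @: S)).
Proof.
move=> ef sS; have [f1 f2 f3 f4] := ef.
have sfS : stable (f @: S).
  move=> _ /imsetP[x xS ->]; rewrite -f2 -f3 !imset_f //.
    by have [] := sS _ xS.
  by have [] := sS _ xS.
have [i1 i2 i3 i4] := restr_embedding sS; have [j1 j2 j3 j4] := restr_embedding sfS.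
pose g (x : restr S) : restr (f @: S) := exist _ (f (val x)) (imset_f f (valP x)).
have vg x : val (g x) = f (val x) by [].
have ginj : injective g.
  by move=> x y xy; apply: i1; apply: f1; rewrite -!vg xy.
exists g; last by apply: inj_card_bij ginj _; rewrite !card_sig card_imset.
split=> // [h|h|h nh].
- by apply: j1; rewrite vg i2 f2 j2.
- by apply: j1; rewrite vg i3 f3 j3.
by rewrite -j4 ?vg ?f4 ?i4 // -?i2 ?nh //; apply: j1; rewrite j2 vg -f2 -i2 nh.
Qed.

Context (R : comAlgType K) (phi : raw V -> R).
Hypothesis phi_inv : invariant phi.

Definition Phi (X : raw V) : R := \prod_(S in comps X) phi (restr S).

Lemma restr_valid (X : raw V) (S : {set X}) : valid X -> stable S -> valid (restr S).
Proof. by move=> vX sS; apply: embedding_valid (restr_embedding sS) vX. Qed.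

Lemma Phi_imset (X Y : raw V) (f : X -> Y) : valid X -> embedding f ->
  \prod_(S in [set f @: (T : {set X}) | T in comps X]) phi (restr S) = Phi X.
Proof.
move=> vX ef; have [f1 _ _ _] := ef; rewrite big_imset /=; last first.
  by move=> S T _ _; apply: imset_inj.
apply: eq_bigr => S /comps_stable sS; apply/esym.
apply: (inv_iso phi_inv); [exact: restr_valid | exact: restr_imset].
Qed.

Lemma Phi_iso (X Y : raw V) : valid X -> riso X Y -> Phi X = Phi Y.
Proof.
move=> vX [f ef [g fg gf]]; rewrite -(Phi_imset vX ef); apply: eq_bigl => S.
congr (S \in pred_of_set _); apply/setP => T; apply/imsetP/imsetP.
  move=> [_ /imsetP[h _ ->] ->]; exists (f h) => //; by rewrite (embedding_cc _ ef).
move=> [y _ ->]; exists (cc (g y)); first exact: imset_f.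
by rewrite -(embedding_cc _ ef) gf.
Qed.

Lemma Phi_rsum (X Y : raw V) : valid X -> valid Y -> Phi (rsum X Y) = Phi X * Phi Y.
Proof.
move=> vX vY; have el := @inl_embedding V X Y; have er := @inr_embedding V X Y.
rewrite -(Phi_imset vX el) -(Phi_imset vY er).
have -> : Phi (rsum X Y) = \prod_(S in
    [set (inl : X -> rsum X Y) @: (T : {set X}) | T in comps X] :|:
    [set (inr : Y -> rsum X Y) @: (T : {set Y}) | T in comps Y]) phi (restr S).
  apply: eq_bigl => S; rewrite in_setU; apply/imsetP/orP.
    move=> [[x|y] _ ->]; [left|right].
      by rewrite (embedding_cc x el) !imset_f.
    by rewrite (embedding_cc y er) !imset_f.
  case=> /imsetP[_ /imsetP[h _ ->] ->].
    by exists (inl h); rewrite // (embedding_cc h el).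
  by exists (inr h); rewrite // (embedding_cc h er).
rewrite big_disjointU //= disjoints_subset.
apply/fintype.subsetP => _ /imsetP[_ /imsetP[x _ ->] ->].
rewrite inE; apply/imsetP => -[_ /imsetP[y _ ->]].
move/setP/(_ (inl x)); rewrite imset_f; last by rewrite inE connect0.
by move/esym/imsetP => [].
Qed.

Lemma Phi_rzero : Phi rzero = 1.
Proof. by rewrite /Phi big1 // => S /imsetP[[]]. Qed.

Lemma Phi_conn (X : raw V) : valid X -> conn X -> Phi X = phi X.
Proof.
move=> vX [/card_gt0P[h _] cX]; have ccT (x : X) : cc x = setT.
  by apply/setP => y; rewrite !inE cX.
have -> : Phi X = \prod_(S in [set [set: X]]) phi (restr S).
  apply: eq_bigl => S; rewrite in_set1; apply/imsetP/eqP => [[x _ ->]|->] //.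
  by exists h; rewrite ?ccT.
have sT : stable [set: X] by move=> x _; rewrite !in_setT.
rewrite big_set1; apply: (inv_iso phi_inv); first exact: restr_valid.
have e := restr_embedding sT; exists val => //.
by apply: inj_card_bij; [exact: val_inj | rewrite card_sig cardsT].
Qed.

Lemma Phi_split (X : raw V) h :
  Phi X = phi (restr (cc h)) * \prod_(S in comps X | S != cc h) phi (restr S).
Proof. by rewrite /Phi (bigD1 (cc h)) ?imset_f. Qed.

(** The components are the same subsets before and after, and [s] moves points of only one of them,
    so all the other factors are unchanged. [Z] is a convenient model of the modified component. *)
Lemma Phi_rconj (X : raw V) (s : {perm X}) h (Z : raw V) : valid X ->
  (forall x, s x != x -> connect (@link _ X) h x) ->
  connect (@link _ (rconj s)) =2 connect (@link _ X) ->
  riso (@restr _ (rconj s) (@cc _ X h)) Z ->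
  Phi (rconj s) = phi Z * \prod_(S in comps X | S != cc h) phi (restr S).
Proof.
move=> vX sh E iZ; have [cX pX lX] := vX.
have vs : valid (rconj s).
  by split=> //; [exact: rconj_paired | apply/(rconj_leggy E)].
have ccE (x : X) : cc (x : rconj s) = cc x :> {set X}.
  by apply/setP => y; rewrite !inE E.
have compsE : comps (rconj s) = comps X :> {set {set X}}.
  by apply: eq_imset => x; apply: ccE.
rewrite (Phi_split (h : rconj s)) ccE compsE; congr (_ * _).
  apply: (inv_iso phi_inv _ iZ); apply: restr_valid => //.
  by rewrite -ccE; apply: cc_stable.
apply: eq_bigr => S /andP[SX Sh].
have sS : @stable V X S := @comps_stable X S SX.
have fixS (x : X) : x \in S -> s x = x.
  move=> xS; apply: contraNeq Sh => /sh hx; case/imsetP: SX xS => y _ ->.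
  rewrite inE => yx; apply/eqP/setP => z; rewrite !inE.
  have sym := link_sym cX pX.
  by rewrite (same_connect sym (connect_trans yx (_ : connect _ x h))) // sym.
apply: (inv_iso phi_inv).
  apply: (restr_valid (X := rconj s)) => // x xS; split; first by have [] := sS _ xS.
  have pxS : @pr _ X x \in S by have [] := sS _ xS.
  by rewrite /= -{1}(fixS _ xS) permK fixS.
apply: riso_id => // -[x xS] /=; congr insubd.
have pxS : @pr _ X x \in S by have [] := sS _ xS.
by rewrite -{1}(fixS _ xS) permK fixS.
Qed.

Lemma restr_rconj (X : raw V) (S : {set X}) (s : {perm X}) (t : {perm restr S}) :
  stable S -> (forall x, val (t x) = s (val x)) ->
  riso (restr (S : {set rconj s})) (rconj t).
Proof.
move=> sS vt; apply: riso_id => // x; apply: val_inj.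
have [_ _ i3 _] := restr_embedding sS.
rewrite /= vt i3 val_insubd /=.
have E : val ((t^-1)%g x) = (s^-1)%g (val x).
  by apply: (@perm_inj _ s); rewrite -vt !permKV.
rewrite -E; case: ifP => // /negP[].
rewrite -i3 -vt; exact: valP.
Qed.

End Components.

(** * Relations under products and disjoint unions; decomposition into connected diagrams *)

Section Lists.
Context (K : fieldType) (V : vectType K).

Lemma mem_cc (X : raw V) (h : X) : h \in cc h.
Proof. by rewrite inE connect0. Qed.

Lemma Phi_invariant (R : comAlgType K) (phi : raw V -> R) :
  invariant phi -> invariant (Phi phi).
Proof.
move=> phi_inv.
have vcc (X : raw V) (h : X) : valid X -> valid (restr (cc h)).
  by move=> vX; apply: restr_valid => //; apply: cc_stable.
split=> [X Y|X h vX nh|X h h' vX sep hh'|X c1 c2 l a vX nl c12 cl].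
- exact: Phi_iso.
- have [cX pX lX] := vX; pose h0 : restr (cc h) := Sub h (mem_cc h).
  have [i1 i2 i3 i4] := restr_embedding (@cc_stable _ X h).
  rewrite (Phi_split _ h).
  rewrite (@Phi_rconj _ _ _ _ phi_inv X (flipr h) h (rconj (flipr h0))) //.
  + rewrite -mulrDl (inv_AS phi_inv) ?mul0r //; first exact: vcc.
    by rewrite -(inj_eq i1) i2.
  + exact: flipr_fix.
  + exact: flipr_connect.
  + apply: restr_rconj => [|x]; first exact: cc_stable.
    by rewrite /flipr (inj_tperm _ _ _ i1) !i2.
- have [cX pX lX] := vX.
  have hc := mem_cc h.
  have h'c : h' \in cc h by rewrite inE -hh' link_pr.
  pose h0 : restr (cc h) := Sub h hc; pose h0' : restr (cc h) := Sub h' h'c.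
  have [i1 i2 i3 i4] := restr_embedding (@cc_stable _ X h).
  have it x y z : val (tperm x y z : restr (cc h)) = tperm (val x) (val y) (val z).
    exact: inj_tperm.
  rewrite (Phi_split _ h).
  rewrite (@Phi_rconj _ _ _ _ phi_inv X _ h (rconj (ihr h0 h0'))) //.
  rewrite (@Phi_rconj _ _ _ _ phi_inv X _ h (rconj (ihr h0 h0' * hxr h0 h0')%g)) //.
  + rewrite -mulrBl -mulrDl (inv_IHX phi_inv) ?mul0r //; first exact: vcc.
      move: sep; rewrite /separate !inE -![h' == _]/(val h0' == _).
      by rewrite -!(inj_eq i1) !i2.
    by apply: i1; rewrite i3.
  + exact: sited_fix hh' (@ihxr_sited _ _ X h h').
  + exact: sited_connect sep hh' (@ihxr_sited _ _ X h h').
  + apply: restr_rconj => [|x]; first exact: cc_stable.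
    by rewrite /ihr /hxr !permM !it !i2.
  + exact: sited_fix hh' (@ihr_sited _ _ X h h').
  + exact: sited_connect sep hh' (@ihr_sited _ _ X h h').
  + apply: restr_rconj => [|x]; first exact: cc_stable.
    by rewrite /ihr !permM !it !i2.
have lc := mem_cc l.
pose l0 : restr (cc l) := Sub l lc.
have [i1 i2 i3 i4] := restr_embedding (@cc_stable _ X l).
pose c' (c : X -> V) (x : restr (cc l)) := c (val x).
have H (c : X -> V) : (forall h, nx h = h -> h != l -> c h = col h) ->
    Phi phi (recol c) = phi (recol (c' c)) *
      \prod_(S in comps X | S != cc l) phi (restr S).
  move=> cE; rewrite (Phi_split _ (l : recol c)); congr (_ * _).
  apply: eq_bigr => S /andP[SX Sl]; have sS : @stable _ X S := @comps_stable _ _ X S SX.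
  apply: (inv_iso phi_inv).
    apply: (@restr_valid _ _ (recol c)) => //; by case: vX.
  have [_ k2 _ _] := restr_embedding sS.
  apply: riso_id => // x nx'; apply: cE; first by rewrite -k2 -[in RHS]nx'.
  apply: contraNneq Sl => xl; have lS : l \in S by rewrite -xl; apply: valP.
  case/imsetP: SX lS => y _ ->; rewrite inE => yl; apply/eqP/setP => z; rewrite !inE.
  have [cX pX _] := vX; exact: (same_connect (link_sym cX pX)).
rewrite (H c1) => [|h nh hl]; last by have [] := c12 _ nh hl.
rewrite (H c2) => [|h nh hl]; last by have [] := c12 _ nh hl.
rewrite (Phi_split _ l) scalerAl -mulrDl; congr (_ * _).
apply: (inv_lin phi_inv (l := l0)) => //; first exact: vcc.
  by apply: i1; rewrite i2.
move=> x nx' xl; apply: c12; first by rewrite -i2 nx'.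
by apply: contra xl => /eqP xl; apply/eqP/i1.
Qed.

Lemma rsum_rconj (X Z : raw V) (s : {perm X}) (t : {perm rsum X Z}) :
  (forall x, t (inl x) = inl (s x)) -> (forall z, t (inr z) = inr z) ->
  riso (rsum (rconj s) Z) (rconj t).
Proof.
move=> tl tr; apply: riso_id => // h.
have tlV x : (t^-1)%g (inl x) = inl ((s^-1)%g x).
  by apply: (@perm_inj _ t); rewrite permKV tl permKV.
have trV z : (t^-1)%g (inr z) = inr z by apply: (@perm_inj _ t); rewrite permKV tr.
by case: h => x /=; rewrite ?tlV ?trV /= ?tl ?tr.
Qed.

(** Makes the class of a disjoint union linear in each component separately, so that components can
    be expanded in the bases one by one. *)
Lemma rsum_invariant (N : lmodType K) (F : raw V -> N) (Z : raw V) :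
  valid Z -> invariant F -> invariant (fun X => F (rsum X Z)).
Proof.
move=> vZ [Fiso FAS FIHX Flin].
have vS X : valid X -> valid (rsum X Z) by move=> vX; apply: rsum_valid.
have il (X : raw V) x y z : tperm (inl x : rsum X Z) (inl y) (inl z) = inl (tperm x y z).
  by rewrite -(inj_tperm (f := inl : X -> rsum X Z)) // => u v [].
have ir (X : raw V) x y z : tperm (inl x : rsum X Z) (inl y) (inr z) = inr z.
  by rewrite tpermD.
split=> [X Y vX XY|X h vX nh|X h h' vX sep hh'|X c1 c2 l a vX nl c12 cl].
- by apply: Fiso; [exact: vS | apply: rsum_riso => //; apply: riso_refl].
- rewrite (Fiso (rsum (rconj (flipr h)) Z) (rconj (flipr (inl h : rsum X Z)))); last 2 first.
  + by apply: vS; apply: valid_flipr.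
  + by apply: rsum_rconj => x; rewrite ?il ?ir.
  by apply: FAS; [exact: vS | apply: contraNneq nh => -[e]; rewrite [nx h]e].
- have iE (x y : X) : ((inl x : rsum X Z) == inl y) = (x == y) by apply: inj_eq => u v [].
  have ssep : separate (inl h : rsum X Z) (inl h').
    by move: sep; rewrite /separate !inE /= !iE.
  rewrite (Fiso (rsum (rconj (ihr h h')) _) (rconj (ihr (inl h : rsum X Z) (inl h')))).
  rewrite (Fiso (rsum (rconj (ihr h h' * hxr h h')%g) _)
    (rconj (ihr (inl h : rsum X Z) (inl h') * hxr (inl h : rsum X Z) (inl h'))%g)).
  + by apply: FIHX => //; [exact: vS | rewrite /= hh'].
  + by apply: vS; apply: (valid_sited vX sep hh'); apply: ihxr_sited.
  + by apply: rsum_rconj => x; rewrite /ihr /hxr !permM ?il ?ir.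
  + by apply: vS; apply: (valid_sited vX sep hh'); apply: ihr_sited.
  + by apply: rsum_rconj => x; rewrite /ihr !permM ?il ?ir.
pose c' (c : X -> V) (h : rsum X Z) := match h with inl x => c x | inr z => col z end.
have vr (c : X -> V) : valid (recol c) by case: vX.
have H (c : X -> V) : F (rsum (recol c) Z) = F (recol (c' c)).
  by apply: Fiso; [exact: vS | apply: riso_id => // -[]].
rewrite !H; apply: (Flin (rsum X Z) (c' c1) (c' c2) (inl l)) => //.
- exact: vS.
- by rewrite /= nl.
- by case=> x [] // nx' xl; apply: c12.
Qed.

(* A multiset of diagrams is represented by a list [L], and its disjoint union by
   [rlist L]. *)
Definition diag_index := {dk : nat * nat & diagram V dk.1 dk.2}.
HB.instance Definition _ := Choice.on diag_index.

Definition rI (x : diag_index) : raw V := std (tagged x).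
Definition connI (x : diag_index) : bool := connected_graph (edges (tagged x)).
Definition rlist (L : seq diag_index) : raw V :=
  foldr (fun x => rsum (rI x)) rzero L.
Definition dtot (L : seq diag_index) := (\sum_(x <- L) (tag x).1)%N.
Definition ktot (L : seq diag_index) := (\sum_(x <- L) (tag x).2)%N.

Lemma rI_valid x : valid (rI x). Proof. exact: std_valid. Qed.

Lemma rlist_valid L : valid (rlist L).
Proof.
elim: L => [|x L IH]; first exact: rzero_valid.
by apply: rsum_valid => //; apply: rI_valid.
Qed.

Lemma rlist_cat L1 L2 : riso (rlist (L1 ++ L2)) (rsum (rlist L1) (rlist L2)).
Proof.
elim: L1 => [|x L IH] /=; first exact: riso_sym (rsum0 _).
apply: riso_trans (rsum_riso (riso_refl _) IH) _; exact: rsumA.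
Qed.

Lemma rlist_perm L1 L2 : perm_eq L1 L2 -> riso (rlist L1) (rlist L2).
Proof.
move=> p; apply: (@catCA_perm_ind _ (fun L => riso (rlist L1) (rlist L))) p _.
  move=> s1 s2 s3 H; apply: (riso_trans H).
  rewrite !catA; apply: riso_trans (rlist_cat _ _) _.
  apply: riso_trans (riso_sym (rlist_cat _ _)).
  apply: rsum_riso (riso_refl _); apply: riso_trans (rlist_cat _ _) _.
  apply: riso_trans (riso_sym (rlist_cat _ _)); exact: rsumC.
exact: riso_refl.
Qed.

Lemma rlist_ntri L : ntri (rlist L) = (3 * ktot L)%N.
Proof.
rewrite /ktot; elim: L => [|x L IH].
  by rewrite big_nil; apply: eq_card0 => -[].
by rewrite big_cons /= ntri_rsum IH wired_ntri mulnDr.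
Qed.

Lemma rlist_nleg L : (nleg (rlist L) + ktot L = 2 * dtot L)%N.
Proof.
rewrite /ktot /dtot; elim: L => [|x L IH].
  by rewrite !big_nil addn0; apply: eq_card0 => -[].
rewrite !big_cons -[rlist _]/(rsum (rI x) (rlist L)) nleg_rsum wired_nleg mulnDr -IH.
have xle := std_le (tagged x); lia.
Qed.

Lemma rlist_std L : exists D : diagram V (dtot L) (ktot L), riso (std D) (rlist L).
Proof. by apply: std_form; [exact: rlist_valid | exact: rlist_ntri | exact: rlist_nleg]. Qed.

Lemma cls_rlist0 d k L : (d != dtot L) || (k != ktot L) -> cls d k (rlist L) = 0.
Proof.
move=> dk; rewrite /cls; case: pselect => // -[D DL].
have := std_ntri DL; have := std_nleg DL; have := rlist_nleg L; rewrite rlist_ntri.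
by move: dk; case: eqVneq => //= e; lia.
Qed.

Lemma conn_index (X : raw V) : valid X -> conn X ->
  exists2 x, connI x & riso (rI x) X.
Proof.
move=> vX cX; have [c p _] := vX.
have [d [k [tX lX]]] := type_exists c p; have [D DX] := std_form vX tX lX.
exists (Tagged (fun dk : nat * nat => diagram V dk.1 dk.2) (D : diagram V (d, k).1 (d, k).2)) => //.
apply/(wired_conn _ (color D)); exact: riso_conn (riso_sym DX) cX.
Qed.

Lemma decomp (X : raw V) : valid X -> exists2 L, all connI L & riso (rlist L) X.
Proof.
have [n] := ubnP #|X|; elim: n X => // n IH X Xn vX.
have [X0|/card_gt0P[h _]] := posnP #|X|.
  exists [::] => //; pose f (x : @rzero V) : X := match x with end.
  exists f; first by split; case.
  by apply: inj_card_bij; [case | rewrite X0].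
have [cX pX lX] := vX; have sS := @cc_stable _ X h.
have sC := stableC cX pX sS.
have cc0 : (0 < #|cc h|)%N by apply/card_gt0P; exists h; rewrite inE connect0.
have [|x cx xS] := @conn_index (restr (cc h)) (restr_valid vX sS).
  split=> [|y z]; first by rewrite card_sig.
  rewrite -(embedding_connect _ _ (restr_embedding sS)).
  have := valP y; have := valP z; rewrite !inE => hz hy.
  by apply: connect_trans hz; rewrite (link_sym cX pX).
have [|L cL LC] := IH (restr (~: cc h)) _ (restr_valid vX sC).
  move: Xn cc0; rewrite card_sig -(cardsC (cc h)).
  rewrite -[#|in_mem^~ _|]/(#|~: cc h|); set p := #|~: _|; set q := #|cc h|; lia.
exists (x :: L); first by rewrite /= cx.
apply: riso_trans (restr_split cX pX sS); exact: rsum_riso xS LC.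
Qed.

End Lists.

(** * Bases of connected diagrams and the map from [B] to polynomials *)

Section Basis.
Context (K : fieldType) (V : vectType K).

Local Notation I := (diag_index V).
Local Notation R := (malg (cmonom I) K).

Definition mkI d k (D : diagram V d k) : I :=
  existT (fun dk : nat * nat => diagram V dk.1 dk.2) (d, k) D.

Definition class_at (x : I) : B V (tag x).1 (tag x).2 := diagram_class (tagged x).

Lemma B_lspan d k (m : B V d k) : lspan (range (@diagram_class K V d k)) m.
Proof.
apply: (lspan_trans _ (@lquot_lspan _ _ (@jacobi_relation K V d k) _ (@freeg_lspan _ _) m)).
by move=> _ [_ [D _ <-] <-]; apply: lspan_mem; exists D.
Qed.

Definition spans_connected (P : I -> Prop) := forall d k (D : diagram V d k),
  connected_graph (edges D) ->
  lspan [set diagram_class E | E in [set E | P (mkI E)]]%classic (diagram_class D).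

Lemma exists_basis : exists (P : I -> Prop) (lin : forall d k, {linear B V d k -> R}),
  [/\ forall x, P x -> connI x, spans_connected P
    & forall x, P x -> lin _ _ (class_at x) = var K x].
Proof.
have H (dk : nat * nat) : exists AL : set (diagram V dk.1 dk.2) * {linear B V dk.1 dk.2 -> R},
   [/\ (AL.1 `<=` [set D | connected_graph (edges D)])%classic,
     forall D, connected_graph (edges D) ->
       lspan (@diagram_class K V dk.1 dk.2 @` AL.1)%classic (diagram_class D)
     & forall D, AL.1 D -> AL.2 (diagram_class D) = var K (existT _ dk D)].
  have [A [AP Asp AL]] := @partial_hamel_basis K _ _ (@diagram_class K V dk.1 dk.2)
     [set D | connected_graph (edges D)]%classic (@B_lspan dk.1 dk.2).
  by have [L LE] := AL R (fun D => var K (existT _ dk D)); exists (A, L).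
pose f dk := projT1 (cid (H dk)).
exists (fun x => (f (tag x)).1 (tagged x)), (fun d k => (f (d, k)).2).
split=> [[dk D]|d k D cD|[[d k] D]] /=; rewrite /f; case: cid => -[A L] /= [AP Asp LE].
- exact: AP.
- exact: Asp.
- exact: LE.
Qed.

(** The components of one diagram have various types, so a function of raw graphs has to read off
    from each graph which [B V d k] its class is taken in. *)
Definition kk (X : raw V) := (ntri X %/ 3)%N.
Definition dd (X : raw V) := ((nleg X + kk X)./2)%N.

Lemma kk_std d k (D : diagram V d k) : kk (std D) = k.
Proof. by rewrite /kk wired_ntri mulKn. Qed.

Lemma dd_std d k (D : diagram V d k) : dd (std D) = d.
Proof.
by have kd := std_le D; rewrite /dd kk_std /std wired_nleg subnK // mul2n half_double.
Qed.

Lemma invariant_comp (M N : lmodType K) (F : raw V -> M) (f : {linear M -> N}) :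
  invariant F -> invariant (f \o F).
Proof.
move=> [Fiso FAS FIHX Flin].
split=> [X Y vX XY|X h vX nh|X h h' vX sep hh'|X c1 c2 l a vX nl c12 cl] /=.
- by rewrite (Fiso X Y).
- by rewrite -linearD FAS ?linear0.
- by rewrite -linearB -linearD FIHX ?linear0.
- by rewrite (Flin X c1 c2 l a) // linearP.
Qed.

(** [rconj] and [recol] keep [nx], so all terms of AS, IHX and linearity have the same type, even by
    conversion; only isomorphisms need an argument. *)
Lemma invariant_typed (N : lmodType K) (F : nat -> nat -> raw V -> N) :
  (forall d k, invariant (F d k)) -> invariant (fun X => F (dd X) (kk X) X).
Proof.
move=> Finv; split=> [X Y vX XY|X h vX nh|X h h' vX sep hh'|X c1 c2 l a vX nl c12 cl].
- have -> : kk Y = kk X by rewrite /kk (riso_ntri XY).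
  have -> : dd Y = dd X by rewrite /dd /kk (riso_ntri XY) (riso_nleg XY).
  exact: (inv_iso (Finv _ _)).
- exact: (inv_AS (Finv (dd X) (kk X))).
- exact: (inv_IHX (Finv (dd X) (kk X))).
- exact: (inv_lin (Finv (dd X) (kk X)) vX nl).
Qed.

(** Components in [L1] are still arbitrary connected diagrams, those in [L2] are basis diagrams.
    With the others fixed, the class is linear in the head of [L1], which can therefore be replaced
    by basis diagrams and moved to [L2]. *)
Lemma cls_lspan (P : I -> Prop) : (forall x, P x -> connI x) -> spans_connected P ->
  forall d k (m : B V d k), lspan [set cls d k (rlist L) | L in
    [set L | [/\ forall x, x \in L -> P x, dtot L = d & ktot L = k]]]%classic m.
Proof.
move=> Pc Psp d k m; set A := [set _ | _ in _]%classic.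
have key L1 : forall L2, all (@connI _ _) L1 -> (forall x, x \in L2 -> P x) ->
    lspan A (cls d k (rlist (L1 ++ L2))).
  elim: L1 => [|x L1 IH] L2 /=.
    (* The induction does not keep track of the total type; a list of another type has class 0. *)
    move=> _ PL2; have [/andP[/eqP dL /eqP kL]|] := boolP ((d == dtot L2) && (k == ktot L2)).
      by apply: lspan_mem; exists L2.
    by rewrite negb_and => /cls_rlist0 ->; apply: lspan0.
  case/andP=> cx cL1 PL2.
  have inv := rsum_invariant (rlist_valid (L1 ++ L2)) (cls_invariant V d k).
  have [L LE] := invariant_lift (tag x).1 (tag x).2 inv.
  rewrite -LE; apply: (lspan_sub (f := L)) (Psp _ _ _ cx) => _ [E PE <-].
  rewrite LE; have -> : cls d k (rsum (std E) (rlist (L1 ++ L2))) =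
      cls d k (rlist (L1 ++ mkI E :: L2)).
    rewrite -[rsum _ _]/(rlist (mkI E :: L1 ++ L2)); apply: cls_iso; apply: rlist_perm.
    by rewrite -cat1s perm_catCA.
  apply: IH => // y; rewrite inE => /orP[/eqP -> //|]; exact: PL2.
apply: (lspan_trans _ (B_lspan m)) => _ [D _ <-].
have [L cL LD] := decomp (std_valid D).
rewrite -(cls_std (riso_refl (std D))) -(cls_iso _ _ LD) -[L]cats0; exact: key.
Qed.

Context (lin : forall d k, {linear B V d k -> R}).

Definition phiI (x : I) : R := lin _ _ (class_at x).
Definition phiR (X : raw V) : R := lin _ _ (cls (dd X) (kk X) X).

Lemma phiR_invariant : invariant phiR.
Proof.
apply: (invariant_typed (F := fun d k => lin d k \o cls d k)) => d k.
by apply: invariant_comp; apply: cls_invariant.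
Qed.

Lemma phiR_std (x : I) : phiR (rI x) = phiI x.
Proof.
rewrite /phiR /phiI /rI kk_std dd_std; congr (lin _ _ _).
exact: cls_std (riso_refl _).
Qed.

Lemma Phi_rlist L : all (@connI _ _) L -> Phi phiR (rlist L) = \prod_(x <- L) phiI x.
Proof.
elim: L => [_|x L IH]; first by rewrite big_nil; apply: Phi_rzero.
case/andP=> cx cL; rewrite big_cons -(IH cL) -phiR_std.
have cxr : conn (rI x) by apply/wired_conn.
rewrite -(Phi_conn phiR_invariant (rI_valid x) cxr).
exact: (Phi_rsum phiR_invariant (rI_valid x) (rlist_valid L)).
Qed.

Lemma exists_PhiB d k : exists F : {linear B V d k -> R}, forall L,
  all (@connI _ _) L -> dtot L = d -> ktot L = k ->
  F (cls d k (rlist L)) = \prod_(x <- L) phiI x.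
Proof.
have inv := Phi_invariant phiR_invariant.
have [F FE] := invariant_lift d k inv; exists F => L cL dL kL.
have [D DL] := rlist_std L; rewrite -(Phi_rlist cL).
move: D DL; rewrite dL kL => D DL; rewrite (cls_std DL) FE.
by apply: (inv_iso inv) DL; apply: std_valid.
Qed.

Hypothesis char2 : (2%:R : K) != 0.
Hypothesis char3 : (3%:R : K) != 0.

(** [d - 1 <= k] is [euler_bound], and [k <= 2d - 2] means at least two legs. Validity gives one;
    exactly one would make the class vanish, while the linear form [lin] sends a basis diagram to a
    nonzero variable. *)
Lemma basis_good (P : I -> Prop) : (forall x, P x -> connI x) ->
  (forall x, P x -> phiI x = var K x) ->
  forall x, P x -> good (tag x).1 (tag x).2.
Proof.
move=> Pc Pv x Px; have vx := rI_valid x; have [cX pX lX] := vx.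
have cx : conn (rI x) by apply/wired_conn/Pc.
have := euler_bound cX pX cx; rewrite wired_ntri wired_nleg.
have kd := std_le (tagged x).
have legs : (0 < 2 * (tag x).1 - (tag x).2)%N.
  rewrite -(wired_nleg (edges (tagged x)) (color (tagged x))).
  have [/card_gt0P[h _] _] := cx; have [l [_ nl]] := lX h.
  by apply/card_gt0P; exists l; rewrite inE; apply/eqP.
have : (2 * (tag x).1 - (tag x).2 != 1)%N.
  apply/eqP => l1; have := @one_leg_eq0 K V (tag x).1 (tag x).2 char2 char3 (rI x) vx.
  rewrite wired_nleg => /(_ l1); rewrite (cls_std (riso_refl _)) => e.
  by have := Pv x Px; rewrite /phiI /class_at e linear0 => /esym/var_neq0.
move/eqP; rewrite /good => h1 h2; apply/and3P; split; lia.
Qed.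

End Basis.

(** * Generators of the right-hand side *)

Section Generators.
Context (K : fieldType) (V : vectType K).

Local Notation I := (diag_index V).
Local Notation R := (malg (cmonom I) K).

(* The element of [Bc V d k] of a connected diagram; zero if the class of [D] does not
   belong to it. *)
Definition bc d k (D : diagram V d k) : Bc V d k :=
  (insubd (0 : lsub (@connected_classes K V d k)) (diagram_class D)
   : lsub (@connected_classes K V d k)).

Definition bval d k (x : Bc V d k) : B V d k := val (x : lsub _).

Lemma bval_inj d k : injective (@bval d k).
Proof. exact: val_inj. Qed.

Lemma bval_linear d k : linear (@bval d k).
Proof. by []. Qed.

Lemma bcE d k (D : diagram V d k) : connected_graph (edges D) ->
  bval (bc D) = diagram_class D.
Proof.
move=> cD; rewrite /bval /bc val_insubd.
have -> : in_span (@connected_classes K V d k) (diagram_class D); last by [].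
by apply/asboolP; apply: lspan_mem; exists D.
Qed.

Lemma bc_act d k g (D : diagram V d k) : connected_graph (edges D) ->
  rep_act (Bc V d k) g (bc D) = bc (diagram_act g D).
Proof.
move=> cD; apply: bval_inj; rewrite (bcE (D := diagram_act g D)) //.
rewrite -diagram_class_act -bcE //.
Qed.

Lemma Bc_lspan (P : I -> Prop) : (forall x, P x -> connI x) -> spans_connected P ->
  forall d k (x : Bc V d k),
  lspan [set bc E | E in [set E : diagram V d k | P (mkI E)]]%classic x.
Proof.
move=> Pc Psp d k x; set A := [set _ | _ in _]%classic.
(* Spanning is known in the ambient space [B]; combinations of classes are lifted term by term to
   the subspace. *)
have key v : lspan [set diagram_class E | E in [set E : diagram V d k | P (mkI E)]]%classic v ->
    exists2 y : Bc V d k, bval y = v & lspan A y.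
  elim=> [|b _ u [E PE <-] _ [y <- Ay]]; first by exists 0; [|exact: lspan0].
  exists (b *: bc E + y); first by rewrite bval_linear bcE //; apply: (Pc (mkI E)).
  by apply: lspan_cons Ay; exists E.
have [|y yx Ay] := key (bval x); last by rewrite -(bval_inj yx).
have cx : lspan (@connected_classes K V d k) (bval x).
  by apply/asboolP; apply: (valP (x : lsub _)).
by apply: lspan_trans cx => _ [D cD ->]; apply: Psp.
Qed.

Definition SymT (t : nat * nat * nat) : rep K (GL V) :=
  let: (a, d, k) := t in Sym a (Bc V d k).

(* [gen_sym P L y]: [y] is the product of the classes of the diagrams in [L], all of
   which satisfy [P]; similarly for [gen_term] and [gen_dsum]. *)
Definition gen_sym (P : I -> Prop) (t : nat * nat * nat) :
    seq I -> SymT t -> Prop :=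
  match t return seq I -> SymT t -> Prop with
  | (a, d, k) => fun L y => exists w : 'I_a -> diagram V d k,
     [/\ forall i, P (mkI (w i)), L = [seq mkI (w i) | i <- enum 'I_a]
       & y = psym [ffun i => bc (w i)]]
  end.

Lemma gen_sym_lspan (P : I -> Prop) : (forall x, P x -> connI x) -> spans_connected P ->
  forall t (y : SymT t), lspan [set y | exists L, gen_sym P L y]%classic y.
Proof.
move=> Pc Psp [[a d] k] y.
apply: (lspan_trans _ (@sym_lspan K _ a _ _ (@Bc_lspan P Pc Psp d k) y)) => _ [x Bx <-].
apply: lspan_mem.
have H i : exists E : diagram V d k, P (mkI E) /\ bc E = x i.
  by have [E PE Ex] := Bx i; exists E.
have [w wP] := choice H.
exists [seq mkI (w i) | i <- enum 'I_a]; exists w.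
split=> [i||]; [by have [] := wP i | reflexivity | ].
by congr psym; apply/ffunP => i; rewrite ffunE; have [_ ->] := wP i.
Qed.

Lemma gen_symW (P Q : I -> Prop) t L (y : SymT t) : (forall x, P x -> Q x) ->
  gen_sym P L y -> gen_sym Q L y.
Proof.
by case: t y => -[a d] k y PQ [w [Pw Lw yw]]; exists w; split=> // i; apply: PQ.
Qed.

Lemma gen_sym_prod (lin : forall d k, {linear B V d k -> R}) t :
  exists psi : {linear SymT t -> R}, forall L (y : SymT t),
    gen_sym (@connI _ _) L y -> psi y = \prod_(x <- L) phiI lin x.
Proof.
case: t => -[a d] k.
have [f fE] : exists f : {linear Bc V d k -> R}, f =1 lin d k \o @bval d k.
  by apply: exists_linear => b x y /=; rewrite bval_linear linearP.
have [psi psiE] := sym_prod a f.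
exists psi => L y [w [cw -> ->]]; rewrite psiE big_map big_enum /=.
by apply: eq_bigr => i _; rewrite ffunE fE /= bcE //; apply: cw.
Qed.

Lemma mkI_inj d k : injective (@mkI K V d k).
Proof. by move=> D E /eqP; rewrite eq_Tagged => /eqP. Qed.

Lemma gen_sym_perm (P Q : I -> Prop) t L L' (y y' : SymT t) : perm_eq L L' ->
  gen_sym P L y -> gen_sym Q L' y' -> y = y'.
Proof.
case: t y y' => -[a d] k y y' LL' [w [_ Lw ->]] [w' [_ Lw' ->]].
move: LL'; rewrite Lw Lw' -/(codom _).
have -> : [seq mkI (w i) | i <- enum 'I_a] = [tuple mkI (w i) | i < a] by [].
have -> : [seq mkI (w' i) | i <- enum 'I_a] = [tuple mkI (w' i) | i < a] by [].
case/tuple_permP => s E.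
rewrite -(psym_perm s [ffun i => bc (w' i)]); congr psym; apply/ffunP => i.
rewrite !ffunE; congr bc; apply: mkI_inj.
have := congr1 (fun t => nth (mkI (w i)) t i) E.
rewrite -!tnth_nth !tnth_mktuple //.
Qed.

Definition actI (g : GL V) (x : I) : I :=
  existT (fun dk : nat * nat => diagram V dk.1 dk.2) (tag x) (diagram_act g (tagged x)).

Lemma gen_sym_act t g L (y : SymT t) : gen_sym (@connI _ _) L y ->
  gen_sym (@connI _ _) (map (actI g) L) (rep_act (SymT t) g y).
Proof.
case: t y => -[a d] k y [w [cw -> ->]]; exists (fun i => diagram_act g (w i)); split.
- by move=> i; apply: cw.
- by rewrite -map_comp; apply: eq_map => i.
rewrite [LHS]psym_act; congr psym; apply/ffunP => i; rewrite !ffunE.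
exact: bc_act (cw i).
Qed.

Lemma gen_sym_tag P t L (y : SymT t) : gen_sym P L y ->
  size L = t.1.1 /\ forall x, x \in L -> tag x = (t.1.2, t.2) /\ P x.
Proof.
case: t y => -[a d] k y [w [Pw -> _]]; rewrite size_map size_enum_ord; split=> // x.
by case/mapP => i _ ->.
Qed.

Lemma tag_mkI (x : I) d k : tag x = (d, k) -> exists D : diagram V d k, x = mkI D.
Proof. by case: x => dk D /= e; move: D; rewrite e => D; exists D. Qed.

Lemma gen_sym_exists (P : I -> Prop) a d k L : size L = a ->
  (forall x, x \in L -> tag x = (d, k) /\ P x) ->
  exists y : SymT (a, d, k), gen_sym P L y.
Proof.
move=> sL LP.
have H (i : 'I_a) : exists D : diagram V d k, tnth (in_tuple L) (cast_ord (esym sL) i) = mkI D.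
  by apply: tag_mkI; have [] := LP _ (mem_tnth (cast_ord (esym sL) i) (in_tuple L)).
have [w wP] := choice H.
exists (psym [ffun i => bc (w i)]); exists w; split=> [i||]; last by [].
  by rewrite -wP; have [] := LP _ (mem_tnth (cast_ord (esym sL) i) (in_tuple L)).
rewrite -[LHS](val_tcast sL (in_tuple L)) -[LHS]/(tval (tcast sL (in_tuple L))).
rewrite -[LHS]map_tnth_enum; apply: eq_map => i.
by rewrite -wP tcastE.
Qed.

Definition gen_term (P : I -> Prop) (s : seq (nat * nat * nat)) (L : seq I)
    (y : decomposition_term V s) : Prop :=
  exists (f : 'I_(size s) -> seq I)
    (z : family (fun i : 'I_(size s) => SymT (tnth (in_tuple s) i))),
  [/\ forall i, gen_sym P (f i) (z i), L = flatten [seq f i | i <- enum 'I_(size s)]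
    & y = ptensor z].

Lemma gen_term_lspan (P : I -> Prop) : (forall x, P x -> connI x) -> spans_connected P ->
  forall s (y : decomposition_term V s),
  lspan [set y | exists L, gen_term P L y]%classic y.
Proof.
move=> Pc Psp s y.
pose G (i : 'I_(size s)) : set (SymT (tnth (in_tuple s) i)) :=
  [set z | exists L, gen_sym P L z]%classic.
apply: (lspan_trans _ (@tensor_lspan K _ _ (fun i : 'I_(size s) => SymT (tnth (in_tuple s) i))
  G (fun i => @gen_sym_lspan P Pc Psp _) y)) => _ [z zG <-].
apply: lspan_mem.
pose f i := projT1 (cid (zG i)).
have fP i : gen_sym P (f i) (z i) by rewrite /f; case: cid.
by exists (flatten [seq f i | i <- enum 'I_(size s)]), f, z.
Qed.

Lemma gen_term_prod (lin : forall d k, {linear B V d k -> R}) s :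
  exists psi : {linear decomposition_term V s -> R}, forall L y,
    gen_term (@connI _ _) L y -> psi y = \prod_(x <- L) phiI lin x.
Proof.
have H (i : 'I_(size s)) := gen_sym_prod lin (tnth (in_tuple s) i).
pose psi i := projT1 (cid (H i)).
have psiP i L y : gen_sym (@connI _ _) L y -> psi i y = \prod_(x <- L) phiI lin x.
  by rewrite /psi; case: cid => p /= pE /pE.
have [T TE] := @tensor_prod _ _ _ (fun i : 'I_(size s) => SymT (tnth (in_tuple s) i)) R psi.
exists T => L y [f [z [fz -> ->]]]; rewrite TE big_flatten big_map big_enum /=.
by apply: eq_bigr => i _; apply: psiP.
Qed.

Lemma gen_term_act s g L (y : decomposition_term V s) : gen_term (@connI _ _) L y ->
  gen_term (@connI _ _) (map (actI g) L) (rep_act (decomposition_term V s) g y).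
Proof.
case=> f [z [fz -> ->]]; exists (fun i => map (actI g) (f i)), (family_act g z); split.
- by move=> i; rewrite ffunE; apply: gen_sym_act.
- by rewrite map_flatten -map_comp.
- exact: ptensor_act.
Qed.

End Generators.

Lemma flatten_delta (T : Type) (J : finType) (i : J) (F : J -> seq T) :
  (forall j, j != i -> F j = [::]) -> flatten [seq F j | j <- enum J] = F i.
Proof.
move=> F0; have := mem_enum J i; have := enum_uniq J.
have nil s : i \notin s -> flatten [seq F j | j <- s] = [::].
  elim: s => //= j s IH; rewrite inE negb_or eq_sym => /andP[ji /IH ->].
  by rewrite F0.
move=> u m; case/splitPr: m u => s1 s2; rewrite cat_uniq /= => /and3P[_ n1 /andP[n2 _]].
rewrite map_cat flatten_cat /= (nil s2) // (nil s1) ?cats0 //.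
by move: n1; rewrite negb_or => /andP[].
Qed.

Lemma perm_flatten_fibers (T : eqType) (U : eqType) (f : T -> U) (L : seq T) (s : seq U) :
  uniq s -> {in L, forall x, f x \in s} ->
  perm_eq (flatten [seq [seq x <- L | f x == u] | u <- s]) L.
Proof.
elim: s L => [|u s IH] L /=; first by case: L => // x L _ /(_ x (mem_head _ _)).
case/andP=> us uqs Ls; rewrite perm_sym -(perm_filterC (fun x => f x == u) L).
rewrite perm_cat2l perm_sym; set L' := [seq x <- L | _].
have -> : [seq [seq x <- L | f x == v] | v <- s] = [seq [seq x <- L' | f x == v] | v <- s].
  apply/eq_in_map => v vs; rewrite -filter_predI; apply: eq_filter => x /=.
  by case: eqP => //= ->; apply/esym; apply: contraNneq us => <-.
apply: IH => // x; rewrite mem_filter => /andP[/= xu /Ls].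
by rewrite inE (negPf xu).
Qed.

(** * A generator of the right-hand side is determined by its multiset of diagrams *)

Section DsumGenerators.
Context (K : fieldType) (V : vectType K).

Local Notation I := (diag_index V).
Local Notation R := (malg (cmonom I) K).

Lemma lex_gt_trans : transitive lex_gt.
Proof. by move=> [[a d] k] [[b e] l] [[c f] m]; rewrite /lex_gt; lia. Qed.

Lemma lex_gt_irr : irreflexive lex_gt.
Proof. by move=> [[a d] k]; rewrite /lex_gt; lia. Qed.

Definition has_tag (t : nat * nat * nat) (x : I) : bool := tag x == (t.1.2, t.2).

Section Term.
Context (s : seq (nat * nat * nat)).
Hypothesis s_sorted : sorted lex_gt s.

Lemma sorted_distinct (i j : 'I_(size s)) : i != j ->
  ((tnth (in_tuple s) i).1.2, (tnth (in_tuple s) i).2) !=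
  ((tnth (in_tuple s) j).1.2, (tnth (in_tuple s) j).2).
Proof.
have H (i' j' : 'I_(size s)) : (i' < j')%N ->
    ((tnth (in_tuple s) i').1.2, (tnth (in_tuple s) i').2) !=
    ((tnth (in_tuple s) j').1.2, (tnth (in_tuple s) j').2).
  move=> ij; rewrite !(tnth_nth (0, 0, 0)%N) /=.
  have := sorted_ltn_nth lex_gt_trans (0, 0, 0)%N s_sorted i' j' (ltn_ord i') (ltn_ord j') ij.
  by case: nth => -[a d] k; case: nth => -[b e] l; rewrite /lex_gt /= xpair_eqE; lia.
rewrite neq_ltn => /orP[/H //|/H]; by rewrite eq_sym.
Qed.

Context (P : I -> Prop) (L : seq I) (f : 'I_(size s) -> seq I)
  (z : family (fun i : 'I_(size s) => SymT V (tnth (in_tuple s) i))).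
Hypothesis fz : forall i, gen_sym P (f i) (z i).
Hypothesis Lf : L = flatten [seq f i | i <- enum 'I_(size s)].

(** The pairs (d_i, k_i) are distinct by strict sortedness, so the type of a diagram tells which
    tensor factor it comes from. *)
Lemma fiber_eq i : f i = seq.filter (has_tag (tnth (in_tuple s) i)) L.
Proof.
rewrite Lf filter_flatten -map_comp.
rewrite (flatten_delta (i := i) (F := seq.filter (has_tag (tnth (in_tuple s) i)) \o f)).
  apply/esym/all_filterP/allP => x xf; have [_ /(_ _ xf)[e _]] := gen_sym_tag (fz i).
  by rewrite /has_tag e.
move=> j ji /=; apply/eqP; rewrite -[_ == _]negbK -has_filter; apply/hasP => -[x xf].
have [_ /(_ _ xf)[e _]] := gen_sym_tag (fz j).
by rewrite /has_tag e (negPf (sorted_distinct ji)).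
Qed.

Lemma fiber_size i : (tnth (in_tuple s) i).1.1 = count (has_tag (tnth (in_tuple s) i)) L.
Proof. by rewrite -size_filter -fiber_eq; have [<- _] := gen_sym_tag (fz i). Qed.

Lemma mem_gen x : x \in L -> exists i, has_tag (tnth (in_tuple s) i) x /\ P x.
Proof.
rewrite Lf => /flattenP[_ /mapP[i _ ->] xf]; exists i.
by have [_ /(_ _ xf)[e Px]] := gen_sym_tag (fz i); rewrite /has_tag e.
Qed.

Hypothesis s_pos : all (fun t : nat * nat * nat => (0 < t.1.1)%N) s.

(** The right-hand side depends only on the multiset of [L]. As a strictly sorted list is determined
    by its members, the multiset determines the summand in which a generator lies. *)
Lemma mem_decomposition t : (t \in s) = (0 < t.1.1)%N && (t.1.1 == count (has_tag t) L).
Proof.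
apply/idP/andP => [ts|[t0 /eqP tc]].
  split; first exact: (allP s_pos).
  have /tnthP[i ti] : t \in in_tuple s by [].
  by rewrite ti; apply/eqP; apply: fiber_size.
have : has (has_tag t) L by rewrite has_count -tc.
case/hasP => x xL /eqP xt; have [i [/eqP xi _]] := mem_gen xL.
have e : has_tag t =1 has_tag (tnth (in_tuple s) i) by move=> y; rewrite /has_tag -xt xi.
have : t = tnth (in_tuple s) i.
  move: (fiber_size i); rewrite -(eq_count e) -tc.
  move: xi; rewrite xt; case: (tnth _ i) => -[a d] k; case: t {t0 tc xt e} => -[b d'] k' /=.
  by move=> [-> ->] ->.
by move=> ->; apply: mem_tnth.
Qed.

Lemma big_gen (g : nat * nat -> nat) :
  (\sum_(x <- L) g (tag x) = \sum_(t <- s) t.1.1 * g (t.1.2, t.2))%N.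
Proof.
rewrite Lf big_flatten big_map big_enum /= (big_nth (0, 0, 0)%N) big_mkord.
apply: eq_bigr => i _; have [sz tg] := gen_sym_tag (fz i).
rewrite (eq_big_seq (fun=> g ((tnth (in_tuple s) i).1.2, (tnth (in_tuple s) i).2))).
  by rewrite big_const_seq count_predT iter_addn_0 sz mulnC (tnth_nth (0, 0, 0)%N).
by move=> x /tg[-> _].
Qed.

End Term.

Context (d k : nat).

Local Notation target :=
  (dsum (fun pi : decomposition d k => decomposition_term V (val pi))).

Definition gen_dsum (P : I -> Prop) (L : seq I) (y : target) : Prop :=
  exists (pi : decomposition d k) (y' : decomposition_term V (val pi)),
    gen_term P L y' /\ y = dsum_inj (M := fun pi : decomposition d k =>
      decomposition_term V (val pi)) y'.

Lemma gen_dsum_lspan (P : I -> Prop) : (forall x, P x -> connI x) -> spans_connected P ->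
  forall y : target, lspan [set y | exists L, gen_dsum P L y]%classic y.
Proof.
move=> Pc Psp y.
pose G (pi : decomposition d k) : set (decomposition_term V (val pi)) :=
  [set y | exists L, gen_term P L y]%classic.
have Gsp (pi : decomposition d k) : forall y : decomposition_term V (val pi), lspan (G pi) y.
  exact: gen_term_lspan.
apply: (lspan_trans _ (@dsum_lspan K _ _ (fun pi : decomposition d k =>
  decomposition_term V (val pi)) G Gsp y)).
by move=> _ [pi [z [L Lz] ->]]; apply: lspan_mem; exists L, pi, z.
Qed.

Lemma gen_dsumW (P Q : I -> Prop) L y : (forall x, P x -> Q x) ->
  gen_dsum P L y -> gen_dsum Q L y.
Proof.
move=> PQ [pi [y' [[f [z [fz Lf ez]]] ey]]]; exists pi, y'; split=> //.
by exists f, z; split=> // i; apply: gen_symW PQ (fz i).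
Qed.

Lemma gen_dsum_prod (lin : forall d k, {linear B V d k -> R}) :
  exists psi : {linear target -> R}, forall L y,
    gen_dsum (@connI _ _) L y -> psi y = \prod_(x <- L) phiI lin x.
Proof.
pose psi (pi : decomposition d k) := projT1 (cid (gen_term_prod lin (val pi))).
have psiP pi L y : gen_term (@connI _ _) L y -> psi pi y = \prod_(x <- L) phiI lin x.
  by rewrite /psi; case: cid => p /= pE /pE.
have [T TE] := dsum_lift psi.
by exists T => L _ [pi [y [Ly ->]]]; rewrite TE; apply: psiP.
Qed.

Lemma gen_dsum_act g L y : gen_dsum (@connI _ _) L y ->
  gen_dsum (@connI _ _) (map (actI g) L) (rep_act target g y).
Proof.
case=> pi [y' [Ly ->]]; exists pi, (rep_act _ g y'); split; first exact: gen_term_act.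
exact: dsum_inj_act.
Qed.

Lemma decompositionP (pi : decomposition d k) : let s := val pi in
  [/\ all (fun t : nat * nat * nat => (0 < t.1.1)%N) s, sorted lex_gt s,
      (\sum_(t <- s) t.1.1 * t.1.2 = d)%N & (\sum_(t <- s) t.1.1 * t.2 = k)%N].
Proof.
have /and4P[pos /eqP sd /eqP sk so] := valP pi; split=> //.
by apply: sub_all pos => -[[a e] l] /andP[].
Qed.

Lemma gen_dsum_tot P L y : gen_dsum P L y -> dtot L = d /\ ktot L = k.
Proof.
case=> pi [_ [[f [z [fz Lf _]]] _]]; have [_ _ sd sk] := decompositionP pi.
rewrite /dtot /ktot (big_gen fz Lf (fun t => t.1)) (big_gen fz Lf (fun t => t.2)).
by split.
Qed.

Lemma gen_dsum_perm P L L' y y' : perm_eq L L' -> gen_dsum P L y -> gen_dsum P L' y' ->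
  y = y'.
Proof.
move=> LL' [pi [_ [[f [z [fz Lf ->]]] ->]]] [pi' [_ [[f' [z' [fz' Lf' ->]]] ->]]].
have [pos so _ _] := decompositionP pi; have [pos' so' _ _] := decompositionP pi'.
have e : pi = pi'.
  apply: val_inj; apply: (irr_sorted_eq lex_gt_trans lex_gt_irr so so') => t.
  rewrite (mem_decomposition so fz Lf pos) (mem_decomposition so' fz' Lf' pos').
  by rewrite (seq.permP LL').
move: f' z' fz' Lf' pos' so'; rewrite -e => f' z' fz' Lf' pos' so'.
congr dsum_inj; congr ptensor; apply/ffunP => i.
apply: gen_sym_perm (fz i) (fz' i).
by rewrite (fiber_eq so fz Lf) (fiber_eq so' fz' Lf') perm_filter.
Qed.

End DsumGenerators.

(** * Tensors with a given multiset of diagrams, and the action on disjoint unions *)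

Section Existence.
Context (K : fieldType) (V : vectType K).

Local Notation I := (diag_index V).

(** The weak order, since sorting asks for a total relation; it becomes the strict [lex_gt] once
    duplicates are removed. *)
Definition type_ge (t u : nat * nat) : bool :=
  ((u.1 < t.1) || ((u.1 == t.1) && (u.2 <= t.2)))%N.

Definition types (L : seq I) : seq (nat * nat) :=
  sort type_ge (undup [seq tag x | x <- L]).

Definition type_seq (L : seq I) : seq (nat * nat * nat) :=
  [seq (count (fun x => tag x == t) L, t.1, t.2) | t <- types L].

Lemma types_uniq L : uniq (types L).
Proof. by rewrite sort_uniq undup_uniq. Qed.

Lemma mem_types L : {in L, forall x, tag x \in types L}.
Proof. by move=> x xL; rewrite mem_sort mem_undup map_f. Qed.

Lemma type_seq_sorted L : sorted lex_gt (type_seq L).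
Proof.
have tot : total type_ge by move=> [a b] [c e]; rewrite /type_ge /=; lia.
have tr : transitive type_ge by move=> [a b] [c e] [g h]; rewrite /type_ge /=; lia.
have so : sorted type_ge (types L) by apply: sort_sorted.
have un := types_uniq L.
rewrite sorted_map; move: so un; case: (types L) => // t s.
elim: s t => //= u s IH t /andP[tu us] /andP[ts un].
rewrite IH // andbT; move: tu ts; rewrite inE negb_or => + /andP[+ _].
by case: t u {IH us un} => [a b] [c e]; rewrite /type_ge /lex_gt /= xpair_eqE; lia.
Qed.

Lemma type_seq_sum L (g : nat * nat -> nat) :
  (\sum_(t <- type_seq L) t.1.1 * g (t.1.2, t.2) = \sum_(x <- L) g (tag x))%N.
Proof.
have p := perm_flatten_fibers (types_uniq L) (@mem_types L).
rewrite -(perm_big _ p) /= big_flatten !big_map /=; apply: eq_bigr => t _.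
rewrite big_filter (eq_bigr (fun=> g t)) => [|x /eqP -> //].
by rewrite big_const_seq iter_addn_0 mulnC; case: t.
Qed.

Lemma type_seq_decomposition L : (forall x, x \in L -> good (tag x).1 (tag x).2) ->
  is_decomposition (dtot L) (ktot L) (type_seq L).
Proof.
move=> Lg; apply/and4P; split.
- apply/allP => _ /mapP[t tL ->]; move: tL; rewrite mem_sort mem_undup.
  case/mapP => x xL ->; rewrite Lg // andbT -has_count; apply/hasP; by exists x.
- by rewrite (type_seq_sum L (fun t => t.1)).
- by rewrite (type_seq_sum L (fun t => t.2)).
- exact: type_seq_sorted.
Qed.

(** [L'] is [L] regrouped by type in decreasing order, with one symmetric power for each type that
    occurs; goodness of the types makes this an admissible decomposition. *)
Lemma gen_dsum_exists (P : I -> Prop) d k L :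
  (forall x, x \in L -> P x /\ good (tag x).1 (tag x).2) -> dtot L = d -> ktot L = k ->
  exists L' (y : dsum (fun pi : decomposition d k => decomposition_term V (val pi))),
    perm_eq L' L /\ gen_dsum P L' y.
Proof.
move=> LP dL kL.
have dec : is_decomposition d k (type_seq L).
  by rewrite -dL -kL; apply: type_seq_decomposition => x /LP[].
set s := type_seq L in dec.
have H (i : 'I_(size s)) : exists y : SymT V (tnth (in_tuple s) i),
    gen_sym P [seq x <- L | has_tag (tnth (in_tuple s) i) x] y.
  have : (tnth (in_tuple s) i).1.1 = size [seq x <- L | has_tag (tnth (in_tuple s) i) x].
    have /mapP[t _ ->] : tnth (in_tuple s) i \in type_seq L by apply: mem_tnth.
    by rewrite size_filter; apply: eq_count => x; case: t.
  have : forall x, x \in [seq x <- L | has_tag (tnth (in_tuple s) i) x] ->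
      tag x = ((tnth (in_tuple s) i).1.2, (tnth (in_tuple s) i).2) /\ P x.
    by move=> x; rewrite mem_filter => /andP[/eqP -> /LP[]].
  case: (tnth _ i) => -[a e] l H1 H2.
  exact: gen_sym_exists (esym H2) H1.
pose z : family (fun i : 'I_(size s) => SymT V (tnth (in_tuple s) i)) :=
  [ffun i => projT1 (cid (H i))].
have zP i : gen_sym P [seq x <- L | has_tag (tnth (in_tuple s) i) x] (z i).
  by rewrite ffunE; case: cid.
pose f (i : 'I_(size s)) := [seq x <- L | has_tag (tnth (in_tuple s) i) x].
exists (flatten [seq f i | i <- enum 'I_(size s)]).
exists (dsum_inj (M := fun pi : decomposition d k => decomposition_term V (val pi))
  (i := exist _ s dec) (ptensor z)).
split; last by exists (exist _ s dec), (ptensor z); split=> //; exists f, z.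
have -> : [seq f i | i <- enum 'I_(size s)] =
    [seq [seq x <- L | tag x == t] | t <- types L].
  rewrite -[RHS]map_id.
  have -> : [seq f i | i <- enum 'I_(size s)] =
      [seq [seq x <- L | has_tag t x] | t <- [seq tnth (in_tuple s) i | i <- enum 'I_(size s)]].
    by rewrite -map_comp.
  rewrite map_tnth_enum /= map_id -map_comp; apply: eq_map => t /=.
  by apply: eq_filter => x; rewrite /has_tag; case: t.
exact: perm_flatten_fibers (types_uniq L) (@mem_types L).
Qed.

Lemma std_act g d k (D : diagram V d k) :
  riso (std (diagram_act g D)) (recol (fun h : std D => val g (col h))).
Proof.
by apply: riso_id => // h /eqP; rewrite next_eq; case: h => //= j _; rewrite ffunE.
Qed.

Lemma cls_act g d k (X : raw V) (D : diagram V d k) : riso (std D) X ->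
  rep_act (B V d k) g (cls d k X) = cls d k (recol (fun h : X => val g (col h))).
Proof.
move=> DX; rewrite (cls_std DX) diagram_class_act -(cls_std (riso_refl _)).
apply: cls_iso; apply: riso_trans (std_act g D) _.
case: DX => f [f1 f2 f3 f4] bf; exists f => //; split=> // h nh.
by rewrite /= f4.
Qed.

Lemma rlist_act g (L : seq I) :
  riso (rlist (map (actI g) L)) (recol (fun h : rlist L => val g (col h))).
Proof.
elim: L => [|x L IH] /=; first by apply: riso_id => // -[].
apply: riso_trans (rsum_riso (std_act g (tagged x)) IH) _.
by apply: riso_id => // -[].
Qed.

End Existence.

(** * The isomorphism and its equivariance *)

Theorem theorem7p2 (K : fieldType) (charK : [pchar K]%R =i pred0)
    (n : nat) (V : vectType K) (dimV : \dim {:V} = n) (d k : nat) :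
  rep_isomorphic (B V d k)
    (dsum (fun pi : decomposition d k => decomposition_term V (val pi))).
Proof.
have char2 : (2%:R : K) != 0 by rewrite ((pcharf0P K).1 charK).
have char3 : (3%:R : K) != 0 by rewrite ((pcharf0P K).1 charK).
set T := dsum _.
have [P [lin [Pc Psp Pv]]] := exists_basis V.
have Pgood := basis_good char2 char3 Pc Pv.
have [F FE] := exists_PhiB lin d k.
have [G GE] := gen_dsum_prod d k lin.
have phiP (L : seq (diag_index V)) : (forall x, x \in L -> P x) ->
    \prod_(x <- L) phiI lin x = mon K L.
  by move=> LP; apply: eq_big_seq => x /LP; apply: Pv.
have conP (L : seq (diag_index V)) : (forall x, x \in L -> P x) -> all (@connI _ _) L.
  by move=> LP; apply/allP => x /LP; apply: Pc.
have FL L : (forall x, x \in L -> P x) -> dtot L = d -> ktot L = k ->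
    F (cls d k (rlist L)) = mon K L.
  by move=> LP dL kL; rewrite FE ?phiP //; apply: conP.
have memP Q L (y : T) : gen_dsum Q L y -> forall x, x \in L -> Q x.
  by case=> pi [_ [[f [z [fz Lf _]]] _]] x xL; have [i []] := mem_gen fz Lf xL.
have GL' L (y : T) : gen_dsum P L y -> G y = mon K L.
  move=> Ly; rewrite (GE L) ?phiP //; first exact: memP Ly.
  exact: gen_dsumW Pc Ly.
have Finj : injective F.
  apply: (@mon_spanned_inj K _ _ F (fun L x => [/\ forall y, y \in L -> P y,
      dtot L = d, ktot L = k & x = cls d k (rlist L)])).
  - move=> x; apply: (lspan_trans _ (cls_lspan Pc Psp x)) => _ [L [LP dL kL] <-].
    by apply: lspan_mem; exists L.
  - by move=> L x [LP dL kL ->]; apply: FL.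
  - by move=> L L' x y LL' [_ _ _ ->] [_ _ _ ->]; apply: cls_iso; apply: rlist_perm.
have Ginj : injective G.
  apply: (@mon_spanned_inj K _ _ G (@gen_dsum K V d k P)).
  - exact: gen_dsum_lspan.
  - by move=> L x; apply: GL'.
  - by move=> L L' x y; apply: gen_dsum_perm.
have FG x : exists y, G y = F x.
  elim: (cls_lspan Pc Psp x) => [|a _ w [L [LP dL kL] <-] _ [y yE]].
    by exists 0; rewrite !linear0.
  (* Here [Pgood] enters: a disjoint union of basis diagrams has a matching tensor only because all
     its components have good types. *)
  have [|L' [y' [LL' Ly']]] := @gen_dsum_exists K V P d k L _ dL kL.
    by move=> u uL; split; [apply: LP | apply/Pgood/LP].
  have e : mon K L' = mon K L by apply: perm_big.
  have lG := linearP G a y' y.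
  have lF := linearP F a (cls d k (rlist L)) w.
  exists (a *: (y' : T) + y).
  apply: (etrans lG); apply/esym; apply: (etrans lF).
  apply: (congr2 (fun u v => a *: u + v)); last exact: esym yE.
  exact: etrans (FL L LP dL kL) (etrans (esym e) (esym (GL' _ _ Ly'))).
have GF y : exists x, F x = G y.
  elim: (gen_dsum_lspan Pc Psp y) => [|a z w [L Lz] _ [x xE]].
    by exists 0; rewrite !linear0.
  have [dL kL] := gen_dsum_tot Lz.
  exists (a *: cls d k (rlist L) + x).
  have lF := linearP F a (cls d k (rlist L)) x; apply: (etrans lF).
  have lG := linearP G a z w; apply/esym; apply: (etrans lG).
  apply: (congr2 (fun u v => a *: u + v)); last exact: esym xE.
  exact: etrans (GL' _ _ Lz) (esym (FL L (memP _ _ _ Lz) dL kL)).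
have [h [hbij hE]] := linear_iso_of_inj Finj Ginj FG GF.
exists h; split=> // g x.
(* Stated for all connected diagrams, because acting on the colors leads out of the chosen bases.
   Both sides have the same image in [R], the product of the expansions of the components. *)
have hgen L y : gen_dsum (@connI _ _) L y -> h (cls d k (rlist L)) = y.
  move=> Ly; apply: Ginj; have [dL kL] := gen_dsum_tot Ly.
  by rewrite hE FE ?(GE L) //; apply/allP; apply: memP Ly.
have [h' hK h'K] := hbij.
(* Equivariance is tested on generators of the target, through the inverse of [h]. Every one of them
   has a disjoint union, whereas a disjoint union with a component of bad type has no matching
   tensor. *)
have [h'' h''E] : exists h'' : {linear T -> B V d k}, h'' =1 h'.
  by apply: exists_linear => a u v; apply: (can_inj hK); rewrite linearP !h'K.
have cS : spans_connected (fun x : diag_index V => connI x).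
  by move=> d' k' D cD; apply: lspan_mem; exists D.
suff key : forall y : T, h (rep_act (B V d k) g (h'' y)) = rep_act T g y.
  by rewrite -[x]hK -!h''E key h''E h'K.
move=> y; have sp : lspan [set z : T | exists L, gen_dsum (@connI _ _) L z]%classic y.
  exact: gen_dsum_lspan.
apply: (lspan_eq_lin (f := h \o rep_act (B V d k) g \o h'') (g := rep_act T g) _ sp).
move=> z [L Lz].
have [dL kL] := gen_dsum_tot Lz.
have [D DL] := rlist_std L; rewrite dL kL in D DL.
have e1 : h'' z = cls d k (rlist L) by rewrite h''E -(hgen _ _ Lz) hK.
rewrite -[LHS]/(h (rep_act (B V d k) g (h'' z))) e1 (cls_act g DL).
rewrite -(cls_iso _ _ (rlist_act g L)).
by apply: hgen; apply: gen_dsum_act.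
Qed.
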